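(* Let $W$ be the Weyl group of a finite crystallographic root system. The following equivalent statements hold for $W$: (i) Every element of $W$ is expressible as the product of two involutions of $W$. (ii) Every element of $W$ is contained in some dihedral subgroup of $W$. (iii) For each element $w \in W$ there is an involution $i \in W$ such that $iwi = w^{-1}$.
   Context: An involution of $W$ here means an element $i \in W$ with $i^2 = 1$ (the identity element is allowed). A dihedral subgroup of $W$ means a subgroup generated by two involutions in this sense (degenerate cases allowed). The Weyl group $W$ is the group generated by the reflections $s_\tau$, $\tau \in \Phi$, where $\Phi$ is a finite crystallographic root system. *)

(* Defs.v *)
From HB Require Import structures.
From mathcomp Require Import all_boot all_order all_algebra.
From mathcomp Require Import finmap reals.

Set Implicit Arguments.
Unset Strict Implicit.
Unset Printing Implicit Defensive.

Import Order.TTheory GRing.Theory Num.Theory.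
Local Open Scope ring_scope.

(* The Euclidean space is 'cV[R]_n with its standard inner product; a linear
   map is a matrix acting on the left, so that A *m B is A after B. *)
Section RootSystems.

Variables (R : realType) (n : nat).
Implicit Types (u v t : 'cV[R]_n) (A B : 'M[R]_n) (S W D : 'M[R]_n -> Prop).
Implicit Types (Phi : {fset 'cV[R]_n}).

Definition dotp u v : R := \sum_(k < n) u k 0 * v k 0.

Definition refl t v : 'cV[R]_n := v - (2 * dotp v t / dotp t t) *: t.

(* The matrix of refl t; see reflmxE. *)
Definition reflmx t : 'M[R]_n := 1%:M - (2 / dotp t t) *: (t *m t^T).

(* Neither "Phi spans the space" nor "Phi is reduced" is required: conventions
   differ on both axioms, and this definition covers all of them. *)
Definition crystallographic_root_system Phi : Prop :=
  [/\ forall a, a \in Phi -> a != 0,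
      forall a b, a \in Phi -> b \in Phi -> refl a b \in Phi
    & forall a b, a \in Phi -> b \in Phi ->
        2 * dotp b a / dotp a a \is a Num.int].

(* The subgroup of GL_n(R) generated by a set S of invertible matrices. *)
Inductive generated S : 'M[R]_n -> Prop :=
| generated_gen A : S A -> generated S A
| generated_1 : generated S 1%:M
| generated_mul A B : generated S A -> generated S B -> generated S (A *m B)
| generated_inv A : generated S A -> generated S (invmx A).

Definition weyl_group Phi : 'M[R]_n -> Prop :=
  generated (fun A => exists2 t, t \in Phi & A = reflmx t).

(* The identity counts as an involution. *)
Definition involution_of W A : Prop := W A /\ A *m A = 1%:M.

Definition dihedral_subgroup_of W D : Prop :=
  exists i j, [/\ involution_of W i, involution_of W j
    & forall A, D A <-> generated (fun B => B = i \/ B = j) A].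

Lemma reflmxE t v : reflmx t *m v = refl t v.
Proof.
rewrite /reflmx /refl mulmxBl mul1mx -scalemxAl -mulmxA.
have -> : t^T *m v = (dotp v t)%:M.
  apply/matrixP => i j; rewrite !ord1 !mxE eqxx mulr1n.
  by apply: eq_bigr => k _; rewrite !mxE mulrC.
by rewrite mul_mx_scalar scalerA mulrAC.
Qed.

End RootSystems.

(* Main.v *)
(* Call a group strongly real if every element w of it admits an involution i of
   the group with (i w)^2 = 1; then w = i (i w), and i w i = w^-1.

   The indecomposable positive roots of Phi, rescaled to squared length 2, have
   pairwise inner products 0, -1, -sqrt 2 or -sqrt 3 and their reflections
   generate the Weyl group. Adding one root at a time, positive definiteness
   leaves for each connected component only the types A, B, D, E, F, G.

   In types A, B and D the group permutes the vertices of a simplex or the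
   signed vectors of an orthonormal frame. The abelian group generated by w and
   -1 acts on these points, and sending g x to g^-1 x on the orbit of each base
   point x is an involution inverting w; in type D it is made even by composing
   it, if necessary, with w on a single orbit on which w is an odd cycle.

   In the exceptional types a finite list of products of two involutions is
   verified to be stable, up to conjugation and a central sign, under left
   multiplication by reflections; hence it meets every conjugacy class up to
   that sign. *)

From Stdlib Require Import BinInt.
From HB Require Import structures.
From mathcomp Require Import all_boot all_order all_algebra all_fingroup.
From mathcomp Require Import finmap reals ring lra zify ssrZ.
Require Import Defs.

Set Implicit Arguments.
Unset Strict Implicit.
Unset Printing Implicit Defensive.

Import Order.TTheory GRing.Theory Num.Theory.
Local Open Scope ring_scope.

(** * Groups generated by reflections *)

(** An element of a reflection group that fixes every generating root is the identity, even if the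
    roots do not span the space. All identities between matrices are therefore checked on finite
    data: permutations of points in types A, B and D, integer coordinates in the others.

    Equal root lengths merge types B and C and make the diagrams F4 and G2 symmetric. A diagram is
    excluded by a vector [b + y], with [y] in the span of the roots collected so far, whose squared
    length would not be positive: [y] comes from the null vector of an affine diagram, from a
    highest root or fundamental weight, or, in types B and D, from minus the projection of [b] onto
    an orthonormal frame. Since the new root may attach anywhere, an extension yields its diagram
    only up to a permutation of the list, which does not change the group.

    A central sign costs nothing: if [w] is conjugate to [z l r] with [z] central and
    [z^2 = l^2 = r^2 = 1], the corresponding conjugate of [l] still inverts [w], because
    [l z l r = z r] is an involution. *)

Section GeneratedGroups.

Variables (R : realType) (n : nat).
Implicit Types (A B : 'M[R]_n) (S G : 'M[R]_n -> Prop).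

Definition involutive_set S := forall A, S A -> A *m A = 1%:M.

Lemma mulmx_eq1_invmx A B : A *m B = 1%:M -> invmx A = B.
Proof.
move=> AB1; have [uA _] := mulmx1_unit AB1.
by rewrite -[B](mulKmx uA) AB1 mulmx1.
Qed.

Lemma generated_sub S G A :
  (forall B, S B -> generated G B) -> generated S A -> generated G A.
Proof.
move=> SG; elim=> {A} [A /SG //||A B _ GA _ GB|A _ GA].
- exact: generated_1.
- exact: generated_mul.
- exact: generated_inv.
Qed.

(** Closure under [invmx] is meaningful only for invertible matrices; all elements are invertible
    here because each generator is its own inverse. *)
Lemma generated_unit S A :
  involutive_set S -> generated S A -> A *m invmx A = 1%:M.
Proof.
move=> invS gA; apply: mulmxV; elim: gA => {A} [A SA||A B _ uA _ uB|A _ uA].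
- by case: (mulmx1_unit (invS _ SA)).
- exact: unitmx1.
- by rewrite unitmx_mul uA uB.
- by rewrite unitmx_inv.
Qed.

Lemma generated_ind_word S (P : 'M[R]_n -> Prop) :
    involutive_set S -> P 1%:M ->
    (forall A B, S A -> generated S B -> P B -> P (A *m B)) ->
  forall A, generated S A -> P A.
Proof.
move=> invS P1 PM A gA.
suff: forall B, generated S B -> P B -> P (A *m B).
  by move/(_ _ (generated_1 S) P1); rewrite mulmx1.
(* [A] and its inverse are treated together, so that the case of an inverse merely exchanges the two
   claims. *)
suff [H _] : (forall B, generated S B -> P B -> P (A *m B)) /\
             (forall B, generated S B -> P B -> P (invmx A *m B)) by [].
elim: gA => {A} [A SA||A B gA [IA IA'] gB [IB IB']|A gA [IA IA']].
- have -> : invmx A = A by exact: mulmx_eq1_invmx (invS _ SA).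
  by split=> B gB PB; apply: PM.
- by rewrite (mulmx_eq1_invmx (mul1mx _)); split=> B gB; rewrite mul1mx.
- have -> : invmx (A *m B) = invmx B *m invmx A.
    apply: mulmx_eq1_invmx.
    rewrite mulmxA -(mulmxA A) (generated_unit invS gB) mulmx1.
    exact: generated_unit gA.
  split=> C gC PC; rewrite -mulmxA.
    by apply: IA; [exact: generated_mul|exact: IB].
  by apply: IB'; [apply: generated_mul (generated_inv gA) gC|exact: IA'].
- by rewrite invmxK; split.
Qed.

Definition strongly_real G := forall w, G w -> exists i,
  [/\ G i, i *m i = 1%:M & (i *m w) *m (i *m w) = 1%:M].

Lemma strongly_real_eq G H :
  (forall A, G A <-> H A) -> strongly_real G -> strongly_real H.
Proof.
move=> GH srG w /GH /srG[i [Gi i2 iw2]].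
by exists i; split=> //; apply/GH.
Qed.

Lemma strongly_real_trivial S :
  (forall A, ~ S A) -> strongly_real (generated S).
Proof.
move=> S0 w gw; exists 1%:M; split; [exact: generated_1|by rewrite mulmx1|].
have -> : w = 1%:M.
  by elim/generated_ind_word: gw => [A /S0|//|A B /S0].
by rewrite !mulmx1.
Qed.

Lemma generated_commute S T A B :
    involutive_set S -> involutive_set T ->
    (forall C D, S C -> T D -> C *m D = D *m C) ->
  generated S A -> generated T B -> A *m B = B *m A.
Proof.
move=> invS invT ST gA gB.
elim/generated_ind_word: gA => // [|C D SC gD DB]; first by rewrite mul1mx mulmx1.
rewrite -mulmxA DB !mulmxA; congr (_ *m D).
elim/generated_ind_word: gB {DB} => // [|E F TE gF CF].
  by rewrite mul1mx mulmx1.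
by rewrite -mulmxA -CF !mulmxA; congr (_ *m F); apply: ST.
Qed.

(** Every element is [a *m b] with [a] and [b] in the two commuting factors. If [i] inverts [a] and
    [j] inverts [b], then [(i j)(a b) = (i a)(j b)] is a product of commuting involutions. *)
Lemma strongly_real_commuting S T :
    involutive_set S -> involutive_set T ->
    (forall C D, S C -> T D -> C *m D = D *m C) ->
    strongly_real (generated S) -> strongly_real (generated T) ->
  strongly_real (generated (fun A => S A \/ T A)).
Proof.
move=> invS invT ST srS srT w gw.
have gS A : generated S A -> generated (fun A => S A \/ T A) A.
  by apply: generated_sub => B SB; apply: generated_gen; left.
have gT A : generated T A -> generated (fun A => S A \/ T A) A.
  by apply: generated_sub => B SB; apply: generated_gen; right.
have comm A B := @generated_commute S T A B invS invT ST.
have [a [b [ga gb ->]]] : exists a b, [/\ generated S a, generated T b & w = a *m b].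
  have invST : involutive_set (fun A => S A \/ T A) by move=> A [/invS|/invT].
  elim/generated_ind_word: gw => // [|C D [SC|TC] gD [a [b [ga gb ->]]]].
  - by exists 1%:M, 1%:M; split; [exact: generated_1|exact: generated_1|rewrite mulmx1].
  - exists (C *m a), b; split=> //; last by rewrite mulmxA.
    by apply: generated_mul ga; apply: generated_gen.
  - have gC : generated T C by exact: generated_gen.
    exists a, (C *m b); split=> //; first exact: generated_mul.
    by rewrite !mulmxA (comm a C).
have [i [gi i2 ia2]] := srS _ ga; have [j [gj j2 jb2]] := srT _ gb.
exists (i *m j); split.
- by apply: generated_mul; [apply: gS|apply: gT].
- by rewrite -mulmxA (mulmxA j) -(comm i j) // -(mulmxA i) mulmxA i2 j2 mulmx1.
- have -> : i *m j *m (a *m b) = (i *m a) *m (j *m b).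
    by rewrite -!mulmxA; congr (i *m _); rewrite !mulmxA (comm a j).
  have gia : generated S (i *m a) by exact: generated_mul.
  have gjb : generated T (j *m b) by exact: generated_mul.
  rewrite -mulmxA (mulmxA (j *m b)) -(comm (i *m a) (j *m b)) // -(mulmxA (i *m a)).
  by rewrite mulmxA ia2 jb2 mulmx1.
Qed.

End GeneratedGroups.

(** * Inner products, reflections and the faithful action on the roots *)

Section Reflections.

Variables (R : realType) (n : nat).
Implicit Types (A B : 'M[R]_n) (S G : 'M[R]_n -> Prop) (u v t x y : 'cV[R]_n).

Lemma dotpE u v : dotp u v = (u^T *m v) 0 0.
Proof. by rewrite mxE; apply: eq_bigr => k _; rewrite mxE. Qed.

Lemma dotpC u v : dotp u v = dotp v u.
Proof. by apply: eq_bigr => k _; rewrite mulrC. Qed.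

Lemma dotpDl x y v : dotp (x + y) v = dotp x v + dotp y v.
Proof. by rewrite !dotpE linearD mulmxDl mxE. Qed.

Lemma dotpZl a x v : dotp (a *: x) v = a * dotp x v.
Proof. by rewrite !dotpE linearZ -scalemxAl mxE. Qed.

Lemma dotp0l v : dotp 0 v = 0.
Proof. by rewrite !dotpE linear0 mul0mx mxE. Qed.

Lemma dotpNl x v : dotp (- x) v = - dotp x v.
Proof. by rewrite -scaleN1r dotpZl mulN1r. Qed.

Lemma dotpBl x y v : dotp (x - y) v = dotp x v - dotp y v.
Proof. by rewrite dotpDl dotpNl. Qed.

Lemma dotpDr x y v : dotp v (x + y) = dotp v x + dotp v y.
Proof. by rewrite dotpC dotpDl !(dotpC v). Qed.

Lemma dotpZr a x v : dotp v (a *: x) = a * dotp v x.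
Proof. by rewrite dotpC dotpZl dotpC. Qed.

Lemma dotp0r v : dotp v 0 = 0.
Proof. by rewrite dotpC dotp0l. Qed.

Lemma dotpNr x v : dotp v (- x) = - dotp v x.
Proof. by rewrite dotpC dotpNl dotpC. Qed.

Lemma dotpBr x y v : dotp v (x - y) = dotp v x - dotp v y.
Proof. by rewrite dotpDr dotpNr. Qed.

Lemma dotp_suml I (r : seq I) P (F : I -> 'cV[R]_n) v :
  dotp (\sum_(i <- r | P i) F i) v = \sum_(i <- r | P i) dotp (F i) v.
Proof.
by apply: (big_morph (fun x => dotp x v)) => [x y|]; rewrite ?dotpDl ?dotp0l.
Qed.

Lemma dotp_sumr I (r : seq I) P (F : I -> 'cV[R]_n) v :
  dotp v (\sum_(i <- r | P i) F i) = \sum_(i <- r | P i) dotp v (F i).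
Proof. by rewrite dotpC dotp_suml; apply: eq_bigr => i _; rewrite dotpC. Qed.

Definition dotp_lin :=
  (dotpDl, dotpDr, dotpBl, dotpBr, dotpNl, dotpNr, dotpZl, dotpZr, dotp0l, dotp0r).

Lemma dotp_ge0 v : 0 <= dotp v v.
Proof. by apply: sumr_ge0 => k _; rewrite -expr2 sqr_ge0. Qed.

Lemma dotp_eq0 v : (dotp v v == 0) = (v == 0).
Proof.
apply/idP/eqP => [|->]; last by rewrite dotp0l.
rewrite psumr_eq0 => [/allP v0|k _]; last by rewrite -expr2 sqr_ge0.
apply/matrixP => k j; rewrite ord1 mxE.
by have := v0 k (mem_index_enum k); rewrite /= mulf_eq0 orbb => /eqP.
Qed.

Lemma dotp_gt0 v : (0 < dotp v v) = (v != 0).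
Proof. by rewrite lt_def dotp_ge0 andbT dotp_eq0. Qed.

Lemma reflmxEl t v : reflmx t *m v = v - (2 * dotp v t / dotp t t) *: t.
Proof. exact: reflmxE. Qed.

Lemma reflmx_orthogonal t x : dotp x t = 0 -> reflmx t *m x = x.
Proof. by move=> xt; rewrite reflmxEl xt mulr0 mul0r scale0r subr0. Qed.

Lemma colmx_eq A B : (forall v : 'cV[R]_n, A *m v = B *m v) -> A = B.
Proof.
move=> AB; apply/matrixP => i j.
have := AB (delta_mx j 0); rewrite -!colE => /matrixP /(_ i 0).
by rewrite !mxE.
Qed.

Lemma reflmxK t : reflmx t *m reflmx t = 1%:M.
Proof.
apply: colmx_eq => v; rewrite -mulmxA mul1mx !reflmxEl.
(* The zero vector yields the identity matrix, because the coefficient multiplies [0]. *)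
have [->|t0] := eqVneq t 0; first by rewrite !scaler0 !subr0.
have tt : dotp t t != 0 by rewrite dotp_eq0.
rewrite dotpBl dotpZl -addrA -opprD -scalerDl.
set c := (X in X *: t); suff -> : c = 0 by rewrite scale0r subr0.
by rewrite /c; field.
Qed.

Lemma reflmxZ a t : a != 0 -> reflmx (a *: t) = reflmx t.
Proof.
move=> a0; apply: colmx_eq => v; rewrite !reflmxEl scalerA; congr (_ - _ *: _).
have [->|t0] := eqVneq t 0; first by rewrite scaler0 !dotp0r !mulr0 !mul0r.
have tt : dotp t t != 0 by rewrite dotp_eq0.
by rewrite !dotp_lin; field; rewrite a0 tt.
Qed.

Lemma reflmx_opp t : reflmx (- t) = reflmx t.
Proof. by rewrite -scaleN1r reflmxZ // oppr_eq0 oner_eq0. Qed.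

Definition orthogonal_mx A := forall x y, dotp (A *m x) (A *m y) = dotp x y.

Lemma orthogonal_reflmx t : orthogonal_mx (reflmx t).
Proof.
move=> x y; rewrite !reflmxEl.
have [->|t0] := eqVneq t 0; first by rewrite !scaler0 !subr0.
have tt : dotp t t != 0 by rewrite dotp_eq0.
by rewrite !dotp_lin (dotpC t y); field.
Qed.

Definition refl_group (K : seq 'cV[R]_n) :=
  generated (fun A : 'M[R]_n => exists2 t, t \in K & A = reflmx t).

Lemma refl_group_involutive (K : seq 'cV[R]_n) :
  involutive_set (fun A : 'M[R]_n => exists2 t, t \in K & A = reflmx t).
Proof. by move=> _ [t _ ->]; apply: reflmxK. Qed.

Implicit Types (K L : seq 'cV[R]_n).

Lemma refl_group_gen K t : t \in K -> refl_group K (reflmx t).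
Proof. by move=> tK; apply: generated_gen; exists t. Qed.

Lemma refl_group_ind K (P : 'M[R]_n -> Prop) :
    P 1%:M -> (forall t A, t \in K -> refl_group K A -> P A -> P (reflmx t *m A)) ->
  forall A, refl_group K A -> P A.
Proof.
move=> P1 PM; apply: generated_ind_word => //; first exact: refl_group_involutive.
by move=> _ B [t tK ->]; apply: PM.
Qed.

Lemma refl_group_sub K L A :
  (forall t, t \in K -> refl_group L (reflmx t)) -> refl_group K A -> refl_group L A.
Proof. by move=> KL; apply: generated_sub => _ [t tK ->]; apply: KL. Qed.

Lemma refl_group_eq K L : K =i L -> forall A, refl_group K A <-> refl_group L A.
Proof.
by move=> KL A; split; apply: refl_group_sub => t tK;
  apply: refl_group_gen; rewrite -?KL // KL.
Qed.

Lemma refl_group_orthogonal K A : refl_group K A -> orthogonal_mx A.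
Proof.
elim/refl_group_ind => {A} [x y|t A _ _ oA x y]; first by rewrite !mul1mx.
by rewrite -!mulmxA orthogonal_reflmx oA.
Qed.

Lemma orthogonal_conj_reflmx A t :
  orthogonal_mx A -> A *m reflmx t = reflmx (A *m t) *m A.
Proof.
move=> oA; apply: colmx_eq => v.
by rewrite -!mulmxA !reflmxEl mulmxBr -scalemxAr !oA.
Qed.

Lemma refl_group_unit K A : refl_group K A -> A *m invmx A = 1%:M.
Proof. exact: (generated_unit (@refl_group_involutive K)). Qed.

(** This is the source of reflections outside the generating list: an element of the group carries a
    known root to a new one, and conjugation carries the reflection along. *)
Lemma refl_group_conj K A t :
  refl_group K A -> refl_group K (reflmx t) -> refl_group K (reflmx (A *m t)).
Proof.
move=> gA gt; suff -> : reflmx (A *m t) = A *m reflmx t *m invmx A.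
  by apply: generated_mul (generated_inv gA); apply: generated_mul.
rewrite (orthogonal_conj_reflmx _ (refl_group_orthogonal gA)) -mulmxA.
by rewrite (refl_group_unit gA) mulmx1.
Qed.

(* [A v - v] lies in the span of [K], and it is orthogonal to [K] when [A] is
   an isometry fixing [K]; so it vanishes. *)
Lemma refl_group_faithful K A :
  refl_group K A -> (forall t, t \in K -> A *m t = t) -> A = 1%:M.
Proof.
move=> gA fixK; apply: colmx_eq => v; rewrite mul1mx.
have spanA : forall v, exists c : nat -> R,
    A *m v - v = \sum_(i < size K) c i *: nth 0 K i.
  elim/refl_group_ind: gA {fixK} => [{}v|t B tK _ IH {}v].
    exists (fun=> 0); rewrite mul1mx subrr big1 // => i _.
    by rewrite scale0r.
  have [c cE] := IH v; have it : (index t K < size K)%N by rewrite index_mem.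
  (* Only the coefficient at the first occurrence of [t] is changed, as [K] may contain
     repetitions. *)
  exists (fun i => c i - (i == index t K)%:R * (2 * dotp (B *m v) t / dotp t t)).
  under eq_bigr do rewrite scalerBl.
  rewrite big_split /= -cE sumrN (bigD1 (Ordinal it)) //= eqxx mul1r nth_index //.
  rewrite big1 ?addr0 => [|i /negbTE ne]; last first.
    by rewrite -val_eqE /= in ne; rewrite ne mul0r scale0r.
  by rewrite -mulmxA reflmxEl addrAC.
have [c cE] := spanA v.
apply/eqP; rewrite -subr_eq0 -dotp_eq0 {2}cE dotp_sumr big1 // => i _.
rewrite dotpZr dotpBl; have tK : nth 0 K i \in K by apply: mem_nth.
by rewrite -{1}(fixK _ tK) (refl_group_orthogonal gA) subrr mulr0.
Qed.

End Reflections.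

(** * Classification of simple systems *)

Ltac gram_lia := do !case: ifP => //; move=> *; exfalso; lia.

Section Diagrams.

Variables (R : realType) (n : nat).
Implicit Types (K L : seq 'cV[R]_n) (b t x y : 'cV[R]_n) (g : nat -> nat -> R).

Let rt2 : R := Num.sqrt 2.
Let rt3 : R := Num.sqrt 3.

(** These are the inner products of vectors of squared length 2 at angles of 90, 120, 135 and 150
    degrees, that is, minus the square roots of 0, 1, 2 and 3. *)
Definition admissible (c : R) := [|| c == 0, c == -1, c == - rt2 | c == - rt3].

Definition simple_system L :=
  [/\ free L, {in L, forall x, dotp x x = 2} &
      {in L &, forall x y, x != y -> admissible (dotp x y)}].

Lemma rt2_sqr : rt2 * rt2 = 2.
Proof. by rewrite -expr2 sqr_sqrtr ?ler0n. Qed.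

Lemma rt3_sqr : rt3 * rt3 = 3.
Proof. by rewrite -expr2 sqr_sqrtr ?ler0n. Qed.

Lemma rt2_gt1 : 1 < rt2.
Proof. by rewrite -[1]sqrtr1 ltr_sqrt // ltr1n. Qed.

Lemma rt3_gt_rt2 : rt2 < rt3.
Proof. by rewrite ltr_sqrt ?ltr_nat ?ltr0n. Qed.

Variant admissible_spec (c : R) : Prop :=
| Admissible0 of c = 0
| Admissible1 of c = -1
| Admissible2 of c = - rt2
| Admissible3 of c = - rt3.

Lemma admissibleP c : admissible c -> admissible_spec c.
Proof.
by case/or4P => /eqP;
  [exact: Admissible0|exact: Admissible1|exact: Admissible2|exact: Admissible3].
Qed.


Lemma admissible_le c : admissible c -> c != 0 -> c <= -1.
Proof.
have := rt2_gt1; have := rt3_gt_rt2.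
by move=> ? ? /admissibleP [] -> //; rewrite ?eqxx //; lra.
Qed.

Lemma admissible_le0 c : admissible c -> c <= 0.
Proof.
have [->|c0] := eqVneq c 0 => // /admissible_le/(_ c0) ?; lra.
Qed.

Lemma admissible_sqr_lt2 c : admissible c -> c != 0 -> c * c < 2 -> c = -1.
Proof.
have := rt2_sqr; have := rt3_sqr.
by move=> ? ? /admissibleP [] -> //; rewrite ?eqxx // mulrNN; lra.
Qed.

Lemma admissible_lt c : admissible c -> c != 0 -> c != -1 -> c <= - rt2.
Proof.
have := rt3_gt_rt2.
by move=> ? /admissibleP [] -> //; rewrite ?eqxx //; lra.
Qed.

Lemma simple_system_perm K L : perm_eq K L -> simple_system K -> simple_system L.
Proof.
move=> KL [fK nK aK]; split; first by rewrite -(perm_free KL).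
- by move=> x; rewrite -(perm_mem KL); apply: nK.
- by move=> x y; rewrite -!(perm_mem KL); apply: aK.
Qed.

Lemma simple_system_sub K L :
  subseq K L -> simple_system L -> simple_system K.
Proof.
move=> KL [fL nL aL]; have sKL := mem_subseq KL; split.
- by move: KL => /(subseq_uniqP (free_uniq fL)) ->; apply: filter_free.
- by move=> x /sKL; apply: nL.
- by move=> x y /sKL xL /sKL yL; apply: aL.
Qed.

(* Node 0 is joined to node [q] with inner product [- c]; the nodes
   [1, 2, 3, ...] form a simply laced chain. *)
Definition gram_chain (q : nat) (c : R) (i j : nat) : R :=
  if i == j then 2
  else if ((i == 0) && (j == q) || (j == 0) && (i == q))%N then - c
  else if [&& 0 < i, 0 < j & (i == j.+1) || (j == i.+1)]%N then -1 else 0.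

Definition gram_F4 (i j : nat) : R :=
  if i == j then 2
  else if ((i == 1) && (j == 2) || (j == 1) && (i == 2))%N then - rt2
  else if ((i == j.+1) || (j == i.+1))%N then -1 else 0.

Definition has_gram g K := forall i j,
  (i < size K)%N -> (j < size K)%N -> dotp K`_i K`_j = g i j.

(** Node 0 distinguishes the families other than F: at node 1 it continues the chain by a single,
    double or triple edge, at nodes 2 and 3 it creates the forks of D and E. The lower bounds for D
    and E discard coincidences: the D pattern on three nodes is A3, the E pattern on five nodes is
    D5. *)
Variant classified K : Prop :=
| TypeA of has_gram (gram_chain 1 1) K & (0 < size K)%N
| TypeB of has_gram (gram_chain 1 rt2) K & (1 < size K)%N
| TypeD of has_gram (gram_chain 2 1) K & (3 < size K)%N
| TypeE of has_gram (gram_chain 3 1) K & (5 < size K < 9)%N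
| TypeF of has_gram gram_F4 K & size K = 4
| TypeG of has_gram (gram_chain 1 rt3) K & size K = 2.

Lemma has_gram_cons g b K :
    dotp b b = g 0 0 ->
    (forall j, (j < size K)%N -> dotp b K`_j = g 0 j.+1) ->
    (forall j, (j < size K)%N -> dotp b K`_j = g j.+1 0) ->
    has_gram (fun i j => g i.+1 j.+1) K ->
  has_gram g (b :: K).
Proof.
move=> bb bK Kb KK [|i] [|j] //= iK jK; [exact: bK|by rewrite dotpC Kb|exact: KK].
Qed.

Lemma has_gram_eq g h K : (forall i j, g i j = h i j) -> has_gram g K -> has_gram h K.
Proof. by move=> gh gK i j iK jK; rewrite gK. Qed.

Lemma gram_chainSS q c i j :
  gram_chain q c i.+1 j.+1 = gram_chain 1 1 i j.
Proof.
by rewrite /gram_chain !eqSS /=; gram_lia.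
Qed.

Lemma has_gram_drop k K :
  has_gram (gram_chain 1 1) K -> has_gram (gram_chain 1 1) (drop k K).
Proof.
elim: k K => [|k IH] [|x K] //=.
move=> gK; apply: IH => i j iK jK.
by rewrite (gK i.+1 j.+1) // gram_chainSS.
Qed.

Lemma gram_chainC q c i j : gram_chain q c i j = gram_chain q c j i.
Proof. by rewrite /gram_chain; gram_lia. Qed.

Lemma has_gram_rev K :
  has_gram (gram_chain 1 1) K -> has_gram (gram_chain 1 1) (rev K).
Proof.
move=> gK i j; rewrite size_rev => iK jK.
have nr k : (k < size K)%N -> (rev K)`_k = K`_(size K - k.+1) by exact: nth_rev.
rewrite !nr //.
have ltK k : (k < size K)%N -> (size K - k.+1 < size K)%N by lia.
rewrite gK ?ltK //.
rewrite /gram_chain; gram_lia.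
Qed.

Lemma has_gram_rcons q c b K : (0 < q < size K)%N ->
    has_gram (gram_chain q c) K -> dotp b b = 2 ->
    (forall i, (i < size K)%N -> dotp b K`_i = if (i == (size K).-1)%N then -1 else 0) ->
  has_gram (gram_chain q c) (rcons K b).
Proof.
move=> /andP[q0 qK] gK bb bK i j; rewrite size_rcons => iK jK.
have nr1 k : (k < size K)%N -> (rcons K b)`_k = K`_k by move=> kK; rewrite nth_rcons kK.
have nr2 : (rcons K b)`_(size K) = b by rewrite nth_rcons ltnn eqxx.
have [{}iK|->] : (i < size K)%N \/ i = size K by lia.
  have [{}jK|->] : (j < size K)%N \/ j = size K by lia.
    by rewrite !nr1 // gK.
  by rewrite nr2 nr1 // dotpC bK // /gram_chain; gram_lia.
have [{}jK|->] : (j < size K)%N \/ j = size K by lia.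
  by rewrite nr2 nr1 // bK // /gram_chain; gram_lia.
by rewrite nr2 bb /gram_chain eqxx.
Qed.

(** The expression is the squared length of [b + y], and this vector is nonzero because freeness
    keeps [b] out of the span of [K]. *)
Lemma simple_system_pos b K y :
  simple_system (b :: K) -> y \in <<K>>%VS -> 0 < 2 + 2 * dotp b y + dotp y y.
Proof.
move=> [fbK nK _] yK.
have -> : 2 + 2 * dotp b y + dotp y y = dotp (b + y) (b + y).
  by rewrite !dotp_lin (nK b) ?mem_head // (dotpC y b); ring.
rewrite dotp_gt0; apply: contraTneq fbK => by0; rewrite free_cons negb_and negbK.
by rewrite -[b](addrK y) by0 sub0r rpredN yK.
Qed.

(** Forbidden edges are refuted by explicit coefficients [t]; the list may be shorter than [K], the
    missing coefficients being 0. Where an affine diagram would arise, [t] is its null vector,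
    scaled so that [b] has coefficient 1. *)
Lemma simple_system_test b K g (t : seq R) :
    simple_system (b :: K) -> has_gram g K -> (size t <= size K)%N ->
  0 < 2 + 2 * \sum_(i < size t) t`_i * dotp b K`_i +
      \sum_(i < size t) \sum_(j < size t) t`_i * t`_j * g i j.
Proof.
move=> sbK gK tK; have lt i : (i < size t)%N -> (i < size K)%N by move/leq_trans; apply.
have := @simple_system_pos b K (\sum_(i < size t) t`_i *: K`_i) sbK.
have -> : dotp b (\sum_(i < size t) t`_i *: K`_i) = \sum_(i < size t) t`_i * dotp b K`_i.
  by rewrite dotp_sumr; apply: eq_bigr => i _; rewrite dotpZr.
have -> : dotp (\sum_(i < size t) t`_i *: K`_i) (\sum_(i < size t) t`_i *: K`_i) =
    \sum_(i < size t) \sum_(j < size t) t`_i * t`_j * g i j.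
  rewrite dotp_suml; apply: eq_bigr => i _; rewrite dotp_sumr; apply: eq_bigr => j _.
  by rewrite dotpZl dotpZr gK ?lt // mulrA.
apply; apply: rpred_sum => i _; apply: rpredZ; apply: memv_span.
by apply: mem_nth; apply: lt.
Qed.

Lemma simple_system_adm b K i :
  simple_system (b :: K) -> (i < size K)%N -> admissible (dotp b K`_i).
Proof.
move=> [fbK _ aK] iK; have KiK : K`_i \in K by apply: mem_nth.
apply: aK; rewrite ?mem_head // ?inE ?KiK ?orbT //.
by move: (free_uniq fbK) => /= /andP[bK _]; apply: contraNneq bK => ->.
Qed.

End Diagrams.

(** * Attaching a root to a chain of type A *)

Section TypeAExtension.

Variables (R : realType) (n : nat).
Implicit Types (K L : seq 'cV[R]_n) (b t x y : 'cV[R]_n).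

Let rt2 : R := Num.sqrt 2.
Let rt3 : R := Num.sqrt 3.

(** The sum of all simple roots of type A is again a root: a new last node adds 2 to the squared
    length and its single edge removes 2. *)
Lemma gram_chain_sum k :
  \sum_(i < k.+1) \sum_(j < k.+1) gram_chain 1 1 i j = 2 :> R.
Proof.
have row m : \sum_(i < m.+1) gram_chain 1 1 i m.+1 = -1 :> R.
  rewrite big_ord_recr /= big1 ?add0r => [|i _]; rewrite /gram_chain; last first.
    by have := ltn_ord i; gram_lia.
  by gram_lia.
elim: k => [|k IH]; first by rewrite !big_ord1.
rewrite big_ord_recr /=.
under eq_bigr do rewrite big_ord_recr /=.
rewrite big_split /= IH row big_ord_recr /=.
under eq_bigr do rewrite gram_chainC.
by rewrite row /gram_chain eqxx; ring.
Qed.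

Lemma simple_system_drop b k K :
  simple_system (b :: K) -> simple_system (b :: drop k K).
Proof. by apply: simple_system_sub; rewrite /= eqxx drop_subseq. Qed.

(** A second edge would close a cycle: with coefficient 1 on [b] and on the chain from [p] to [q],
    the squared length would be at most [2 + 2 - 4 = 0]. *)
Lemma attached_once b K p q :
    has_gram (gram_chain 1 1) K -> simple_system (b :: K) -> (p < q < size K)%N ->
  dotp b K`_p != 0 -> dotp b K`_q = 0.
Proof.
move=> gK sbK /andP[pq qK] xp; apply/eqP; apply: contraT => xq.
have sL := @simple_system_drop b p K sbK; have gL := @has_gram_drop _ _ p K gK.
have xL i : dotp b (drop p K)`_i = dotp b K`_(p + i) by rewrite nth_drop.
have sz : (size (nseq (q - p).+1 (1%R : R)) <= size (drop p K))%N.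
  by rewrite size_nseq size_drop; lia.
have := simple_system_test sL gL sz; rewrite size_nseq.
under eq_bigr do rewrite nth_nseq ltn_ord mul1r xL.
under [X in _ + X]eq_bigr => i _.
  under eq_bigr do rewrite !nth_nseq !ltn_ord !mul1r.
  over.
rewrite gram_chain_sum.
have -> : (q - p).+1 = (q - p.+1).+2 by lia.
rewrite big_ord_recl big_ord_recr /= addn0.
have -> : (p + bump 0 (q - p.+1))%N = q by rewrite /bump /=; lia.
set s := \sum_(i < _) _.
have s0 : s <= 0.
  apply: sumr_le0 => i _; apply: admissible_le0; apply: simple_system_adm sbK _.
  by have := ltn_ord i; rewrite /= /bump /=; lia.
have := admissible_le (simple_system_adm sbK qK) xq.
have := admissible_le (simple_system_adm sbK (ltn_trans pq qK)) xp.
lra.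
Qed.

Lemma attach_gram b K p c :
    has_gram (gram_chain 1 1) K -> dotp b b = 2 -> (p < size K)%N ->
    dotp b K`_p = - c -> (forall i, (i < size K)%N -> i != p -> dotp b K`_i = 0) ->
  has_gram (gram_chain p.+1 c) (b :: K).
Proof.
move=> gK bb pK xp x0; apply: has_gram_cons => //.
- move=> j jK; rewrite /gram_chain /= orbF eqSS.
  by have [->|jp] := eqVneq j p; rewrite // x0.
- move=> j jK; rewrite /gram_chain /= eqSS.
  by have [->|jp] := eqVneq j p; rewrite // x0.
- by apply: has_gram_eq gK => i j; rewrite gram_chainSS.
Qed.

(** The symmetry of the chain places the only node joined to [b] in the left half. The cases are the
    position of this node and the value on the edge; everything outside the list contains an affine
    diagram, possibly with a heavier edge. *)
Lemma extend_TypeA_left b K p :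
    has_gram (gram_chain 1 1) K -> simple_system (b :: K) ->
    (p < size K)%N -> (p <= size K - p.+1)%N -> dotp b K`_p != 0 ->
    (forall i, (i < size K)%N -> i != p -> dotp b K`_i = 0) ->
  classified (b :: K).
Proof.
move=> gK sbK pK pm xp x0.
have bb : dotp b b = 2 by case: sbK => _ nb _; apply: nb; rewrite mem_head.
have adm := simple_system_adm sbK pK.
have gbK c : dotp b K`_p = - c -> has_gram (gram_chain p.+1 c) (b :: K).
  by move=> xpc; apply: attach_gram.
have r22 := @rt2_sqr R; have r33 := @rt3_sqr R.
have r21 := @rt2_gt1 R; have r32 := @rt3_gt_rt2 R; rewrite -/rt2 -/rt3 in r22 r33 r21 r32.
have drop_data k : (k <= p)%N ->
  [/\ simple_system (b :: drop k K), has_gram (gram_chain 1 1) (drop k K),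
      size (drop k K) = (size K - k)%N &
      forall i, (k + i < size K)%N ->
        dotp b (drop k K)`_i = if (k + i == p)%N then dotp b K`_p else 0].
  move=> kp; split; [exact: simple_system_drop|exact: has_gram_drop|exact: size_drop|].
  by move=> i iK; rewrite nth_drop; case: eqVneq => [->|/x0->].
(* With a double edge at an interior node, [b], this node and its two neighbours form affine B3. The
   coefficients are its null vector in roots of equal length. *)
have big_c : (0 < p)%N -> dotp b K`_p <= - rt2 -> False.
  case: p pK pm xp x0 adm gbK drop_data => // p pK pm _ _ _ _ dd _ xr.
  have [sL gL szL xL] := dd p (leqnSn p).
  have sz : (size [:: rt2 / 2; rt2; rt2 / 2] <= size (drop p K))%N by rewrite szL /=; lia.
  have := simple_system_test sL gL sz.
  rewrite /= !big_ord_recl !big_ord0 /= /gram_chain /bump /=.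
  rewrite !xL ?addn0 ?addn1 ?addn2 ?eqxx; [|lia..].
  have -> : (p == p.+1) = false by lia.
  have -> : (p.+2 == p.+1) = false by lia.
  by nra.
case/admissibleP: (adm) => xE.
- by rewrite xE eqxx in xp.
- case: p pK pm xp x0 adm gbK drop_data big_c xE => [|[|[|p]]] pK pm _ x0 _ gbK dd _ xE.
  + by apply: TypeA => //; apply: gbK.
  + by apply: TypeD; [apply: gbK|rewrite /=; lia].
  + have [sz8|sz8] := ltnP (size K) 8.
      by apply: TypeE; [apply: gbK|rewrite /=; lia].
    (* The marks 2, 4, 6, 5, 4, 3, 2, 1 of affine E8, divided by the mark 3 of [b]. *)
    have := simple_system_test (t := [:: 2/3; 4/3; 2; 5/3; 4/3; 1; 2/3; 1/3]) sbK gK sz8.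
    rewrite /= !big_ord_recl !big_ord0 /= /gram_chain /bump /= xE.
    rewrite !(x0 0%N) ?(x0 1%N) ?(x0 3%N) ?(x0 4%N) ?(x0 5%N) ?(x0 6%N) ?(x0 7%N) //; [|lia..].
    lra.
  (* Three nodes on either side of the attachment give affine E7; its marks are divided by the mark
     2 of [b]. *)
  + have [sL gL szL xL] := dd p (leq_addl 3 p).
    have sz : (size [:: 1/2 : R; 1; 3/2; 2; 3/2; 1; 1/2]%R <= size (drop p K))%N.
      by rewrite szL /=; lia.
    have := simple_system_test sL gL sz.
    rewrite /= !big_ord_recl !big_ord0 /= /gram_chain /bump /=.
    rewrite !xL ?addn0 /=; [|lia..].
    have E i : (p + i == p.+3)%N = (i == 3)%N by lia.
    have -> : (p == p.+3)%N = false by lia.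
    rewrite !E /= xE; lra.
- case: (posnP p) => [p0|p0]; last first.
    by case: (big_c p0); rewrite xE.
  apply: TypeB; last by rewrite /=; lia.
  by have := gbK _ xE; rewrite p0.
- case: (posnP p) => [p0|p0]; last first.
    by case: (big_c p0); rewrite xE lerN2 ltW.
  have [sz|sz] := ltnP (size K) 2.
    apply: TypeG; last by rewrite /=; lia.
    by have := gbK _ xE; rewrite p0.
  (* The null vector of affine G2, in roots of equal length. *)
  subst p; have := simple_system_test (t := [:: 2 * rt3 / 3; rt3 / 3]) sbK gK sz.
  rewrite /= !big_ord_recl !big_ord0 /= /gram_chain /bump /= xE (x0 1%N) // -/rt3.
  by nra.
Qed.

Lemma extend_TypeA b K p :
    has_gram (gram_chain 1 1) K -> simple_system (b :: K) ->
    (p < size K)%N -> dotp b K`_p != 0 ->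
  exists2 K', perm_eq K' (b :: K) & classified K'.
Proof.
move=> gK sbK pK xp.
have x0 i : (i < size K)%N -> i != p -> dotp b K`_i = 0.
  move=> iK ip; have [lt|lt|E] := ltngtP i p; last by rewrite E eqxx in ip.
    have := @attached_once b K i p gK sbK; rewrite lt pK => /(_ isT) H.
    by apply/eqP; apply: contraT => /H /eqP; rewrite (negbTE xp).
  by apply: (attached_once gK sbK _ xp); rewrite lt.
have [pm|pm] := leqP p (size K - p.+1).
  by exists (b :: K) => //; apply: extend_TypeA_left pm xp x0.
have nr k : (k < size K)%N -> (rev K)`_k = K`_(size K - k.+1) by exact: nth_rev.
have rK : perm_eq (b :: rev K) (b :: K) by rewrite perm_cons perm_rev.
exists (b :: rev K) => //; apply: (@extend_TypeA_left _ _ (size K - p.+1)).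
- exact: has_gram_rev.
- by apply: simple_system_perm sbK; rewrite perm_sym.
- by rewrite size_rev; lia.
- by rewrite size_rev; lia.
- rewrite nr; last lia.
  by have -> : (size K - (size K - p.+1).+1)%N = p by lia.
- move=> i; rewrite size_rev => iK ip.
  by rewrite nr //; apply: x0; lia.
Qed.

End TypeAExtension.

(** * Orthonormal frames for types B and D *)

Section Frames.

Variables (R : realType) (n : nat).
Implicit Types (K L : seq 'cV[R]_n) (b t x y e : 'cV[R]_n).

Let rt2 : R := Num.sqrt 2.

(** In the standard model of types B and D the chain is [K_i = y_i - y_(i-1)] for [i > 0], so
    partial sums recover the orthonormal vectors [y_i] from [y_0 = e]. The entry of index 0 is never
    added; it enters only through the choice of [e]. *)
Fixpoint frame e K i : 'cV[R]_n :=
  if i is i'.+1 then frame e K i' + K`_i else e.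

Definition frame_origin e K := dotp e e = 1 /\
  forall j, (0 < j < size K)%N -> dotp e K`_j = - (j == 1)%:R.

Lemma frame_dotpK q c e K i j :
    has_gram (gram_chain q c) K -> frame_origin e K ->
    (i < size K)%N -> (0 < j < size K)%N ->
  dotp (frame e K i) K`_j = (i == j)%:R - (i.+1 == j)%:R.
Proof.
move=> gK [_ eK] + /andP[j0 jK]; elim: i => [|i IH] iK /=.
  by rewrite eK ?j0 //; case: j j0 {jK} => [|[|j]] //= _; rewrite sub0r.
rewrite dotpDl IH; last by lia.
rewrite gK // /gram_chain j0 /=.
have -> : (j == 0)%N && (i.+1 == q) = false by lia.
by do !case: eqP => ? /=; try (exfalso; lia); ring.
Qed.

Lemma frame_orthonormal q c e K i j :
    has_gram (gram_chain q c) K -> frame_origin e K ->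
    (i < size K)%N -> (j < size K)%N ->
  dotp (frame e K i) (frame e K j) = (i == j)%:R.
Proof.
move=> gK oe; wlog ij : i j / (j <= i)%N.
  move=> W iK jK; have [ij|/ltnW ij] := leqP j i; first exact: W.
  by rewrite dotpC eq_sym W.
elim: i j ij => [|i IH] j ij iK jK.
  by move: ij; rewrite leqn0 => /eqP->; rewrite (proj1 oe).
have iK' : (i < size K)%N by lia.
have [lt|lt|->] := ltngtP j i.+1; last 1 first.
- rewrite /= !dotp_lin IH // eqxx (dotpC K`_i.+1) (frame_dotpK gK oe) //.
  rewrite eqxx (_ : (i == i.+1) = false); last by lia.
  by rewrite gK // /gram_chain eqxx /=; ring.
- rewrite /= dotpDl IH // (dotpC K`_i.+1) (frame_dotpK gK oe) //.
  by rewrite eqSS [j == i]eq_sym (_ : (j == i.+1) = false) /=; [ring|lia].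
- lia.
Qed.

Lemma frame_span e K i : e \in <<K>>%VS -> (i < size K)%N -> frame e K i \in <<K>>%VS.
Proof.
move=> eK; elim: i => //= i IH iK; apply: rpredD; first by apply: IH; lia.
exact/memv_span/mem_nth.
Qed.

(** Strictness comes from the independence of [b]: for [y] equal to minus the projection of [b] onto
    the frame, [simple_system_pos] reads [2 - s > 0]. *)
Lemma bessel q c b e K :
    has_gram (gram_chain q c) K -> frame_origin e K -> e \in <<K>>%VS ->
    simple_system (b :: K) ->
  \sum_(i < size K) dotp b (frame e K i) ^+ 2 < 2.
Proof.
move=> gK oe eK sbK.
pose y := - \sum_(i < size K) dotp b (frame e K i) *: frame e K i.
have yK : y \in <<K>>%VS.
  by rewrite rpredN rpred_sum // => i _; rewrite rpredZ // frame_span.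
have := simple_system_pos sbK yK; set s := \sum_(i < _) _.
have -> : dotp b y = - s.
  rewrite dotpNr dotp_sumr; congr (- _); apply: eq_bigr => i _.
  by rewrite dotpZr expr2.
have -> : dotp y y = s.
  rewrite dotpNl dotpNr opprK dotp_suml; apply: eq_bigr => i _.
  rewrite dotp_sumr (bigD1 i) //= big1 => [|j ji].
    by rewrite dotpZl dotpZr (frame_orthonormal gK oe) // eqxx mulr1 addr0 expr2.
  rewrite dotpZl dotpZr (frame_orthonormal gK oe) //.
  by rewrite (_ : (i == j :> nat) = false) ?mulr0 // eq_sym; apply/negbTE.
by lra.
Qed.

Lemma bessel1 q c b e K i :
    has_gram (gram_chain q c) K -> frame_origin e K -> e \in <<K>>%VS ->
    simple_system (b :: K) -> (i < size K)%N ->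
  dotp b (frame e K i) ^+ 2 < 2.
Proof.
move=> gK oe eK sbK iK; apply: le_lt_trans (bessel gK oe eK sbK).
by rewrite (bigD1 (Ordinal iK)) //= lerDl sumr_ge0 // => k _; rewrite sqr_ge0.
Qed.

Lemma bessel2 q c b e K i j :
    has_gram (gram_chain q c) K -> frame_origin e K -> e \in <<K>>%VS ->
    simple_system (b :: K) -> (i < j < size K)%N ->
  dotp b (frame e K i) ^+ 2 + dotp b (frame e K j) ^+ 2 < 2.
Proof.
move=> gK oe eK sbK /andP[ij jK]; apply: le_lt_trans (bessel gK oe eK sbK).
have iK := ltn_trans ij jK.
rewrite (bigD1 (Ordinal iK)) //= (bigD1 (Ordinal jK)) /=; last first.
  by rewrite -val_eqE /=; lia.
by rewrite addrA lerDl sumr_ge0 // => k _; rewrite sqr_ge0.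
Qed.

Lemma frame_originB K : has_gram (gram_chain 1 rt2) K -> (0 < size K)%N ->
  frame_origin (rt2^-1 *: K`_0) K.
Proof.
move=> gK K0; have r22 := @rt2_sqr R; rewrite -/rt2 in r22.
have r20 : rt2 != 0 by apply/eqP => r0; rewrite r0 in r22; lra.
split=> [|j /andP[j0 jK]].
  by rewrite dotpZl dotpZr gK // /gram_chain /= -r22; field.
rewrite dotpZl gK //; case: j j0 {jK} => [|[|j]] //= _; rewrite /gram_chain /=.
  by rewrite mulrN mulVf.
by rewrite mulr0 oppr0.
Qed.

(** In the model of type D, [K_0 = y_0 + y_1] and [K_1 = y_1 - y_0], which determines [y_0]. *)
Lemma frame_originD K : has_gram (gram_chain 2 1) K -> (1 < size K)%N ->
  frame_origin (2^-1 *: (K`_0 - K`_1)) K.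
Proof.
move=> gK K1; have K0 := ltnW K1; split=> [|j /andP[j0 jK]].
  by rewrite !dotp_lin !gK // /gram_chain /=; field.
rewrite !dotp_lin !gK //; case: j j0 {jK} => [|[|[|j]]] //= _; rewrite /gram_chain /=.
- by field.
- by ring.
- by ring.
Qed.

Section Extension.

Variables (q : nat) (c : R) (b e : 'cV[R]_n) (K : seq 'cV[R]_n).
Hypotheses (gK : has_gram (gram_chain q c) K) (oe : frame_origin e K).
Hypotheses (eK : e \in <<K>>%VS) (sbK : simple_system (b :: K)).

Let x i := dotp b K`_i.
Let z i := dotp b (frame e K i).

Lemma extension_zS i : z i.+1 = z i + x i.+1.
Proof. by rewrite /z /= dotpDr. Qed.

(* Two coordinates [<= -1] would already exhaust the squared length 2 of [b]. *)
Lemma extension_interior p :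
  z p <= 0 -> (p.+2 < size K)%N -> x p.+1 = 0.
Proof.
move=> zp pK; have pK' : (p.+1 < size K)%N by lia.
apply/eqP; apply: contraT => xp.
have := admissible_le (simple_system_adm sbK pK') xp; rewrite -/(x p.+1) => xle.
have := admissible_le0 (simple_system_adm sbK pK); rewrite -/(x p.+2) => xle2.
have := @bessel2 q c b e K p.+1 p.+2 gK oe eK sbK; rewrite ltnSn pK => /(_ isT).
rewrite -!/(z _) (extension_zS p.+1) (extension_zS p); nra.
Qed.

(** From a nonpositive coordinate on, [extension_interior] kills one node after another and the
    coordinates [z] stay constant. The last node escapes, since that lemma uses the node after
    it. *)
Lemma extension_const p k :
  z p <= 0 -> (p + k.+1 < size K)%N -> z (p + k) = z p /\ forall i, (i < k)%N -> x (p + i).+1 = 0.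
Proof.
move=> zp; elim: k => [|k IH] pk; first by rewrite addn0.
have [] := IH; first by lia.
move=> zk xk; have xpk : x (p + k).+1 = 0.
  by apply: extension_interior; [rewrite zk|lia].
split; first by rewrite addnS extension_zS zk xpk addr0.
by move=> i; rewrite ltnS leq_eqVlt => /orP[/eqP->|/xk].
Qed.

End Extension.

End Frames.

(** * Attaching a root to a diagram of type B *)

Section TypeBDExtension.

Variables (R : realType) (n : nat).
Implicit Types (K L : seq 'cV[R]_n) (b t x y : 'cV[R]_n).

Let rt2 : R := Num.sqrt 2.

Lemma simple_system_norm b K : simple_system (b :: K) -> dotp b b = 2.
Proof. by case=> _ nb _; apply: nb; rewrite mem_head. Qed.

(** The coordinates of [b] all equal [z 0], except possibly the last. If the last node meets [b],
    the chain grows at its far end. Otherwise [b] meets node 0, each coordinate has square at least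
    1/2, and squared length 2 leaves room for at most three of them: the results are B3 and F4. *)
Lemma extend_TypeB b K p :
    has_gram (gram_chain 1 rt2) K -> (1 < size K)%N -> simple_system (b :: K) ->
    (p < size K)%N -> dotp b K`_p != 0 ->
  exists2 K', perm_eq K' (b :: K) & classified K'.
Proof.
move=> gK K1 sbK pK xp; have K0 := ltnW K1.
have oe := frame_originB gK K0; rewrite -/rt2 in oe.
set e := rt2^-1 *: K`_0 in oe.
have eK : e \in <<K>>%VS by apply/rpredZ/memv_span/mem_nth.
have bb := simple_system_norm sbK.
pose z i := dotp b (frame e K i).
have r22 := @rt2_sqr R; have r21 := @rt2_gt1 R; rewrite -/rt2 in r22 r21.
have zE : dotp b K`_0 = rt2 * z 0.
  by rewrite /z /= dotpZr mulrA mulfV ?mul1r //; apply/eqP; lra.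
have z0 : z 0 <= 0.
  have := admissible_le0 (simple_system_adm sbK K0); rewrite zE; nra.
have zS := @extension_zS _ _ b e K.
have [] := @extension_const _ _ _ _ b e K gK oe eK sbK 0 (size K - 2) z0; first by lia.
rewrite add0n => zm xm.
have szK : (size K).-1 = (size K - 2).+1 by lia.
have lK : ((size K).-1 < size K)%N by lia.
have zl : z (size K).-1 = z 0 + dotp b K`_(size K).-1 by rewrite szK /z zS zm.
have xi i : (i < size K)%N -> i != 0 -> i != (size K).-1 -> dotp b K`_i = 0.
  case: i => // i iK _ iK'; apply: xm; lia.
have [xl0|xl0] := eqVneq (dotp b K`_(size K).-1) 0; last first.
  have xl := admissible_le (simple_system_adm sbK lK) xl0.
  have := bessel1 gK oe eK sbK lK; rewrite -/(z _) zl => bl.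
  have x0 : dotp b K`_0 = 0.
    apply/eqP; apply: contraT => x0.
    have := admissible_le (simple_system_adm sbK K0) x0; rewrite zE => zle.
    have zh : z 0 <= - (rt2 / 2) by nra.
    nra.
  have z00 : z 0 = 0 by move/eqP: zE; rewrite x0 eq_sym mulf_eq0 => /orP[/eqP|/eqP//]; lra.
  have xl1 : dotp b K`_(size K).-1 = -1.
    apply: admissible_sqr_lt2 => //; first exact: simple_system_adm sbK lK.
    by move: bl; rewrite z00 add0r expr2.
  exists (rcons K b); first by rewrite perm_rcons.
  apply: TypeB; last by rewrite size_rcons; lia.
  apply: has_gram_rcons => // i iK; case: eqP => [->//|/eqP il].
  by have [->//|i0] := eqVneq i 0%N; apply: xi.
have x0 : dotp b K`_0 != 0.
  have [p0|p0] := eqVneq p 0%N; [by rewrite p0 in xp|have [pl|pl] := eqVneq p (size K).-1].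
    by rewrite pl xl0 eqxx in xp.
  by rewrite xi ?eqxx in xp.
have zi (i : 'I_(size K)) : z i = z 0.
  have [ilt|ige] := ltnP i (size K).-1; last first.
    have -> : i = (size K).-1 :> nat by have := ltn_ord i; lia.
    by rewrite zl xl0 addr0.
  have [] := @extension_const _ _ _ _ b e K gK oe eK sbK 0 i z0 => //.
  by lia.
have := bessel gK oe eK sbK; under eq_bigr do rewrite -/(z _) zi.
rewrite sumr_const card_ord => bl.
have x0le := admissible_le (simple_system_adm sbK K0) x0.
have zsq : 1 <= 2 * z 0 ^+ 2 by move: x0le; rewrite zE expr2; nra.
have szlt : (size K < 4)%N.
  rewrite ltnNge; apply/negP => sz4; have := ler_wpMn2l (sqr_ge0 (z 0)) sz4.
  rewrite -[_ *+ 4]mulr_natl; lra.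
(* At least two equal coordinates give [2 * z 0 ^+ 2 < 2], and the left side is the square of the
   edge value. *)
have x01 : dotp b K`_0 = -1.
  apply: admissible_sqr_lt2 => //; first exact: simple_system_adm sbK K0.
  have := ler_wpMn2l (sqr_ge0 (z 0)) K1.
  rewrite zE mulrACA r22 -expr2 mulr_natl; lra.
have xi0 i : (0 < i < size K)%N -> dotp b K`_i = 0.
  move=> /andP[i0 iK]; have [->//|il] := eqVneq i (size K).-1.
  by apply: xi => //; rewrite -lt0n.
clear -gK K1 szlt bb x01 xi0.
case: K gK K1 szlt x01 xi0 => [|k0 [|k1 [|k2 [|]]]] //= gK _ _ x01 xi0.
  (* The double edge joins [k1] and [k0], so [k1] becomes node 0 and [b] the end of the chain. *)
  exists [:: k1; k0; b]; first by rewrite (perm_catC [:: k1; k0] [:: b]) /= perm_cons (perm_catC [:: k1]).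
  apply: TypeB => //.
  have := gK 0%N 0%N isT isT; have := gK 1%N 1%N isT isT; have := gK 0%N 1%N isT isT.
  have := xi0 1%N isT; rewrite /gram_chain /= => b1 k01 k11 k00.
  by move=> [|[|[|i]]] [|[|[|j]]] // _ _; rewrite /gram_chain /= ?bb // 1?dotpC // ?x01 // dotpC.
exists [:: b; k0; k1; k2] => //; apply: TypeF => //.
have := gK 0%N 0%N isT isT; have := gK 1%N 1%N isT isT; have := gK 0%N 1%N isT isT.
have := gK 2%N 2%N isT isT; have := gK 1%N 2%N isT isT; have := gK 0%N 2%N isT isT.
have := xi0 1%N isT; have := xi0 2%N isT; rewrite /gram_chain /= => b2 b1 k02 k12 k22 k01 k11 k00.
by move=> [|[|[|[|i]]]] [|[|[|[|j]]]] // _ _; rewrite /gram_F4 /= ?bb // 1?dotpC // ?x01 // dotpC.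
Qed.

End TypeBDExtension.

(** * Attaching a root to a diagram of type D *)

Section TypeDExtension.

Variables (R : realType) (n : nat).
Implicit Types (K L : seq 'cV[R]_n) (b t x y : 'cV[R]_n).

(** This is the diagram automorphism that exchanges the two short legs. *)
Lemma has_gramD_swap x y L :
  has_gram (gram_chain 2 1) [:: x, y & L] -> has_gram (gram_chain 2 1) [:: y, x & L].
Proof.
move=> gK [|[|i]] [|[|j]] iL jL.
- exact: (gK 1%N 1%N).
- exact: (gK 1%N 0%N).
- by rewrite (gK 1%N j.+2) //; case: j {jL}.
- exact: (gK 0%N 1%N).
- exact: (gK 0%N 0%N).
- by rewrite (gK 0%N j.+2) //; case: j {jL}.
- by rewrite (gK i.+2 1%N) //; case: i {iL}.
- by rewrite (gK i.+2 0%N) //; case: i {iL}.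
- exact: (gK i.+2 j.+2).
Qed.

(** Lengthening one short leg gives arms of lengths 1, 2 and [size L - 1] at the branch node, the
    head of [L]: type D5 if the last length is 1, otherwise E6, E7 or E8. *)
Lemma extend_TypeD_leg b x y L :
    has_gram (gram_chain 2 1) [:: x, y & L] -> (1 < size L < 6)%N ->
    dotp b b = 2 -> dotp b x = -1 -> dotp b y = 0 ->
    (forall i, (i < size L)%N -> dotp b L`_i = 0) ->
  exists2 K', perm_eq K' [:: b, x, y & L] & classified K'.
Proof.
move=> gK /andP[L1 L6] bb bx by0 bL.
have xx := gK 0%N 0%N isT isT; have yy := gK 1%N 1%N isT isT.
have xy := gK 0%N 1%N isT isT; rewrite /gram_chain /= in xx yy xy.
have xL i : (i < size L)%N -> dotp x L`_i = - (i == 0)%:R.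
  by move=> iL; rewrite (gK 0%N i.+2) //; case: i {iL} => //= ?; rewrite oppr0.
have yL i : (i < size L)%N -> dotp y L`_i = - (i == 0)%:R.
  by move=> iL; rewrite (gK 1%N i.+2) //; case: i {iL} => //= ?; rewrite oppr0.
have LL i j : (i < size L)%N -> (j < size L)%N -> dotp L`_i L`_j = gram_chain 1 1 i j.
  by move=> iL jL; rewrite (gK i.+2 j.+2) // !gram_chainSS.
have [sz2|sz2] := leqP (size L) 2.
  case: L gK L1 L6 bL xL yL LL sz2 => [|u [|v []]] // gK _ _ bL xL yL LL _.
  have := bL 0%N isT; have := bL 1%N isT; have := xL 0%N isT; have := xL 1%N isT.
  have := yL 0%N isT; have := yL 1%N isT; have := LL 0%N 0%N isT isT.
  have := LL 0%N 1%N isT isT; have := LL 1%N 1%N isT isT.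
  rewrite /gram_chain /= oppr0 => vv uv uu yv yu xv xu bv bu.
  exists [:: y; v; u; x; b].
    by apply/seq.permP => a /=; lia.
  apply: TypeD => //.
  by move=> [|[|[|[|[|i]]]]] [|[|[|[|[|j]]]]] // _ _; rewrite /gram_chain /=;
     try assumption; rewrite dotpC; assumption.
exists [:: y, b, x & L].
  by apply/seq.permP => a /=; lia.
apply: TypeE; last by rewrite /=; lia.
apply: has_gram_cons; first exact: yy.
- move=> [|[|j]] /= jL; rewrite /gram_chain /=; [by rewrite dotpC|by rewrite dotpC|].
  by rewrite yL //; case: j {jL} => //=; rewrite oppr0.
- move=> [|[|j]] /= jL; rewrite /gram_chain /=; [by rewrite dotpC|by rewrite dotpC|].
  by rewrite yL //; case: j {jL} => //=; rewrite oppr0.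
apply: has_gram_cons; first exact: bb.
- by move=> [|j] /= jL; rewrite /gram_chain //= bL.
- by move=> [|j] /= jL; rewrite /gram_chain //= bL.
apply: has_gram_cons; first exact: xx.
- by move=> j jL; rewrite xL // /gram_chain /=; case: j {jL} => //=; rewrite oppr0.
- by move=> j jL; rewrite xL // /gram_chain /=; case: j {jL} => //=; rewrite oppr0.
by move=> i j iL jL; rewrite LL // !gram_chainSS.
Qed.

(** If both legs met [b], two coordinates would be at most -1. So only leg 0 does, all coordinates
    have the same absolute value, at least 1/2, and squared length 2 bounds their number by
    seven. *)
Lemma extend_TypeD_head b K :
    has_gram (gram_chain 2 1) K -> (3 < size K)%N -> simple_system (b :: K) ->
    dotp b K`_0 != 0 ->
  exists2 K', perm_eq K' (b :: K) & classified K'.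
Proof.
move=> gK K3 sbK x0.
have [K0 K1 K2] : [/\ 0 < size K, 1 < size K & 2 < size K]%N by split; lia.
have oe := frame_originD gK K1; set e := 2^-1 *: (K`_0 - K`_1) in oe.
have eK : e \in <<K>>%VS.
  by apply/rpredZ/rpredB; apply/memv_span/mem_nth.
have bb := simple_system_norm sbK.
pose z i := dotp b (frame e K i).
have x0a := simple_system_adm sbK K0; have x1a := simple_system_adm sbK K1.
have x00 := admissible_le0 x0a; have x10 := admissible_le0 x1a.
have z0E : z 0 = (dotp b K`_0 - dotp b K`_1) / 2.
  by rewrite /z /= dotpZr dotpBr mulrC.
have zS := @extension_zS _ _ b e K.
have z1E : z 1 = (dotp b K`_0 + dotp b K`_1) / 2.
  by rewrite /z zS -/(z 0) z0E; field.
have z1 : z 1 <= 0 by rewrite z1E; lra.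
have [] := @extension_const _ _ _ _ b e K gK oe eK sbK 1 (size K - 3) z1; first by lia.
move=> zm xm.
have szK : (size K).-1 = (1 + (size K - 3)).+1 by lia.
have lK : ((size K).-1 < size K)%N by lia.
have zl : z (size K).-1 = z 1 + dotp b K`_(size K).-1 by rewrite szK /z zS zm.
have xi i : (1 < i < (size K).-1)%N -> dotp b K`_i = 0.
  case: i => [|[|i]] // iK; rewrite -(xm i) ?add1n //; lia.
have xla := simple_system_adm sbK lK; have xl0 := admissible_le0 xla.
have bl := bessel1 gK oe eK sbK lK; rewrite -/(z _) zl in bl.
have x0le := admissible_le x0a x0.
have [x1|x1] := eqVneq (dotp b K`_1) 0; last first.
  have x1le := admissible_le x1a x1.
  have z1h : z 1 <= -1 by rewrite z1E; lra.
  have := @bessel2 _ _ _ _ b e K 1 2 gK oe eK sbK K2; rewrite -!/(z _).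
  have -> : z 2 = z 1 + dotp b K`_2 by rewrite /z zS.
  have := admissible_le0 (simple_system_adm sbK K2) => x2; nra.
have z1h : z 1 <= - (1 / 2) by rewrite z1E x1; lra.
have xlN : dotp b K`_(size K).-1 = 0.
  by apply/eqP; apply: contraT => /(admissible_le xla) xle; nra.
have zi (i : 'I_(size K)) : z i ^+ 2 = z 1 ^+ 2.
  case: i => [[|i] iK] /=; first by rewrite z0E z1E x1 subr0 addr0.
  have [ilt|ige] := ltnP i.+1 (size K).-1; last first.
    have -> : i.+1 = (size K).-1 by clear -iK ige; lia.
    by rewrite zl xlN addr0.
  have [] := @extension_const _ _ _ _ b e K gK oe eK sbK 1 i z1; first by clear -ilt; lia.
  by rewrite add1n /z => ->.
have := bessel gK oe eK sbK; under eq_bigr do rewrite -/(z _) zi.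
rewrite sumr_const card_ord => bs.
have zsq : 1 <= 4 * z 1 ^+ 2 by rewrite expr2; nra.
have sz8 : (size K < 8)%N.
  rewrite ltnNge; apply/negP => sz; have := ler_wpMn2l (sqr_ge0 (z 1)) sz.
  rewrite -[_ *+ 8]mulr_natl; lra.
(* There are at least four equal squares [z 1 ^+ 2], and [z 1] is half the edge value; so the edge
   value has square below 2. *)
have x01 : dotp b K`_0 = -1.
  apply: admissible_sqr_lt2 => //; have := ler_wpMn2l (sqr_ge0 (z 1)) K3.
  rewrite -[_ *+ 4]mulr_natl => z4; move: z4 bs; rewrite {1}z1E x1 addr0; nra.
case: K gK K3 sz8 xi x01 x1 xlN {sbK K0 K1 K2 oe e eK z x0a x1a x00 x10 z0E zS z1E z1
  zm xm szK lK zl xla xl0 bl x0 x0le z1h zi bs zsq} => [|k0 [|k1 L]] //= gK K3 sz8 xi x01 x1 xlN.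
apply: extend_TypeD_leg => //; first by lia.
move=> i iL; have [il|il] := eqVneq i.+1 (size L); last by apply: (xi i.+2); lia.
by rewrite -il /= in xlN.
Qed.

(** If both legs are orthogonal to [b], its coordinates vanish before the last node, where [b] can
    only prolong the chain. A leg that meets [b] is brought to position 0. *)
Lemma extend_TypeD b K p :
    has_gram (gram_chain 2 1) K -> (3 < size K)%N -> simple_system (b :: K) ->
    (p < size K)%N -> dotp b K`_p != 0 ->
  exists2 K', perm_eq K' (b :: K) & classified K'.
Proof.
move=> gK K3 sbK pK xp.
have [x0|] := eqVneq (dotp b K`_0) 0; last exact: extend_TypeD_head.
have [x1|x1] := eqVneq (dotp b K`_1) 0; last first.
  case: K gK K3 sbK x1 {pK xp x0} => [|k0 [|k1 L]] // gK K3 sbK x1.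
  have pK : perm_eq [:: b, k1, k0 & L] [:: b, k0, k1 & L].
    by rewrite perm_cons (perm_catCA [:: k1] [:: k0]).
  have sbK' : simple_system [:: b, k1, k0 & L].
    by apply: simple_system_perm sbK; rewrite perm_sym.
  have [K' pK' cK'] := extend_TypeD_head (has_gramD_swap gK) K3 sbK' x1.
  by exists K' => //; rewrite (permPl pK').
have [K0 K1 K2] : [/\ 0 < size K, 1 < size K & 2 < size K]%N by split; lia.
have oe := frame_originD gK K1; set e := 2^-1 *: (K`_0 - K`_1) in oe.
have eK : e \in <<K>>%VS.
  by apply/rpredZ/rpredB; apply/memv_span/mem_nth.
have bb := simple_system_norm sbK.
pose z i := dotp b (frame e K i).
have x0a := simple_system_adm sbK K0; have x1a := simple_system_adm sbK K1.
have x00 := admissible_le0 x0a; have x10 := admissible_le0 x1a.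
have z0E : z 0 = (dotp b K`_0 - dotp b K`_1) / 2.
  by rewrite /z /= dotpZr dotpBr mulrC.
have zS := @extension_zS _ _ b e K.
have z1E : z 1 = (dotp b K`_0 + dotp b K`_1) / 2.
  by rewrite /z zS -/(z 0) z0E; field.
have z1 : z 1 <= 0 by rewrite z1E; lra.
have [] := @extension_const _ _ _ _ b e K gK oe eK sbK 1 (size K - 3) z1; first by lia.
move=> zm xm.
have szK : (size K).-1 = (1 + (size K - 3)).+1 by lia.
have lK : ((size K).-1 < size K)%N by lia.
have zl : z (size K).-1 = z 1 + dotp b K`_(size K).-1 by rewrite szK /z zS zm.
have xi i : (1 < i < (size K).-1)%N -> dotp b K`_i = 0.
  case: i => [|[|i]] // iK; rewrite -(xm i) ?add1n //; lia.
have xla := simple_system_adm sbK lK; have xl0 := admissible_le0 xla.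
have bl := bessel1 gK oe eK sbK lK; rewrite -/(z _) zl in bl.
have z10 : z 1 = 0 by rewrite z1E x0 x1 addr0 mul0r.
have xlN0 : dotp b K`_(size K).-1 != 0.
  have [->|pl] := eqVneq (size K).-1 p; first by [].
  apply: contraNneq xp => _.
  case: p pK pl => [|[|p]] pK pl; rewrite ?x0 ?x1 // xi //.
  by clear -pK pl; lia.
have xl1 : dotp b K`_(size K).-1 = -1.
  by apply: admissible_sqr_lt2 => //; move: bl; rewrite z10 add0r expr2.
exists (rcons K b); first by rewrite perm_rcons.
apply: TypeD; last by rewrite size_rcons; clear -K3; lia.
apply: has_gram_rcons => //.
move=> i iK; case: eqP => [->//|/eqP il].
by case: i iK il => [|[|i]] iK il //; apply: xi; clear -iK il; lia.
Qed.

End TypeDExtension.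

(** * Attaching a root to an exceptional diagram *)

Section ExceptionalExtension.

Variables (R : realType) (n : nat).
Implicit Types (K L : seq 'cV[R]_n) (b t x y : 'cV[R]_n).

Let rt2 : R := Num.sqrt 2.
Let rt3 : R := Num.sqrt 3.

(* Testing against the highest root leaves only the nodes where its
   coefficient is 1. *)
Lemma extend_E6 b K p :
    has_gram (gram_chain 3 1) K -> size K = 6%N -> simple_system (b :: K) ->
    (p < size K)%N -> dotp b K`_p != 0 ->
  exists2 K', perm_eq K' (b :: K) & classified K'.
Proof.
(* The diagram automorphism exchanges nodes 1 and 5, the two with coefficient 1 in the highest root;
   node 5 is the one at the end of the list. *)
wlog p1 : K p / (p != 1)%N.
  move=> W; have [->|p1] := eqVneq p 1%N; last exact: W.
  case: K => [|k0 [|k1 [|k2 [|k3 [|k4 [|k5 [|]]]]]]] // gK _ sbK _ xp.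
  have pK : perm_eq [:: b; k0; k5; k4; k3; k2; k1] [:: b; k0; k1; k2; k3; k4; k5].
    by apply/seq.permP => a /=; lia.
  have [||K' pK' cK'] := W [:: k0; k5; k4; k3; k2; k1] 5%N isT _ erefl _ isT xp.
  - pose s i := nth 0%N [:: 0; 5; 4; 3; 2; 1]%N i.
    move=> i j iK jK; transitivity (gram_chain 3 1 (s i) (s j) : R).
      rewrite -gK; last 2 first.
      + by case: i iK {jK} => [|[|[|[|[|[|]]]]]].
      + by case: j jK {iK} => [|[|[|[|[|[|]]]]]].
      by case: i iK => [|[|[|[|[|[|]]]]]] // _; case: j jK => [|[|[|[|[|[|]]]]]].
    by case: i iK => [|[|[|[|[|[|]]]]]] // _; case: j jK => [|[|[|[|[|[|]]]]]].
  - by apply: simple_system_perm sbK; rewrite perm_sym.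
  by exists K' => //; rewrite (permPl pK').
move=> gK szK sbK pK xp.
have bb := simple_system_norm sbK.
have xa i : (i < 6)%N -> admissible (dotp b K`_i).
  by move=> i6; apply: simple_system_adm sbK _; rewrite szK.
have [] : [/\ dotp b K`_0 <= 0, dotp b K`_1 <= 0, dotp b K`_2 <= 0, dotp b K`_3 <= 0
           & dotp b K`_4 <= 0] by split; apply: admissible_le0; apply: xa.
have := admissible_le0 (xa 5%N isT) => x5 x0 x1 x2 x3 x4.
have := @simple_system_test _ _ b K _ [:: 2; 1; 2; 3; 2; 1]%R sbK gK; rewrite szK => /(_ isT).
rewrite /= !big_ord_recl !big_ord0 /= /gram_chain /bump /= => test.
have xle i : (i < 6)%N -> dotp b K`_i != 0 -> dotp b K`_i <= -1.
  by move=> i6; apply: admissible_le; apply: xa.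
have zle i : (i < 6)%N -> (dotp b K`_i <= -1 -> False) -> dotp b K`_i = 0.
  by move=> i6 no; apply/eqP; apply: contraT => /(xle _ i6) /no.
have {}test : 0 < 4 + 2 * (2 * dotp b K`_0 + dotp b K`_1 + 2 * dotp b K`_2 +
                           3 * dotp b K`_3 + 2 * dotp b K`_4 + dotp b K`_5) by lra.
have x50 : p = 5%N.
  move: xp; case: p pK p1 => [|[|[|[|[|[|p]]]]]] // + _; rewrite szK => // pK /(xle _ pK) xq;
    exfalso; clear -test x0 x1 x2 x3 x4 x5 xq; lra.
subst p.
have [z0 z1 z2 z3 z4] : [/\ dotp b K`_0 = 0, dotp b K`_1 = 0, dotp b K`_2 = 0, dotp b K`_3 = 0
           & dotp b K`_4 = 0].
  have := xle 5%N isT xp => x5'.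
  by split; apply: zle => // xq; clear -test x0 x1 x2 x3 x4 x5' xq; lra.
have x51 : dotp b K`_5 = -1.
  apply/eqP; apply: contraT => /(admissible_lt (xa 5%N isT) xp); rewrite -/rt2 => x5'.
  (* The coefficients are [rt2] times the fundamental weight dual to node 5, orthogonal to all other
     nodes; an edge value of at most [- rt2] would make the square negative. *)
  have := @simple_system_test _ _ b K _
    [:: rt2; rt2 * 2 / 3; rt2 * 4 / 3; rt2 * 2; rt2 * 5 / 3; rt2 * 4 / 3]%R sbK gK.
  rewrite szK => /(_ isT).
  rewrite /= !big_ord_recl !big_ord0 /= /gram_chain /bump /= z0 z1 z2 z3 z4.
  have r22 := @rt2_sqr R; have r21 := @rt2_gt1 R; rewrite -/rt2 in r22 r21.
  by nra.
exists (rcons K b); first by rewrite perm_rcons.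
apply: TypeE; last by rewrite size_rcons szK.
apply: has_gram_rcons => //; rewrite szK // => i i6.
by case: i i6 => [|[|[|[|[|[|]]]]]].
Qed.

(** The highest root has coefficient 1 only at the end of the long arm, and prolonging this arm
    gives E8. *)
Lemma extend_E7 b K p :
    has_gram (gram_chain 3 1) K -> size K = 7%N -> simple_system (b :: K) ->
    (p < size K)%N -> dotp b K`_p != 0 ->
  exists2 K', perm_eq K' (b :: K) & classified K'.
Proof.
move=> gK szK sbK pK xp.
have bb := simple_system_norm sbK.
have xa i : (i < 7)%N -> admissible (dotp b K`_i).
  by move=> i6; apply: simple_system_adm sbK _; rewrite szK.
have [] : [/\ dotp b K`_0 <= 0, dotp b K`_1 <= 0, dotp b K`_2 <= 0, dotp b K`_3 <= 0
           & dotp b K`_4 <= 0] by split; apply: admissible_le0; apply: xa.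
have [] : dotp b K`_5 <= 0 /\ dotp b K`_6 <= 0 by split; apply: admissible_le0; apply: xa.
move=> x5 x6 x0 x1 x2 x3 x4.
have := @simple_system_test _ _ b K _ [:: 2; 2; 3; 4; 3; 2; 1]%R sbK gK; rewrite szK => /(_ isT).
rewrite /= !big_ord_recl !big_ord0 /= /gram_chain /bump /= => test.
have xle i : (i < 7)%N -> dotp b K`_i != 0 -> dotp b K`_i <= -1.
  by move=> i6; apply: admissible_le; apply: xa.
have zle i : (i < 7)%N -> (dotp b K`_i <= -1 -> False) -> dotp b K`_i = 0.
  by move=> i6 no; apply/eqP; apply: contraT => /(xle _ i6) /no.
have {}test : 0 < 4 + 2 * (2 * dotp b K`_0 + 2 * dotp b K`_1 + 3 * dotp b K`_2 +
           4 * dotp b K`_3 + 3 * dotp b K`_4 + 2 * dotp b K`_5 + dotp b K`_6) by lra.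
have [z0 z1 z2 z3 z4] : [/\ dotp b K`_0 = 0, dotp b K`_1 = 0, dotp b K`_2 = 0, dotp b K`_3 = 0
           & dotp b K`_4 = 0].
  by split; apply: zle => // xq; clear -test x0 x1 x2 x3 x4 x5 x6 xq; lra.
have z5 : dotp b K`_5 = 0 by apply: zle => // xq; clear -test x0 x1 x2 x3 x4 x5 x6 xq; lra.
have xp6 : dotp b K`_6 != 0.
  by move: xp; case: p pK => [|[|[|[|[|[|[|p]]]]]]]; rewrite szK ?z0 ?z1 ?z2 ?z3 ?z4 ?z5 ?eqxx.
have x61 : dotp b K`_6 = -1.
  apply/eqP; apply: contraT => /(admissible_lt (xa 6%N isT) xp6); rewrite -/rt2 => x6'.
  (* As in type E6, [rt2] times the fundamental weight dual to the last node. *)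
  have := @simple_system_test _ _ b K _
    [:: rt2 * 3 / 2; rt2; rt2 * 2; rt2 * 3; rt2 * 5 / 2; rt2 * 2; rt2 * 3 / 2]%R sbK gK.
  rewrite szK => /(_ isT).
  rewrite /= !big_ord_recl !big_ord0 /= /gram_chain /bump /= z0 z1 z2 z3 z4 z5.
  have r22 := @rt2_sqr R; have r21 := @rt2_gt1 R; rewrite -/rt2 in r22 r21.
  by nra.
exists (rcons K b); first by rewrite perm_rcons.
apply: TypeE; last by rewrite size_rcons szK.
apply: has_gram_rcons => //; rewrite szK // => i i6.
by case: i i6 => [|[|[|[|[|[|[|]]]]]]].
Qed.

(** All coefficients of the highest root are at least 2, so one edge already makes the squared
    length of [b] plus the highest root nonpositive. *)
Lemma extend_E8 b K p :
    has_gram (gram_chain 3 1) K -> size K = 8%N -> simple_system (b :: K) ->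
    (p < size K)%N -> dotp b K`_p = 0.
Proof.
move=> gK szK sbK pK; apply/eqP; apply: contraT => xp.
have xa i : (i < 8)%N -> admissible (dotp b K`_i).
  by move=> i6; apply: simple_system_adm sbK _; rewrite szK.
have [] : [/\ dotp b K`_0 <= 0, dotp b K`_1 <= 0, dotp b K`_2 <= 0, dotp b K`_3 <= 0
           & dotp b K`_4 <= 0] by split; apply: admissible_le0; apply: xa.
have [] : [/\ dotp b K`_5 <= 0, dotp b K`_6 <= 0 & dotp b K`_7 <= 0].
  by split; apply: admissible_le0; apply: xa.
move=> x5 x6 x7 x0 x1 x2 x3 x4.
have := @simple_system_test _ _ b K _ [:: 3; 2; 4; 6; 5; 4; 3; 2]%R sbK gK; rewrite szK => /(_ isT).
rewrite /= !big_ord_recl !big_ord0 /= /gram_chain /bump /= => test.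
have xle i : (i < 8)%N -> dotp b K`_i != 0 -> dotp b K`_i <= -1.
  by move=> i6; apply: admissible_le; apply: xa.
have {}test : 0 < 4 + 2 * (3 * dotp b K`_0 + 2 * dotp b K`_1 + 4 * dotp b K`_2 +
    6 * dotp b K`_3 + 5 * dotp b K`_4 + 4 * dotp b K`_5 + 3 * dotp b K`_6 + 2 * dotp b K`_7) by lra.
rewrite szK in pK; move: (xle _ pK xp) => xq; exfalso.
by case: p pK xp xq => [|[|[|[|[|[|[|[|p]]]]]]]] // _ _ xq;
  clear -test x0 x1 x2 x3 x4 x5 x6 x7 xq; lra.
Qed.

Lemma has_gramF_rev K : has_gram (@gram_F4 R) K -> size K = 4%N -> has_gram (@gram_F4 R) (rev K).
Proof.
move=> gK szK i j; rewrite size_rev szK => iK jK.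
have nr k : (k < size K)%N -> (rev K)`_k = K`_(size K - k.+1) by exact: nth_rev.
rewrite !nr ?szK // gK ?szK ?ltn_subrL //.
by case: i iK => [|[|[|[|i]]]] // _; case: j jK => [|[|[|[|j]]]].
Qed.

(** The test vector is the highest root [2, 3, 4, 2], its two short coefficients divided by [sqrt 2]
    through the rescaling. It excludes nodes 0 and 1; equal lengths make the diagram symmetric,
    which takes care of the other half. *)
Lemma extend_F4_half b K p :
    has_gram (@gram_F4 R) K -> size K = 4%N -> simple_system (b :: K) ->
    (p < 2)%N -> dotp b K`_p = 0.
Proof.
move=> gK szK sbK p2; apply/eqP; apply: contraT => xp.
have xa i : (i < 4)%N -> admissible (dotp b K`_i).
  by move=> i6; apply: simple_system_adm sbK _; rewrite szK.
have [] : [/\ dotp b K`_0 <= 0, dotp b K`_1 <= 0, dotp b K`_2 <= 0 & dotp b K`_3 <= 0].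
  by split; apply: admissible_le0; apply: xa.
move=> x0 x1 x2 x3.
have := @simple_system_test _ _ b K _ [:: 2; 3; 2 * rt2; rt2]%R sbK gK; rewrite szK => /(_ isT).
rewrite /= !big_ord_recl !big_ord0 /= /gram_F4 /bump /= -/rt2 => test.
have r22 := @rt2_sqr R; have r21 := @rt2_gt1 R; rewrite -/rt2 in r22 r21.
have r2x2 : rt2 * dotp b K`_2 <= 0 by nra.
have r2x3 : rt2 * dotp b K`_3 <= 0 by nra.
have pK : (p < 4)%N by lia.
by have := admissible_le (xa _ pK) xp; case: p p2 {pK xp} => [|[|]] // _ xq;
  exfalso; clear -test x0 x1 r22 r2x2 r2x3 xq; lra.
Qed.

Lemma extend_F4 b K p :
    has_gram (@gram_F4 R) K -> size K = 4%N -> simple_system (b :: K) ->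
    (p < size K)%N -> dotp b K`_p = 0.
Proof.
move=> gK szK sbK; rewrite szK => pK.
have [p2|p2] := ltnP p 2; first exact: extend_F4_half p2.
have nr k : (k < size K)%N -> (rev K)`_k = K`_(size K - k.+1) by exact: nth_rev.
have -> : K`_p = (rev K)`_(3 - p).
  by rewrite nr szK; [congr nth; lia|lia].
apply: extend_F4_half; first exact: has_gramF_rev.
- by rewrite size_rev.
- by apply: simple_system_perm sbK; rewrite perm_cons perm_sym perm_rev.
- by lia.
Qed.

(** The test vectors are the highest long and the highest short root, both of squared length 2; each
    is used at the node where its coefficient is 2. *)
Lemma extend_G2 b K p :
    has_gram (gram_chain 1 rt3) K -> size K = 2%N -> simple_system (b :: K) ->
    (p < size K)%N -> dotp b K`_p = 0.
Proof.
move=> gK szK sbK pK; apply/eqP; apply: contraT => xp; rewrite szK in pK.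
have xa i : (i < 2)%N -> admissible (dotp b K`_i).
  by move=> i6; apply: simple_system_adm sbK _; rewrite szK.
have [x0 x1] : dotp b K`_0 <= 0 /\ dotp b K`_1 <= 0.
  by split; apply: admissible_le0; apply: xa.
have r33 := @rt3_sqr R; have r21 := @rt2_gt1 R; have r32 := @rt3_gt_rt2 R.
rewrite -/rt3 in r33 r32.
have r3x0 : rt3 * dotp b K`_0 <= 0 by nra.
have r3x1 : rt3 * dotp b K`_1 <= 0 by nra.
have := admissible_le (xa _ pK) xp.
case: p pK {xp} => [|[|]] // _ xq; exfalso.
  have := @simple_system_test _ _ b K _ [:: 2; rt3]%R sbK gK; rewrite szK => /(_ isT).
  rewrite /= !big_ord_recl !big_ord0 /= /gram_chain /bump /= -/rt3 => test.
  by clear -test x0 x1 r33 r3x0 r3x1 xq; lra.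
have := @simple_system_test _ _ b K _ [:: rt3; 2]%R sbK gK; rewrite szK => /(_ isT).
rewrite /= !big_ord_recl !big_ord0 /= /gram_chain /bump /= -/rt3 => test.
by clear -test x0 x1 r33 r3x0 r3x1 xq; lra.
Qed.

Lemma classified_extend b K t :
    classified K -> simple_system (b :: K) -> t \in K -> dotp b t != 0 ->
  exists2 K', perm_eq K' (b :: K) & classified K'.
Proof.
move=> cK sbK /(nthP 0) [p pK <-] xp; case: cK => gK szK.
- exact: extend_TypeA xp.
- exact: extend_TypeB xp.
- exact: extend_TypeD xp.
- have [sz6|[sz7|sz8]] : size K = 6%N \/ size K = 7%N \/ size K = 8%N by lia.
  + exact: extend_E6 xp.
  + exact: extend_E7 xp.
  + by rewrite (extend_E8 gK) ?eqxx in xp.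
- by rewrite (extend_F4 gK) ?eqxx in xp.
- by rewrite (extend_G2 gK) ?eqxx in xp.
Qed.

End ExceptionalExtension.

(** * Types A, B and D *)

(* On each orbit of the abelian group [<<s, nu>>], with base point [x], the map
   [g x |-> g^-1 x] is a well defined involution inverting [s] and commuting
   with [nu]. *)
Section InvertingPermutation.

Local Open Scope group_scope.

Variables (X : finType) (nu s : {perm X}).
Hypotheses (nu2 : nu * nu = 1) (nu_s : commute nu s).

Let G := <<[set s; nu]>>%G.

Lemma inverting_abelian : abelian G.
Proof.
by rewrite abelian_gen; apply/centsP => x /set2P[]-> y /set2P[]-> //; apply: commute_sym.
Qed.

Let commG x y : x \in G -> y \in G -> x * y = y * x.
Proof. by move=> xG yG; apply: (centsP inverting_abelian). Qed.

Let sG : s \in G. Proof. by rewrite mem_gen // !inE eqxx. Qed.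
Let nuG : nu \in G. Proof. by rewrite mem_gen // !inE eqxx orbT. Qed.

Let r x := odflt x [pick y | y \in orbit 'P G x].

Let r_orbit x : r x \in orbit 'P G x.
Proof. by rewrite /r; case: pickP => //= /(_ x); rewrite orbit_refl. Qed.

Let r_eq x y : y \in orbit 'P G x -> r y = r x.
Proof.
move=> yx; have E : orbit 'P G y = orbit 'P G x by apply/orbit_eqP.
rewrite /r E; case: pickP => //= /(_ x); by rewrite orbit_refl.
Qed.

Let rP x : exists2 g, g \in G & g (r x) = x.
Proof.
have := r_orbit x; rewrite orbit_sym => /orbitP [g gG E].
by exists g.
Qed.

Let r_act g x : g \in G -> r (g (r x)) = r x.
Proof.
move=> gG; apply: r_eq; have [k kG kx] := rP x.
apply/orbitP; exists (k^-1 * g); first by rewrite groupM ?groupV.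
by rewrite /= apermE permM -{1}kx permK.
Qed.

Let h x := odflt 1 [pick g | (g \in G) && (g (r x) == x)].

Let hP x : h x \in G /\ h x (r x) = x.
Proof.
rewrite /h; case: pickP => [g /andP[gG /eqP gx] //|/=].
by have [g gG gx] := rP x => /(_ g); rewrite gG gx eqxx.
Qed.

Let f x := (h x)^-1 (r x).

(** Elements of an abelian group that agree at the base point have inverses that agree there, so the
    choice made in [h] does not matter. *)
Let fE g x : g \in G -> f (g (r x)) = g^-1 (r x).
Proof.
move=> gG; rewrite /f r_act //; set k := h _.
have [kG kr] := hP (g (r x)); rewrite r_act // -/k in kG kr.
apply: (@perm_inj _ g); rewrite permKV -permM commG ?groupV //.
by rewrite permM -kr permK.
Qed.

Let fK : involutive f.
Proof.
move=> x; have [g gG gx] := rP x; rewrite -{1}gx fE // fE ?groupV //.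
by rewrite invgK.
Qed.

Definition inverting_perm : {perm X} := perm (inv_inj fK).

Let ipE x : inverting_perm x = f x. Proof. exact: permE. Qed.

Lemma inverting_perm2 : inverting_perm * inverting_perm = 1.
Proof. by apply/permP => x; rewrite permM !ipE fK perm1. Qed.

Lemma inverting_permG k x : k \in G -> inverting_perm (k x) = k^-1 (inverting_perm x).
Proof.
move=> kG; rewrite !ipE; have [g gG gx] := rP x; rewrite -{1 2}gx.
rewrite -permM !fE ?groupM // invMg -!permM commG ?groupV //.
Qed.

Lemma inverting_perm_nu x : inverting_perm (nu x) = nu (inverting_perm x).
Proof.
rewrite inverting_permG //; congr (fun_of_perm _ _).
by apply: (mulgI nu); rewrite mulgV nu2.
Qed.

Lemma inverting_perm_s x : inverting_perm (s x) = s^-1 (inverting_perm x).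
Proof. exact: inverting_permG. Qed.

Lemma inverting_perm_orbit x : inverting_perm x \in orbit 'P G x.
Proof.
rewrite ipE; have [g gG gx] := rP x; rewrite -{1}gx fE //.
apply/orbitP; exists (g^-1 * g^-1); first by rewrite groupM ?groupV.
by rewrite /= apermE permM -{1}gx permK.
Qed.

Hypothesis nu_free : forall x, nu x != x.

Let nuK x : nu (nu x) = x. Proof. by rewrite -permM nu2 perm1. Qed.
Let nus x : nu (s x) = s (nu x). Proof. by rewrite -!permM -nu_s. Qed.
Let iK x : inverting_perm (inverting_perm x) = x.
Proof. by rewrite -permM inverting_perm2 perm1. Qed.
Let nuX k x : nu ((s ^+ k) x) = (s ^+ k) (nu x).
Proof. by rewrite -!permM (commuteX k nu_s). Qed.

Let actsG (Z : {set X}) : (forall x, x \in Z -> s x \in Z) ->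
  (forall x, x \in Z -> nu x \in Z) -> forall x y, y \in orbit 'P G x -> x \in Z -> y \in Z.
Proof.
move=> sZ nuZ; have actZ : [acts G, on Z | 'P].
  rewrite gen_subG; apply/subsetP => g /set2P[]->; rewrite !inE /=;
    apply/subsetP => x xZ; rewrite !inE /= apermE; [exact: sZ|exact: nuZ].
by move=> x y /orbitP [g gG <-] xZ; rewrite /= (acts_act actZ).
Qed.

(** Each orbit splits into two cycles of [s] exchanged by [nu], and [Y] collects the cycles through
    base points. The involution is [a] times its conjugate by [nu], where [a] is its restriction to
    [Y] extended by the identity; conjugates have equal parity. *)
Lemma inverting_perm_even :
  (forall x, nu x \notin porbit s x) -> inverting_perm = false :> bool.
Proof.
move=> no_neg; pose Y := [set x | x \in porbit s (r x)].
have r_nu x : r (nu x) = r x by apply: r_eq; apply/orbitP; exists nu.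
have YorNu x : (x \in Y) || (nu x \in Y).
  rewrite !inE r_nu.
  suff: x \in [set x' | (x' \in porbit s (r x)) || (nu x' \in porbit s (r x))] by rewrite inE.
  apply: (actsG _ _ (_ : x \in orbit 'P G (r x))).
  - move=> y; rewrite !inE nus => /orP[] /porbitP [k E].
      by rewrite {1}E -permM -expgSr mem_porbit.
    by rewrite E -permM -expgSr mem_porbit orbT.
  - by move=> y; rewrite !inE nuK orbC.
  - by rewrite orbit_sym.
  - by rewrite inE porbit_id.
have YNu x : x \in Y -> nu x \notin Y.
  rewrite !inE r_nu -!eq_porbit_mem => /eqP xr; apply: contra (no_neg x) => /eqP nxr.
  by rewrite xr -nxr porbit_id.
have iY x : x \in Y -> inverting_perm x \in Y.
  rewrite !inE (r_eq (inverting_perm_orbit x)) => /porbitP [k xk].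
  rewrite ipE {1}xk fE ?groupX // porbit_sym.
  by rewrite -{1}(permKV (s ^+ k) (r x)) mem_porbit.
have iYE x : (inverting_perm x \in Y) = (x \in Y).
  by apply/idP/idP => /iY; rewrite ?iK.
pose a x := if x \in Y then inverting_perm x else x.
have aK : involutive a.
  move=> x; rewrite /a; have [xY|/negbTE xY] := boolP (x \in Y); last by rewrite xY.
  by rewrite iYE xY iK.
have aE x : perm (inv_inj aK) x = a x by exact: permE.
have E : inverting_perm = perm (inv_inj aK) * perm (inv_inj aK) ^ nu.
  apply/permP => x; rewrite permM; have nuV : nu^-1 = nu.
    by apply: (mulgI nu); rewrite mulgV nu2.
  rewrite conjgE nuV !permM !aE /a; have [xY|xY] := boolP (x \in Y).
    by rewrite (negbTE (YNu _ _)) ?iYE // nuK.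
  have := YorNu x; rewrite (negbTE xY) => /= ->.
  by rewrite inverting_perm_nu nuK.
by rewrite E odd_permM odd_permJ addbb.
Qed.

(** A cycle of even length is an odd permutation. The length is even because [nu x = s^j x] gives
    [s^(2 j) x = x], and an odd length would then force [s^j x = x], against [nu_free]. *)
Lemma porbit_cycle_odd (c : {perm X}) x : nu x \in porbit s x ->
    (forall y, c y = if y \in porbit s x then s y else y) -> c = true :> bool.
Proof.
set O := porbit s x => nuO cE.
have sO y : (s y \in O) = (y \in O).
  by rewrite /O -!eq_porbit_mem -(porbit_perm s 1 y) expg1.
have cO y k : y \in O -> (c ^+ k) y = (s ^+ k) y /\ (s ^+ k) y \in O.
  move=> yO; elim: k => [|k [IH IHO]]; first by rewrite !expg0 perm1.
  by rewrite !expgSr !permM IH cE IHO sO.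
have cNO y k : y \notin O -> (c ^+ k) y = y.
  move=> yO; elim: k => [|k IH]; first by rewrite expg0 perm1.
  by rewrite expgSr permM IH cE (negbTE yO).
have porbE y : porbit c y = if y \in O then O else [set y].
  case: ifP => [yO|/negbT yO]; apply/setP => z.
    have -> : O = porbit s y by apply/esym/eqP; rewrite eq_porbit_mem.
    by apply/porbitP/porbitP => [] [k ->]; exists k; have [-> _] := cO y k yO.
  rewrite inE; apply/porbitP/eqP => [[k ->]|->]; first exact: cNO.
  by exists 0%N; rewrite expg0 perm1.
have porbsE : porbits c = O |: [set [set y] | y in ~: O].
  apply/setP => B; rewrite !inE; apply/imsetP/orP => [[y _ ->]|[/eqP->|/imsetP [y]]].
  - by rewrite porbE; case: ifP => [_|/negbT yO]; [left|right; rewrite imset_f // inE].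
  - by exists x; rewrite // porbE /O porbit_id.
  - by rewrite inE => yO ->; exists y; rewrite // porbE (negbTE yO).
have ON : O \notin [set [set y] | y in ~: O].
  apply/imsetP => [[y]]; rewrite inE => yO Oy; move: yO.
  by rewrite {1}Oy inE eqxx.
have cardO : odd #|O| = false.
  have [j nuj] := porbitP _ _ _ nuO.
  have sO1 : (s ^+ #|O|) x = x by rewrite permX iter_porbit.
  have s2j : (s ^+ (j + j)) x = x by rewrite expgD permM -nuj -nuX -nuj nuK.
  apply/negP => oddO; have := nu_free x; rewrite nuj => /negP []; apply/eqP.
  have sOj k : (s ^+ (k * #|O|)) x = x.
    by elim: k => [|k IH]; rewrite ?mul0n ?perm1 // mulSn expgD permM sO1.
  have s2k k : (s ^+ (k * (j + j))) x = x.
    by elim: k => [|k IH]; rewrite ?mul0n ?perm1 // mulSn expgD permM s2j.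
  (* As the length is odd, [j] times it is [j] plus a multiple of [2 j]. *)
  rewrite -{2}(sOj j); have -> : (j * #|O| = #|O|./2 * (j + j) + j)%N.
    by rewrite -{1}(odd_double_half #|O|) oddO; lia.
  by rewrite expgD permM s2k.
(* The parity of [c] is that of the number of points plus the number of cycles, which are [O] and
   the singletons outside it. *)
rewrite /odd_perm porbsE cardsU1 ON card_imset; last exact: set1_inj.
by rewrite -(cardsC O) !oddD cardO /= addbN addbb.
Qed.

Lemma even_inverting_perm : exists i : {perm X},
  [/\ i * i = 1, i = false :> bool, forall x, i (nu x) = nu (i x)
    & forall x, i (s x) = s^-1 (i x)].
Proof.
have [/existsP[x xneg]|] := boolP [exists x, nu x \in porbit s x]; last first.
  rewrite negb_exists => /forallP no_neg; exists inverting_perm.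
  split; [exact: inverting_perm2|exact: inverting_perm_even| |].
    exact: inverting_perm_nu.
  exact: inverting_perm_s.
have [iodd|ieven] := boolP (inverting_perm : bool); last first.
  exists inverting_perm; split; [exact: inverting_perm2|exact: negbTE| |].
    exact: inverting_perm_nu.
  exact: inverting_perm_s.
pose O := porbit s x.
have sO y : (s y \in O) = (y \in O).
  by rewrite /O -!eq_porbit_mem -(porbit_perm s 1 y) expg1.
have nuO y : y \in O -> nu y \in O.
  move=> /porbitP[k ->]; rewrite nuX; have /porbitP [l ->] := xneg.
  by rewrite -permM -expgD mem_porbit.
have nuOE y : (nu y \in O) = (y \in O).
  by apply/idP/idP => /nuO; rewrite ?nuK.
have iO y : y \in O -> inverting_perm y \in O.
  apply: actsG (inverting_perm_orbit y); last exact: nuO.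
  by move=> z; rewrite sO.
have iOE y : (inverting_perm y \in O) = (y \in O).
  by apply/idP/idP => /iO; rewrite ?iK.
pose g y := if y \in O then s y else y.
have g_inj : injective g.
  move=> y z; rewrite /g; case: ifP => yO; case: ifP => zO //.
  - exact: perm_inj.
  - by move=> E; rewrite -E sO yO in zO.
  - by move=> E; rewrite E sO zO in yO.
pose c := perm g_inj; have cE y : c y = g y by exact: permE.
have codd : c = true :> bool by apply: porbit_cycle_odd xneg cE.
(* [inverting_perm] preserves [O] and inverts [c], so the product is an involution; [c] commutes
   with [s], so the product still inverts [s]. *)
exists (inverting_perm * c); split.
- apply/permP => y; rewrite !permM perm1; have sVO z : (s^-1 z \in O) = (z \in O).
    by rewrite -sO permKV.
  rewrite [c (inverting_perm y)]cE /g iOE; have [yO|/negbTE yO] := boolP (y \in O).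
    by rewrite inverting_perm_s iK cE /g sVO yO permKV.
  by rewrite iK cE /g yO.
- by rewrite odd_permM codd iodd.
- move=> y; rewrite !permM !cE /g !iOE nuOE inverting_perm_nu.
  by case: ifP => // _; rewrite nus.
- move=> y; rewrite !permM !cE /g !iOE sO inverting_perm_s.
  by case: ifP => // _; rewrite permK permKV.
Qed.

End InvertingPermutation.

(** * From permutations of points to matrices *)

Section PermutedPoints.

Variables (R : realType) (n : nat) (K : seq 'cV[R]_n).
Variables (X : finType) (pt : X -> 'cV[R]_n) (nu : {perm X}) (P : {perm X} -> Prop).

Definition acts_by A (s : {perm X}) := forall p, A *m pt p = pt (s p).

(** Permutations compose from left to right and matrices from right to left, hence the reversed
    order. *)
Lemma acts_byM A B s t : acts_by A s -> acts_by B t -> acts_by (B *m A) (s * t)%g.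
Proof. by move=> As Bt p; rewrite -mulmxA As Bt permM. Qed.

(** [P] describes permutations known to come from the group. Since the points determine the matrix,
    an involution in [P] that inverts the permutation of [w] lifts to one that inverts [w]. *)
Lemma strongly_real_points :
    (forall A, refl_group K A -> acts_by A 1%g -> A = 1%:M) ->
    (forall t, t \in K -> exists2 s, acts_by (reflmx t) s & commute nu s) ->
    (forall s, P s -> exists2 A, refl_group K A & acts_by A s) ->
    (forall s, commute nu s -> exists i : {perm X},
       [/\ P i, (i * i = 1)%g & forall x, i (s x) = (s^-1)%g (i x)]) ->
  strongly_real (refl_group K).
Proof.
move=> faithful gens real inv w gw.
have [s ws nus] : exists2 s, acts_by w s & commute nu s.
  elim/refl_group_ind: gw => [|t A tK _ [s As nus]].
    by exists 1%g; [move=> p; rewrite mul1mx perm1|exact: commute1].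
  have [u tu nuu] := gens t tK; exists (s * u)%g; first exact: acts_byM.
  exact: commuteM.
have [i [Pi i2 is_]] := inv s nus; have [I gI Ii] := real i Pi; exists I; split=> //.
  by apply: faithful; [exact: generated_mul|rewrite -i2; apply: acts_byM].
apply: faithful; first by do 2!apply: generated_mul => //.
have -> : 1%g = (s * i * (s * i))%g.
  have ii x : i (i x) = x by rewrite -permM i2 perm1.
  by apply/permP => x; rewrite perm1 !permM is_ ii permK.
by do 2!apply: acts_byM.
Qed.

End PermutedPoints.

(** * Reflections permuting the vertices of a simplex *)

Section Simplex.

Variables (R : realType) (n m : nat) (K : seq 'cV[R]_n) (y : nat -> 'cV[R]_n) (c : R).
Hypothesis yy : forall i j, (i < m)%N -> (j < m)%N -> dotp (y i) (y j) = (i == j)%:R + c.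

(** The constant [c] cancels in differences, so the [y i] behave like an orthonormal frame under
    these reflections. *)
Lemma simplex_refl i j k : (i < m)%N -> (j < m)%N -> (k < m)%N -> i != j ->
  reflmx (y i - y j) *m y k = if k == i then y j else if k == j then y i else y k.
Proof.
move=> im jm km ij.
have nn : dotp (y i - y j) (y i - y j) = 2.
  by rewrite !dotp_lin !yy // !eqxx [j == i]eq_sym (negbTE ij) /=; ring.
have dk : dotp (y k) (y i - y j) = (k == i)%:R - (k == j)%:R.
  by rewrite dotpBr !yy //; ring.
rewrite reflmxEl nn dk mulrAC divff ?mul1r ?pnatr_eq0 //.
have [->|ki] := eqVneq k i.
  by rewrite (negbTE ij) subr0 scale1r opprB addrCA subrr addr0.
have [->|kj] := eqVneq k j; last by rewrite subrr scale0r subr0.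
by rewrite sub0r scaleN1r opprK addrCA subrr addr0.
Qed.

Hypothesis yK : forall i, (i.+1 < m)%N -> refl_group K (reflmx (y i.+1 - y i)).

(** Adjacent transpositions generate: the reflection in [y i.+1 - y i] carries [y i - y j] to
    [y i.+1 - y j]. *)
Lemma simplex_refl_group i j : (i < m)%N -> (j < m)%N -> i != j ->
  refl_group K (reflmx (y i - y j)).
Proof.
wlog ij : i j / (j < i)%N.
  move=> W im jm ij; have [lt|lt|E] := ltngtP i j; last by rewrite E eqxx in ij.
    by rewrite -opprB reflmx_opp; apply: W => //; rewrite eq_sym.
  exact: W.
elim: i ij => // i IH; rewrite ltnS leq_eqVlt => /orP[/eqP<-|ji] im jm _.
  exact: yK.
have im' : (i < m)%N by lia.
have -> : y i.+1 - y j = reflmx (y i.+1 - y i) *m (y i - y j).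
  rewrite mulmxBr !simplex_refl //; [|by lia..].
  have [-> -> ->] : [/\ (i == i.+1) = false, (j == i.+1) = false & (j == i) = false].
    by split; lia.
  by rewrite eqxx.
by apply: refl_group_conj; [exact: yK|apply: IH => //; lia].
Qed.

End Simplex.

(** * Strong reality in type A *)

Section TypeA.

Variables (R : realType) (n : nat).
Implicit Types K : seq 'cV[R]_n.

(** For [k = size K] this is [size K + 1] times the fundamental weight of the last node of type A;
    the shorter sums serve the induction. *)
Fixpoint chain_weight K k : 'cV[R]_n :=
  if k is k'.+1 then chain_weight K k' + k%:R *: K`_k' else 0.

Lemma chain_weightE K k i :
    has_gram (gram_chain 1 1) K -> (k <= size K)%N -> (i < size K)%N ->
  dotp (chain_weight K k) K`_i = (k == i.+1)%:R * k.+1%:R - (k == i)%:R * k%:R.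
Proof.
move=> gK + iK; elim: k => [|k IH] kK /=.
  by rewrite dotp0l mulr0 subr0 mul0r.
rewrite dotpDl dotpZl IH; last by lia.
rewrite gK //; have [ki|[ki|[ki|ki]]] :
    k.+1 = i \/ (k = i \/ (k = i.+1 \/ (k != i) && (k != i.+1) && (k.+1 != i))) by lia.
- rewrite -ki eqxx !eqSS /gram_chain ?eqxx.
  have -> : (k == k.+2) = false by lia.
  have -> : (k == k.+1) = false by lia.
  by case: k {IH kK ki} => [|k] /=; rewrite ?mul0r ?eqxx /=; ring.
- rewrite ki !eqxx /gram_chain eqxx /=.
  have -> : (i == i.+1) = false by lia.
  have -> : (i.+1 == i) = false by lia.
  by rewrite -[i.+2%:R]natr1 -[i.+1%:R]natr1 /=; ring.
- rewrite ki eqxx eqSS /gram_chain.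
  have -> : (i.+1 == i) = false by lia.
  have -> : (i.+2 == i) = false by lia.
  by case: i {IH kK ki iK} => [|i] /=; rewrite ?eqxx ?orbT /= -[_.+2%:R]natr1 /=; ring.
- move: ki => /andP[/andP[ki1 ki2] ki3].
  rewrite (negbTE ki1) (negbTE ki2) (negbTE ki3) eqSS (negbTE ki1) /gram_chain (negbTE ki1).
  have -> : [&& 0 < k, 0 < i & (k == i.+1) || (i == k.+1)]%N = false by lia.
  have -> : ((k == 0) && (i == 1) || (i == 0) && (k == 1))%N = false by lia.
  by rewrite /=; ring.
Qed.

(** Node 0 is the last node of the reversed chain, so minus the fundamental weight of that node has
    the required products. *)
Lemma chain_dual K : has_gram (gram_chain 1 1) K ->
  exists e, forall i, (i < size K)%N -> dotp e K`_i = - (i == 0)%:R.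
Proof.
move=> gK; exists (- (size K).+1%:R^-1 *: chain_weight (rev K) (size K)) => i iK.
have nr k : (k < size K)%N -> (rev K)`_k = K`_(size K - k.+1) by exact: nth_rev.
have kK : (size K - i.+1 < size K)%N by lia.
have -> : K`_i = (rev K)`_(size K - i.+1).
  by rewrite nr //; congr nth; lia.
rewrite dotpZl chain_weightE ?size_rev //; last exact: has_gram_rev.
have -> : (size K == size K - i.+1)%N = false by lia.
have -> : (size K == (size K - i.+1).+1)%N = (i == 0)%N by lia.
rewrite mul0r subr0; case: eqP => _; rewrite ?mul0r ?mulr0 ?oppr0 //.
by rewrite mul1r mulNr mulVf // pnatr_eq0.
Qed.

Lemma strongly_real_TypeA K :
  has_gram (gram_chain 1 1) K -> strongly_real (refl_group K).
Proof.
move=> gK; have [e eK] := chain_dual gK.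
have [y y0 yS] : exists2 y : nat -> 'cV[R]_n, y 0%N = e & forall i, y i.+1 = y i + K`_i.
  (* [frame] skips the entry of index 0, so a dummy [0] makes the sums start with the first entry of
     [K]. *)
  by exists (frame e (0 :: K)).
have yKE k i : (k <= size K)%N -> (i < size K)%N ->
    dotp (y k) K`_i = (k == i.+1)%:R - (k == i)%:R.
  move=> + iK; elim: k => [|k IH] kK.
    by rewrite y0 eK // [(0 == i)%N]eq_sym sub0r.
  rewrite yS dotpDl IH; last by lia.
  by rewrite gK // /gram_chain !lt0n; do !case: eqP => ? /=; try (exfalso; lia); ring.
have y0E k : (k <= size K)%N -> dotp (y 0) (y k) = (0 == k)%N%:R + (dotp e e - 1).
  elim: k => [|k IH] kK; first by rewrite y0 /=; ring.
  rewrite yS dotpDr IH; last by lia.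
  by rewrite yKE //; case: k {IH kK} => [|k] /=; ring.
have yy k i : (k < (size K).+1)%N -> (i < (size K).+1)%N ->
    dotp (y k) (y i) = (k == i)%:R + (dotp e e - 1).
  move=> kK; elim: i => [|i IH] iK; first by rewrite dotpC y0E // eq_sym.
  rewrite yS dotpDr IH; last by lia.
  by rewrite yKE //; ring.
have KE i : K`_i = y i.+1 - y i by rewrite yS addrC addKr.
have yG i : (i.+1 < (size K).+1)%N -> refl_group K (reflmx (y i.+1 - y i)).
  by move=> iK; rewrite -KE; apply/refl_group_gen/mem_nth.
pose pt (i : 'I_(size K).+1) := y i.
have act (i j : 'I_(size K).+1) : i != j -> acts_by pt (reflmx (y i - y j)) (tperm i j).
  move=> ij k; rewrite /pt (simplex_refl yy) //.
  have vE (a b : 'I_(size K).+1) : (a == b :> nat) = (a == b) by [].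
  rewrite !vE; case: tpermP => [->|->|/eqP/negbTE-> /eqP/negbTE->//]; rewrite eqxx //.
  by rewrite eq_sym (negbTE ij).
(* In type A every permutation of the points is realised, and [nu] is trivial. *)
apply: (@strongly_real_points _ _ K _ pt 1%g xpredT).
- move=> A gA A1; apply: refl_group_faithful gA _ => _ /(nthP 0) [i iK <-].
  have iK1 : (i < (size K).+1)%N by exact: leqW iK.
  rewrite KE mulmxBr; have := A1 (Ordinal iK1); have := A1 (Ordinal (iK : i.+1 < (size K).+1)%N).
  by rewrite !perm1 /pt /= => -> ->.
- move=> _ /(nthP 0) [i iK <-]; have iK1 : (i < (size K).+1)%N by exact: leqW iK.
  pose a := Ordinal (iK : i.+1 < (size K).+1)%N; pose b := Ordinal iK1.
  exists (tperm a b); last exact: commute_sym (commute1 _).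
  have ab : a != b by rewrite -val_eqE /= neq_ltn ltnSn orbT.
  by have := act a b ab; rewrite /= -KE.
- move=> s _; have [ts -> /allP dts] := prod_tpermP s.
  elim: ts dts => [|t ts IH] dts.
    exists 1%:M; first exact: generated_1.
    by move=> p; rewrite mul1mx big_nil perm1.
  have [|A gA As] := IH; first by move=> x xts; apply: dts; rewrite inE xts orbT.
  have dt := dts t (mem_head _ _).
  exists (A *m reflmx (y t.1 - y t.2)).
    apply: generated_mul => //; apply: (simplex_refl_group yy yG) => //.
  by rewrite big_cons; apply: acts_byM => //; apply: act.
- move=> s _.
  have n1s : commute 1%g s := commute_sym (commute1 s).
  exists (inverting_perm n1s); split=> //; first exact: inverting_perm2.
  exact: inverting_perm_s.
Qed.

End TypeA.

(** * Signed permutations of an orthonormal frame *)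

Section SignedPermutations.

Variables (R : realType) (n m : nat) (K : seq 'cV[R]_n) (e : nat -> 'cV[R]_n) (flip : bool).
Hypothesis ee : forall i j, (i < m)%N -> (j < m)%N -> dotp (e i) (e j) = (i == j)%:R.

Notation X := ('I_m * bool)%type.
Definition signed_point (p : X) : 'cV[R]_n := (-1) ^+ p.2 *: e p.1.
Notation pt := signed_point.

Definition opp_index (p : X) : X := (p.1, ~~ p.2).
Lemma opp_indexK : involutive opp_index.
Proof. by case=> i b; rewrite /opp_index /= negbK. Qed.
Definition opp_perm := perm (inv_inj opp_indexK).
Notation nu := opp_perm.

Lemma opp_permE p : nu p = (p.1, ~~ p.2).
Proof. exact: permE. Qed.

Lemma opp_permK p : nu (nu p) = p.
Proof. by rewrite !opp_permE /= negbK; case: p. Qed.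

Lemma opp_perm2 : (nu * nu = 1)%g.
Proof. by apply/permP => p; rewrite permM perm1 opp_permK. Qed.

Lemma opp_perm_free p : nu p != p.
Proof. by rewrite opp_permE; case: p => i []; rewrite -pair_eqE /= eqxx. Qed.

Lemma opp_perm_inj p q : (nu p == nu q) = (p == q).
Proof. exact/inj_eq/perm_inj. Qed.

Lemma opp_perm_eqC p q : (nu p == q) = (p == nu q).
Proof. by rewrite -{1}[q]opp_permK opp_perm_inj. Qed.

Lemma signed_pointN p : pt (nu p) = - pt p.
Proof.
rewrite opp_permE /pt /=; case: p.2 => /=.
  by rewrite expr0 expr1 scaleN1r opprK scale1r.
by rewrite expr0 expr1 scaleN1r scale1r.
Qed.

Lemma signed_point_dotp p q : dotp (pt p) (pt q) = (p == q)%:R - (p == nu q)%:R.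
Proof.
rewrite /pt dotpZl dotpZr ee // opp_permE -!pair_eqE /= /pair_eq /=.
have -> : (p.1 == q.1 :> nat) = (p.1 == q.1) by [].
by case: eqP => _; case: p.2; case: q.2; rewrite /= ?expr0 ?expr1; ring.
Qed.

(** Linearity forces the second transposition: what exchanges two signed vectors also exchanges
    their opposites. *)
Definition swap_perm (p q : X) : {perm X} := (tperm p q * tperm (nu p) (nu q))%g.

Lemma swap_perm_even p q : p != q -> swap_perm p q = false :> bool.
Proof. by move=> pq; rewrite odd_permM !odd_tperm opp_perm_inj pq. Qed.

Lemma swap_permE p q x : p != q -> p != nu q -> swap_perm p q x =
  if x == p then q else if x == q then p else if x == nu p then nu q
  else if x == nu q then nu p else x.
Proof.
move=> pq pnq; rewrite permM.
have qnp : q != nu p by rewrite eq_sym opp_perm_eqC.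
case: (tpermP p q x) => [->|->|/eqP/negbTE xp /eqP/negbTE xq].
- by rewrite eqxx tpermD ?opp_perm_free // eq_sym.
- by rewrite eq_sym (negbTE pq) eqxx tpermD ?opp_perm_free // eq_sym.
rewrite xp xq; case: tpermP => [->|->|/eqP/negbTE-> /eqP/negbTE->//]; rewrite ?eqxx //.
by rewrite opp_perm_inj eq_sym (negbTE pq).
Qed.

Lemma swap_perm_refl p q : p != q -> p != nu q ->
  acts_by pt (reflmx (pt p - pt q)) (swap_perm p q).
Proof.
move=> pq pnq x; rewrite swap_permE // reflmxEl.
have qnp : q != nu p by rewrite eq_sym opp_perm_eqC.
have nn : dotp (pt p - pt q) (pt p - pt q) = 2.
  rewrite dotpBl !dotpBr !signed_point_dotp !eqxx [q == p]eq_sym (negbTE pq) (negbTE pnq).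
  rewrite (negbTE qnp) ![_ == nu _]eq_sym !(negbTE (opp_perm_free _)) /=; ring.
rewrite nn mulrAC divff ?mul1r ?pnatr_eq0 // dotpBr !signed_point_dotp.
have [npF nqF] := (negbTE (opp_perm_free p), negbTE (opp_perm_free q)).
have [->|xp] := eqVneq x p.
  rewrite (negbTE pq) (negbTE pnq) [p == nu p]eq_sym npF /= !subr0 scale1r.
  by rewrite opprB addrCA subrr addr0.
have [->|xq] := eqVneq x q.
  rewrite (negbTE qnp) [q == nu q]eq_sym nqF /= !subr0 sub0r scaleN1r opprK.
  by rewrite addrCA subrr addr0.
have [->|xnp] := eqVneq x (nu p).
  rewrite opp_perm_inj (negbTE pq) /= !signed_pointN sub0r !subr0 scaleN1r opprK.
  by rewrite addrA addNr add0r.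
have [->|xnq] := eqVneq x (nu q).
  by rewrite /= !signed_pointN subrr !sub0r opprK scale1r opprB addrA addNr add0r.
by rewrite /= !subr0 scale0r subr0.
Qed.

Lemma flip_perm_refl p : acts_by pt (reflmx (pt p)) (tperm p (nu p)).
Proof.
move=> x; rewrite reflmxEl !signed_point_dotp eqxx [p == nu p]eq_sym.
rewrite (negbTE (opp_perm_free _)) subr0 divr1.
case: tpermP => [->|->|/eqP/negbTE-> /eqP/negbTE->].
- rewrite eqxx [p == nu p]eq_sym (negbTE (opp_perm_free _)) subr0 mulr1.
  by rewrite signed_pointN scaler_nat mulr2n opprD addrA subrr sub0r.
- rewrite (negbTE (opp_perm_free _)) eqxx sub0r mulrN1 signed_pointN.
  by rewrite scaleNr opprK scaler_nat mulr2n addrA addNr add0r.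
- by rewrite subrr mulr0 scale0r subr0.
Qed.

Lemma swap_perm_commute p q : p != q -> p != nu q -> commute nu (swap_perm p q).
Proof.
move=> pq pnq; apply/permP => x.
rewrite permM [RHS]permM !swap_permE // !opp_perm_inj !opp_perm_eqC.
have qnp : q != nu p by rewrite eq_sym opp_perm_eqC.
have [->|xp] := eqVneq x p.
  by rewrite [p == nu p]eq_sym (negbTE (opp_perm_free _)) (negbTE pnq).
have [->|xq] := eqVneq x q.
  by rewrite (negbTE qnp) [q == nu q]eq_sym (negbTE (opp_perm_free _)).
by case: ifP => _; [rewrite opp_permK|case: ifP => _ //; rewrite opp_permK].
Qed.

Lemma flip_perm_commute p : commute nu (tperm p (nu p)).
Proof.
apply/permP => x; rewrite !permM.
case: (tpermP p (nu p) x) => [->|->|/eqP xp /eqP xnp]; rewrite ?tpermR ?opp_permK ?tpermL //.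
by rewrite tpermD // eq_sym ?opp_perm_inj // opp_perm_eqC.
Qed.

Lemma swap_perm2 p q : p != q -> p != nu q -> (swap_perm p q * swap_perm p q = 1)%g.
Proof.
move=> pq pnq; have qnp : q != nu p by rewrite eq_sym opp_perm_eqC.
have [npF nqF] := (negbTE (opp_perm_free p), negbTE (opp_perm_free q)).
have qp : q != p by rewrite eq_sym.
apply/permP => x; rewrite permM perm1 !(swap_permE _ pq pnq).
have [->|xp] := eqVneq x p; first by rewrite (negbTE qp) eqxx.
have [->|xq] := eqVneq x q; first by rewrite eqxx.
have [->|xnp] := eqVneq x (nu p).
  by rewrite [nu q == p]eq_sym (negbTE pnq) nqF opp_perm_inj (negbTE qp) eqxx.
have [->|xnq] := eqVneq x (nu q).
  by rewrite npF [nu p == q]eq_sym (negbTE qnp) eqxx.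
by rewrite (negbTE xp) (negbTE xq) (negbTE xnp) (negbTE xnq).
Qed.


Hypothesis K_swap : forall p q, p != q -> p != nu q -> refl_group K (reflmx (pt p - pt q)).
Hypothesis K_flip : flip -> forall p, refl_group K (reflmx (pt p)).
Hypothesis KE : forall t, t \in K -> exists2 a, a != 0 &
  (exists p q, [/\ p != q, p != nu q & t = a *: (pt p - pt q)]) \/
  (flip /\ exists p, t = a *: pt p).

(** A swap of two frame vectors is even on signed points and a single sign change is odd, so the
    parity of [s] counts sign changes; the even ones make up type D. The induction is on the number
    of moved points. *)
Lemma signed_perm_realized (s : {perm X}) : commute nu s -> flip || ~~ s ->
  exists2 A, refl_group K A & acts_by pt A s.
Proof.
move: {2}_.+1 (ltnSn #|[set x | s x != x]|) => k; elim: k s => // k IH s sk nus par.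
have snu x : s (nu x) = nu (s x) by rewrite -!permM nus.
(* [t] brings [s p] back to [p] and fixes whatever [s] fixes, so [s * t] moves fewer points; [A]
   realises the inverse [u] of [t]. *)
have step (t u : {perm X}) A : refl_group K A -> acts_by pt A u -> (t * u = 1)%g ->
    commute nu t -> flip || ~~ t -> (exists2 p, s p != p & t (s p) = p) ->
    (forall x, s x = x -> t x = x) -> exists2 A, refl_group K A & acts_by pt A s.
  move=> gA Au tu nut part [p sp tsp] fixt.
  have [|||B gB Bs] := IH (s * t)%g.
  - apply: leq_trans (proper_card _) sk; apply/properP; split.
      by apply/subsetP => x; rewrite !inE permM; apply: contra => /eqP sx; rewrite sx fixt.
    by exists p; rewrite !inE ?permM ?tsp ?eqxx.
  - exact: commuteM.
  - by move: par part; rewrite odd_permM; case: flip; case: (odd_perm s); case: (odd_perm t).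
  exists (A *m B); first exact: generated_mul.
  have -> : s = (s * t * u)%g by rewrite -mulgA tu mulg1.
  exact: acts_byM.
(* A signed vector sent to a different axis is brought back by a swap. *)
have [/existsP[p /andP[sp spn]]|] := boolP [exists p, (s p != p) && (s p != nu p)].
  apply: (step (swap_perm (s p) p) (swap_perm (s p) p) (reflmx (pt (s p) - pt p))).
  - exact: K_swap.
  - exact: swap_perm_refl.
  - exact: swap_perm2.
  - exact: swap_perm_commute.
  - by rewrite swap_perm_even ?orbT.
  - by exists p; rewrite // swap_permE // eqxx.
  - move=> x sx; rewrite swap_permE //; case: eqP => [xsp|_].
      by move: sx; rewrite xsp => /perm_inj E; rewrite E eqxx in sp.
    case: eqP => [xp|_]; first by rewrite -xp sx eqxx in sp.
    case: eqP => [xsp|_].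
      by move: sx; rewrite xsp snu => /perm_inj /perm_inj E; rewrite E eqxx in sp.
    case: eqP => [xp|//]; move: sx; rewrite xp snu => /perm_inj E.
    by rewrite E eqxx in sp.
rewrite negb_exists => /forallP all_flip.
have sE p : s p = p \/ s p = nu p.
  by have := all_flip p; rewrite negb_and !negbK => /orP[]/eqP; [left|right].
have [s1|] := boolP [forall p, s p == p].
  exists 1%:M; first exact: generated_1.
  by move=> p; rewrite mul1mx (eqP (forallP s1 p)).
rewrite negb_forall => /existsP[p sp]; have [E|spn] := sE p; first by rewrite E eqxx in sp.
have snp : s (nu p) = p by rewrite snu spn opp_permK.
have fix_neq x : s x = x -> (x == p = false) * (x == nu p = false).
  move=> sx; split; apply/eqP => xE; move: (opp_perm_free p).
    by rewrite -spn -xE sx xE eqxx.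
  by rewrite -xE -sx xE snp eqxx.
have [fl|nfl] := boolP flip.
  apply: (step (tperm p (nu p)) (tperm p (nu p)) (reflmx (pt p))).
  - exact: K_flip.
  - exact: flip_perm_refl.
  - exact: tperm2.
  - exact: flip_perm_commute.
  - by rewrite fl.
  - by exists p; rewrite // spn tpermR.
  - by move=> x sx; rewrite tpermD // eq_sym fix_neq.
have [/existsP[q /and3P[sq qp qnp]]|] :=
    boolP [exists q, [&& s q != q, q != p & q != nu p]]; last first.
  rewrite negb_exists => /forallP noq; exfalso.
  have sT : s = tperm p (nu p).
    apply/permP => x; case: tpermP => [->//|->//|/eqP xp /eqP xnp].
    by have := noq x; rewrite xp xnp !andbT negbK => /eqP.
  by move: par; rewrite (negbTE nfl) sT odd_tperm eq_sym opp_perm_free.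
have sqn : s q = nu q by have [E|//] := sE q; rewrite E eqxx in sq.
have pq : p != q by rewrite eq_sym.
have pnq : p != nu q by rewrite -opp_perm_eqC eq_sym.
have pnnq : p != nu (nu q) by rewrite opp_permK.
(* The reflections in the difference and in the sum of the two vectors together change both
   signs. *)
apply: (step (swap_perm p q * swap_perm p (nu q))%g (swap_perm p (nu q) * swap_perm p q)%g
  (reflmx (pt p - pt q) *m reflmx (pt p - pt (nu q)))).
- by apply: generated_mul; apply: K_swap.
- by apply: acts_byM; apply: swap_perm_refl.
- by rewrite -mulgA (mulgA (swap_perm p (nu q))) swap_perm2 // mul1g swap_perm2.
- by apply: commuteM; apply: swap_perm_commute.
- by rewrite odd_permM !swap_perm_even // orbT.
- exists p => //; rewrite permM spn (swap_permE (nu p) pq pnq).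
  rewrite (negbTE (opp_perm_free _)) [nu p == q]eq_sym (negbTE qnp) eqxx.
  by rewrite (swap_permE _ pnq pnnq) [nu q == p]eq_sym (negbTE pnq) eqxx.
- move=> x sx; have [xp xnp] := fix_neq x sx.
  have xq : (x == q) = false by apply/eqP => xE; rewrite -xE sx eqxx in sq.
  have xnq : (x == nu q) = false.
    by apply/eqP => xE; move: sq; rewrite -[q]opp_permK -xE snu sx eqxx.
  rewrite permM (swap_permE x pq pnq) xp xq xnp xnq.
  by rewrite (swap_permE x pnq pnnq) opp_permK xp xq xnp xnq.
Qed.

(** The involution of [even_inverting_perm] is even, so it is realised with or without single sign
    changes. *)
Lemma strongly_real_signed : strongly_real (refl_group K).
Proof.
apply: (@strongly_real_points _ _ K _ pt nu (fun s => commute nu s /\ flip || ~~ s)).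
- move=> A gA A1; apply: refl_group_faithful gA _ => t /KE [a _ [[p [q [_ _ ->]]]|[_ [p ->]]]].
    by rewrite -scalemxAr mulmxBr !A1 !perm1.
  by rewrite -scalemxAr !A1 !perm1.
- move=> t /KE [a a0 [[p [q [pq pnq ->]]]|[_ [p ->]]]]; rewrite reflmxZ //.
    by exists (swap_perm p q); [exact: swap_perm_refl|exact: swap_perm_commute].
  by exists (tperm p (nu p)); [exact: flip_perm_refl|exact: flip_perm_commute].
- by move=> s [nus par]; apply: signed_perm_realized.
- move=> s nus; have [i [i2 ie inu is_]] := even_inverting_perm opp_perm2 nus opp_perm_free.
  exists i; split=> //; split; last by rewrite ie orbT.
  by apply/permP => x; rewrite !permM inu.
Qed.


End SignedPermutations.

(** * Strong reality in types B and D *)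

Section TypeBD.

Variables (R : realType) (n : nat).
Implicit Types K : seq 'cV[R]_n.

Let rt2 : R := Num.sqrt 2.

Lemma signed_swap_refl m (e : nat -> 'cV[R]_n) K :
    (forall i j, (i < m)%N -> (j < m)%N -> i != j -> refl_group K (reflmx (e i - e j))) ->
    (forall i j, (i < m)%N -> (j < m)%N -> i != j -> refl_group K (reflmx (e i + e j))) ->
  forall p q : 'I_m * bool, p != q -> p != opp_perm m q ->
    refl_group K (reflmx (signed_point e p - signed_point e q)).
Proof.
move=> em ep [i b] [j c]; rewrite opp_permE /signed_point /= -!pair_eqE /= /pair_eq /=.
have [<-|ij] := eqVneq i j; first by case: b; case: c.
move=> _ _; have em' := em i j (ltn_ord _) (ltn_ord _) ij.
have ep' := ep i j (ltn_ord _) (ltn_ord _) ij.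
case: b; case: c; rewrite /= ?expr0 ?expr1 ?scaleN1r ?scale1r ?opprK //.
  by rewrite addrC -opprB reflmx_opp.
by rewrite -opprD reflmx_opp.
Qed.

Section Framed.

Variables (K : seq 'cV[R]_n) (q : nat) (c : R) (e : 'cV[R]_n).
Hypotheses (gK : has_gram (gram_chain q c) K) (oe : frame_origin e K).

Let y := frame e K.

Lemma frame_simplex i j : (i < size K)%N -> (j < size K)%N ->
  dotp (y i) (y j) = (i == j)%:R + 0.
Proof. by move=> iK jK; rewrite addr0; apply: frame_orthonormal gK oe _ _. Qed.

Lemma frame_minus_refl i j : (i < size K)%N -> (j < size K)%N -> i != j ->
  refl_group K (reflmx (y i - y j)).
Proof.
apply: (simplex_refl_group frame_simplex) => k kK.
by rewrite /y /= addrAC subrr add0r; apply/refl_group_gen/mem_nth.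
Qed.

Lemma frame_signed i (iK : (i.+1 < size K)%N) : exists p r : 'I_(size K) * bool,
  [/\ p != r, p != opp_perm _ r & K`_i.+1 = 1 *: (signed_point y p - signed_point y r)].
Proof.
exists (Ordinal iK, false), (Ordinal (ltnW iK), false).
rewrite opp_permE -!pair_eqE /= /pair_eq /= -!val_eqE /= andbF (gtn_eqF (ltnSn i)); split=> //.
by rewrite /signed_point /= expr0 !scale1r addrAC subrr add0r.
Qed.

End Framed.

(** The first node is proportional to [y_0]; permuting the frame gives every [y_i], and reflecting
    [y_i - y_j] in [y_j] gives [y_i + y_j]. *)
Lemma strongly_real_TypeB K :
  has_gram (gram_chain 1 rt2) K -> (0 < size K)%N -> strongly_real (refl_group K).
Proof.
move=> gK K0; have oe := frame_originB gK K0; rewrite -/rt2 in oe.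
have r21 := @rt2_gt1 R; rewrite -/rt2 in r21.
have r20 : rt2 != 0 by rewrite gt_eqF //; apply: lt_trans r21.
set e := rt2^-1 *: K`_0 in oe; have K0E : K`_0 = rt2 *: frame e K 0.
  by rewrite /= scalerA mulfV // scale1r.
have yy := frame_simplex gK oe; have minus := frame_minus_refl gK oe.
have flips i : (i < size K)%N -> refl_group K (reflmx (frame e K i)).
  move=> iK; have g0 : refl_group K (reflmx (frame e K 0)).
    by rewrite -(reflmxZ _ r20) -K0E; apply/refl_group_gen/mem_nth.
  have [->//|i0] := eqVneq i 0%N.
  have := refl_group_conj (minus i 0%N iK K0 i0) g0.
  by rewrite (simplex_refl yy) // eqxx [(0 == i)%N]eq_sym (negbTE i0).
have plus i j : (i < size K)%N -> (j < size K)%N -> i != j ->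
    refl_group K (reflmx (frame e K i + frame e K j)).
  move=> iK jK ij; have := refl_group_conj (flips j jK) (minus i j iK jK ij).
  have -> : reflmx (frame e K j) *m (frame e K i - frame e K j) = frame e K i + frame e K j.
    rewrite mulmxBr reflmx_orthogonal ?(frame_orthonormal gK oe) ?(negbTE ij) //.
    rewrite reflmxEl (frame_orthonormal gK oe) // eqxx mulr1 divr1.
    by rewrite scaler_nat mulr2n opprB addrK.
  by [].
apply: (@strongly_real_signed _ _ (size K) K (frame e K) true).
- by move=> i j iK jK; rewrite yy // addr0.
- exact: signed_swap_refl.
- move=> _ [i b]; rewrite /signed_point /=.
  by rewrite reflmxZ ?signr_eq0 //; apply: flips.
- move=> _ /(nthP 0) [[|i] iK <-].
    exists rt2 => //; right; split=> //; exists (Ordinal K0, false).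
    by rewrite /signed_point expr0 scale1r.
  exists 1; rewrite ?oner_eq0 //; left; exact: frame_signed.
Qed.

(** Permuting the frame turns the first node, [y_0 + y_1], into every [y_i + y_j]. *)
Lemma strongly_real_TypeD K :
  has_gram (gram_chain 2 1) K -> (1 < size K)%N -> strongly_real (refl_group K).
Proof.
move=> gK K1; have K0 := ltnW K1; have oe := frame_originD gK K1.
set e := 2^-1 *: (K`_0 - K`_1) in oe.
have K0E : K`_0 = frame e K 0 + frame e K 1.
  rewrite /= addrA -mulr2n -scaler_nat /e scalerA mulfV ?pnatr_eq0 // scale1r.
  by rewrite subrK.
have yy := frame_simplex gK oe; have minus := frame_minus_refl gK oe.
have g0 : refl_group K (reflmx (frame e K 0 + frame e K 1)).
  by rewrite -K0E; apply/refl_group_gen/mem_nth.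
have plus0 j : (j < size K)%N -> j != 0%N ->
    refl_group K (reflmx (frame e K 0 + frame e K j)).
  move=> jK j0; have [->//|j1] := eqVneq j 1%N.
  have := refl_group_conj (minus j 1%N jK K1 j1) g0.
  rewrite mulmxDr !(simplex_refl yy) // !eqxx /=.
  by rewrite ![(_ == j)%N]eq_sym (negbTE j0) (negbTE j1).
have plus i j : (i < size K)%N -> (j < size K)%N -> i != j ->
    refl_group K (reflmx (frame e K i + frame e K j)).
  move=> iK jK ij; have [i0|i0] := eqVneq i 0%N.
    by rewrite i0; apply: plus0 => //; rewrite -i0 eq_sym.
  have [->|j0] := eqVneq j 0%N; first by rewrite addrC; apply: plus0.
  have := refl_group_conj (minus i 0%N iK K0 i0) (plus0 j jK j0).
  rewrite mulmxDr !(simplex_refl yy) // eqxx [(0 == i)%N]eq_sym (negbTE i0).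
  by rewrite [j == i]eq_sym (negbTE ij) (negbTE j0).
apply: (@strongly_real_signed _ _ (size K) K (frame e K) false) => //.
- by move=> i j iK jK; rewrite yy // addr0.
- exact: signed_swap_refl.
- move=> _ /(nthP 0) [[|i] iK <-]; exists 1; rewrite ?oner_eq0 //; left; last exact: frame_signed.
  exists (Ordinal K0, false), (Ordinal K1, true).
  rewrite opp_permE -!pair_eqE /= /pair_eq /=; split=> //.
  by rewrite /signed_point expr0 expr1 !scale1r scaleN1r opprK.
Qed.

End TypeBD.

(** * Exceptional types *)

Section IntegerReflections.

(* Integer coordinates over a list of vectors; a reflection
   [x |-> x - f(x) r] is stored as the pair [(r, f)]. *)
Definition ireflection := (seq Z * seq Z)%type.

Fixpoint idot (f z : seq Z) : Z :=
  match f, z with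
  | a :: f', b :: z' => Z.add (Z.mul a b) (idot f' z')
  | _, _ => Z0
  end.

Fixpoint isub (c : Z) (z r : seq Z) : seq Z :=
  match z, r with
  | a :: z', b :: r' => Z.sub a (Z.mul c b) :: isub c z' r'
  | [::], b :: r' => Z.opp (Z.mul c b) :: isub c [::] r'
  | _, [::] => z
  end.

Definition ireflect (p : ireflection) (z : seq Z) := isub (idot p.2 z) z p.1.

(** The root is reflected by [p] and the form is composed with [p]:
    [f(x - f_p(x) r_p) = f(x) - f(r_p) f_p(x)]. *)
Definition iconj (p q : ireflection) : ireflection :=
  (ireflect p q.1, isub (idot q.2 p.1) q.2 p.2).

(** Negating both root and form gives the same reflection, so the searches try both signs. *)
Definition iopp (q : ireflection) : ireflection := (map Z.opp q.1, map Z.opp q.2).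

(** The nested conditionals let call-by-value evaluation stop at the first difference, where [&&]
    would evaluate both sides. *)
Fixpoint eq_zseq (z r : seq Z) : bool :=
  match z, r with
  | [::], [::] => true
  | a :: z', b :: r' => if Z.eqb a b then eq_zseq z' r' else false
  | _, _ => false
  end.

Definition eq_irefl (p q : ireflection) :=
  if eq_zseq p.1 q.1 then eq_zseq p.2 q.2 else false.

Definition irefl_in (p : ireflection) (s : seq ireflection) :=
  let p' := iopp p in has (fun q => if eq_irefl p q then true else eq_irefl p' q) s.

Fixpoint irefl_remove (p p' : ireflection) (s : seq ireflection) :=
  match s with
  | [::] => None
  | q :: s' => if eq_irefl p q then Some s' else if eq_irefl p' q then Some s'
               else if irefl_remove p p' s' is Some s'' then Some (q :: s'') else None
  end.

Definition iword := seq ireflection.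
Definition imatrix := seq (seq Z).

Definition iapply (w : iword) (M : imatrix) : imatrix :=
  foldr (fun p M => map (ireflect p) M) M w.

Definition iconj_word (w : iword) (q : ireflection) : ireflection := foldr iconj q w.

Fixpoint eq_imatrix (M N : imatrix) : bool :=
  match M, N with
  | [::], [::] => true
  | z :: M', r :: N' => if eq_zseq z r then eq_imatrix M' N' else false
  | _, _ => false
  end.

Definition iunit (m i : nat) : seq Z := ncons i Z0 (Zpos xH :: nseq (m - i.+1) Z0).

Definition iid (m : nat) : imatrix := map (iunit m) (iota 0 m).

(** Comparing the images of the [m] simple roots suffices, as they determine an element of the
    group. *)
Definition eq_iword (m : nat) (w w' : iword) := eq_imatrix (iapply w (iid m)) (iapply w' (iid m)).

(* A class is given by a representative [u = l r] with [l], [r] involutions,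
   generators of its centraliser, and equations [s_a u g = g z^e u_k], each
   encoded as [a :: k :: e :: g], where [a] runs through representatives of
   the orbits of the centraliser on the reflections, [u_k] is the [k]-th
   class representative and [z] is central. *)
Definition iclass := (seq N * seq N * seq (seq N) * seq (seq N))%type.

Definition IClass l r c p : iclass := (l, r, c, p).
Definition icl_left (c : iclass) := c.1.1.1.
Definition icl_right (c : iclass) := c.1.1.2.
Definition icl_centraliser (c : iclass) := c.1.2.
Definition icl_products (c : iclass) := c.2.

Section Check.

Variables (m : nat) (L : seq ireflection) (zword : seq N) (T : seq iclass).

Definition iref (k : N) : ireflection := nth ([::], [::]) L (nat_of_bin k).
Definition irefs (w : seq N) : iword := map iref w.
Definition iclass0 := IClass [::] [::] [::] [::].
Definition irep (c : iclass) : iword := irefs (icl_left c) ++ irefs (icl_right c).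
Definition irep_at (k : N) : iword := irep (nth iclass0 T (nat_of_bin k)).

Fixpoint orbit_cover (fuel : nat) (gens : seq iword)
    (todo rest : seq ireflection) : seq ireflection :=
  if fuel is fuel'.+1 then
    if todo is q :: todo' then
      let: (todo'', rest') := foldr (fun g tr =>
        let: (t, r) := tr in
        let q' := iconj_word g q in
        if irefl_remove q' (iopp q') r is Some r' then (q' :: t, r') else (t, r))
        (todo', rest) gens in
      orbit_cover fuel' gens todo'' rest'
    else rest
  else rest.

Definition product_refl (c : seq N) := iref (nth N0 c 0).
Definition product_class (c : seq N) := nth N0 c 1.
Definition product_sign (c : seq N) := if nth N0 c 2 is N0 then false else true.
Definition product_conj (c : seq N) := irefs (drop 3 c).

Definition check_product (u : iword) (c : seq N) :=
  let g := product_conj c in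
  eq_iword m (product_refl c :: u ++ g)
    (g ++ (if product_sign c then irefs zword else [::]) ++ irep_at (product_class c)).

Definition remove_all (s rest : seq ireflection) :=
  foldr (fun q r => if irefl_remove q (iopp q) r is Some r' then r' else r) rest s.

Definition check_class (c : iclass) :=
  let l := irefs (icl_left c) in
  let r := irefs (icl_right c) in
  let u := l ++ r in
  let gens := map irefs (icl_centraliser c) in
  let starts := map product_refl (icl_products c) in
  [&& eq_iword m (l ++ l) [::], eq_iword m (r ++ r) [::],
      all (fun g => eq_iword m (g ++ u) (u ++ g)) gens,
      all (check_product u) (icl_products c) &
      nilp (orbit_cover (size L).+1 gens starts (remove_all starts L))].

Definition check_closed :=
  all (fun p => all (fun q => irefl_in (iconj p q) L) L) (take m L).

Definition check_central :=
  let z := irefs zword in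
  all (fun p => eq_iword m (p :: z) (z ++ [:: p])) (take m L) && eq_iword m (z ++ z) [::].

(** The first class must be that of the identity, where the induction on word length starts. *)
Definition check_all :=
  [&& (0 < size T)%N, eq_iword m (irep (head iclass0 T)) [::], check_closed, check_central &
      all check_class T].

End Check.

(** Row [i] of the Cartan matrix pairs all simple roots with the coroot of node [i]; in simple-root
    coordinates it is the linear form of the reflection. *)
Definition isimple (cart : seq (seq Z)) : seq ireflection :=
  [seq (iunit (size cart) i, nth [::] cart i) | i <- iota 0 (size cart)].

Definition ireflections (cart : seq (seq Z)) (ptr : seq (N * N)) :=
  foldl (fun L p => rcons L (iconj (nth ([::], [::]) L (nat_of_bin p.2))
                                   (nth ([::], [::]) L (nat_of_bin p.1))))
    (isimple cart) ptr.

Definition check_type cart ptr zword T :=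
  check_all (size cart) (ireflections cart ptr) zword T.

End IntegerReflections.

(* The words below were found by computer search. A root of index at least the
   rank is listed as [(k, i)], the image of root [k] under the simple reflection
   [i]; conjugacy classes are listed up to the central element [-1] (absent in
   type E6). *)
Definition G2_roots : seq (N * N) :=
  [:: (1,0); (2,1); (0,1); (4,0)]%num.
Definition G2_centre : seq N := [:: 0;3]%num.
Definition G2_classes : seq iclass := [::
  IClass [::] [::] [:: [:: 5;4]]
    [:: [:: 0;1;0]; [:: 3;1;1]];
  IClass [::] [:: 0] [:: [:: 3]]
    [:: [:: 0;0;0]; [:: 1;2;0]; [:: 3;0;1;4]; [:: 4;2;1;2]];
  IClass [:: 3] [:: 4] [:: [:: 4;5]]
    [:: [:: 0;1;1;1]; [:: 1;1;0]]]%num.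

Definition F4_roots : seq (N * N) :=
  [:: (1,0); (2,1); (3,2); (5,0); (1,2); (6,1); (8,0); (9,0); (9,2); (10,1); (12,0); (8,3);
    (14,1); (15,0); (16,2); (17,1); (18,3); (19,2); (21,1); (22,0)]%num.
Definition F4_centre : seq N := [:: 0;2;13;20]%num.
Definition F4_classes : seq iclass := [::
  IClass [::] [::] [:: [:: 20;13;10;11]; [:: 15;7]]
    [:: [:: 0;1;0]; [:: 2;2;0]];
  IClass [::] [:: 0] [:: [:: 13;6]; [:: 16;13]]
    [:: [:: 0;0;0;2]; [:: 1;3;0]; [:: 2;4;0]; [:: 5;5;0]; [:: 13;6;0]];
  IClass [::] [:: 2] [:: [:: 2;13;17]; [:: 0;17]]
    [:: [:: 0;4;0]; [:: 1;5;0;1;10]; [:: 2;0;0;22;11]; [:: 3;7;0]; [:: 5;6;0;8;10]];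
  IClass [:: 4] [:: 1] [:: [:: 3]; [:: 0;18;4]]
    [:: [:: 0;1;0;0;18;4]; [:: 2;8;0]; [:: 20;8;1;8;0]; [:: 8;9;0]];
  IClass [::] [:: 0;2] [:: [:: 19;21]; [:: 13;20]]
    [:: [:: 0;2;0]; [:: 1;8;0;2]; [:: 2;1;0;13;19]; [:: 3;10;0]; [:: 5;9;0;13;5]; [::
      11;10;1;5;19]; [:: 13;2;1;1;3;16]; [:: 17;8;1;19;5]; [:: 19;11;0]; [:: 20;1;1;15;16;1]];
  IClass [:: 13] [:: 5] [:: [:: 20;19]; [:: 4;8;10]]
    [:: [:: 0;2;0;7;10]; [:: 4;8;0;1]; [:: 2;9;0;2]; [:: 11;10;1;12]; [:: 7;1;0;5;16]; [::
      19;11;0;18;9]];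
  IClass [::] [:: 0;13] [:: [:: 20;21]; [:: 2;19;5]; [:: 13]]
    [:: [:: 13;1;0;19;6]; [:: 1;9;0;10]; [:: 20;2;1;13]; [:: 3;11;0;6;0]; [:: 7;2;0;1]; [::
      21;1;1;11]];
  IClass [:: 6] [:: 3] [:: [:: 0]; [:: 3;2;22]]
    [:: [:: 22;10;0;23]; [:: 1;10;1;22;13]; [:: 2;2;0;3;15;13]; [:: 12;11;0;2;17]];
  IClass [:: 13] [:: 5;10] [:: [:: 2;1;0]]
    [:: [:: 0;5;0;1]; [:: 2;3;0;20]; [:: 3;12;0]; [:: 8;4;0;13]; [:: 9;13;0]; [:: 15;14;0]; [::
      20;3;1;10;4]];
  IClass [:: 13] [:: 1;8] [:: [:: 15;13;17]; [:: 13;7]]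
    [:: [:: 0;6;0;21;17]; [:: 1;3;0;2]; [:: 2;5;0;2]; [:: 12;14;0;6]; [:: 5;4;0;20]; [::
      22;3;1;22;6]; [:: 19;15;0]; [:: 20;5;1;0;2]];
  IClass [:: 2] [:: 0;6] [:: [:: 2;3;0]]
    [:: [:: 0;7;0]; [:: 10;12;0;15]; [:: 3;4;0;13]; [:: 7;14;0;12]; [:: 13;7;1;19;23]; [::
      18;5;1;11;21]; [:: 22;13;1;2;22]];
  IClass [:: 19] [:: 0;2] [:: [:: 0]; [:: 21;20]]
    [:: [:: 0;5;0;16;21;12]; [:: 1;14;0;2;17]; [:: 2;6;0;6]; [:: 3;7;1;9;11]; [:: 5;15;0;3;8];
      [:: 9;7;0;17;6]; [:: 13;5;1;9;6]; [:: 19;4;0;13]];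
  IClass [:: 22;14] [:: 8;20] [:: [:: 17;6;12;23]]
    [:: [:: 17;10;1;19;8]; [:: 2;8;0;3]; [:: 4;10;0;0;1]; [:: 6;8;1;18;5]];
  IClass [:: 20;13] [:: 3;22] [:: [:: 11;6;20;3]; [:: 1;19]]
    [:: [:: 23;10;1;2]; [:: 20;8;0;9]];
  IClass [:: 10;22] [:: 5;21] [:: [:: 7;13;12;16]]
    [:: [:: 21;11;0;22;7]; [:: 10;8;0;15]; [:: 2;9;0;3]; [:: 14;10;1;13]; [:: 22;8;1;17;7]; [::
      12;10;0;0]];
  IClass [:: 18;11] [:: 4;22] [:: [:: 0;5]; [:: 22;0;16;6]]
    [:: [:: 21;9;0;19]; [:: 2;11;0;16;14]]]%num.

Definition E6_roots : seq (N * N) :=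
  [:: (3,0); (2,1); (3,2); (4,3); (5,4); (8,0); (9,0); (8,1); (9,2); (10,3); (13,0); (14,0);
    (15,0); (14,1); (15,2); (19,0); (17,3); (20,0); (20,1); (22,1); (24,0); (23,3); (25,2);
    (27,1); (27,4); (29,2); (30,1); (32,2); (33,3); (34,0)]%num.
Definition E6_centre : seq N := [::]%num.
Definition E6_classes : seq iclass := [::
  IClass [::] [::] [:: [:: 6;22;35;24;23]; [:: 22;5;26;30]]
    [:: [:: 0;1;0]];
  IClass [::] [:: 0] [:: [:: 28;30;25]; [:: 2;7;5]]
    [:: [:: 0;0;0;8;34;7;3]; [:: 1;2;0]; [:: 3;3;0]];
  IClass [::] [:: 0;1] [:: [:: 28;33;1]; [:: 28;23;24]]
    [:: [:: 1;1;0;5;10]; [:: 2;4;0]; [:: 4;5;0]; [:: 8;6;0]];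
  IClass [:: 0] [:: 6] [:: [:: 0;28;1;31;3]; [:: 3;20;35;19]]
    [:: [:: 0;1;0;31;3]; [:: 1;4;0;8;16]; [:: 13;6;0;2;33]];
  IClass [:: 1] [:: 0;7] [:: [:: 4;0;10;7;1]; [:: 4]]
    [:: [:: 0;3;0;9;4;23;2;24]; [:: 2;2;0;24;23]; [:: 3;7;0]; [:: 4;8;0]; [:: 22;9;0]; [::
      34;10;0]];
  IClass [::] [:: 0;1;4] [:: [:: 20;4;26]; [:: 9;6;4;28]]
    [:: [:: 4;2;0;0;5]; [:: 2;8;0;0]; [:: 32;9;0;25;29;33]; [:: 8;11;0]; [:: 28;12;0]];
  IClass [:: 16] [:: 11;13] [:: [:: 21;13;26;11;14]; [:: 11;13;16]]
    [:: [:: 13;3;0;3;6;8]; [:: 6;7;0;16;8;2]; [:: 21;11;0;16;28]; [:: 5;9;0;4;33;34;2;23]; [::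
      8;2;0;10;0]; [:: 17;13;0]];
  IClass [:: 1;3] [:: 0;7] [:: [:: 8;6;7;5;0]]
    [:: [:: 2;6;0;23;24]; [:: 3;4;0;5;10]; [:: 4;14;0]; [:: 5;15;0]; [:: 12;16;0]; [::
      30;17;0]];
  IClass [:: 7] [:: 0;2;4] [:: [:: 28;12;13;6;3]]
    [:: [:: 4;4;0;5;4]; [:: 1;5;0;2;0]; [:: 16;14;0;16]; [:: 5;18;0]; [:: 26;15;0;16;26]; [::
      22;19;0]];
  IClass [:: 1] [:: 0;7;25] [:: [:: 16;12;3;19;1]; [:: 28;0;1]; [:: 4]]
    [:: [:: 0;6;0;21;15;24;35]; [:: 1;5;0;21;22;14]; [:: 25;4;0;4;25]; [:: 3;16;0;17;19]; [::
      4;19;0;3;6;4]; [:: 33;15;0;23;29;14]; [:: 11;14;0;3]; [:: 18;17;0;10;0]];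
  IClass [:: 2;34] [:: 0;1] [:: [:: 19;29;12]; [:: 5;2;1]]
    [:: [:: 34;4;0;4]; [:: 30;17;0;0;16]; [:: 4;20;0]];
  IClass [:: 28] [:: 11;13;14] [:: [:: 9;20;6;34;11;35]; [:: 23;21;28;24]]
    [:: [:: 13;6;0;30;29]; [:: 3;14;0;2;1;4]; [:: 6;16;0;4;6]; [:: 21;5;0;19;21]];
  IClass [::] [:: 0;1;4;28] [:: [:: 8;4;20;26]; [:: 25;10;27;7]]
    [:: [:: 0;5;0;19;8]; [:: 2;19;0;11;2;16]];
  IClass [:: 19;16] [:: 4;28] [:: [:: 24;19;33]; [:: 0;12;8;2;16]]
    [:: [:: 17;6;0;23;17;24]; [:: 2;16;0]];
  IClass [:: 1;9] [:: 0;4;7] [:: [:: 21;16;0;11;9]]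
    [:: [:: 4;7;0]; [:: 2;11;0;4]; [:: 5;21;0]; [:: 7;22;0]; [:: 22;8;0;9]; [:: 18;23;0]];
  IClass [:: 2;16] [:: 5;11;13] [:: [:: 1;16;3;5;2]]
    [:: [:: 13;9;0;21;24;2;27]; [:: 3;8;0;10]; [:: 9;21;0;10]; [:: 5;7;0]; [:: 23;23;0;2;6;26];
      [:: 30;24;0]];
  IClass [:: 28;0] [:: 11;14;25] [:: [:: 3;7;2;21;0]]
    [:: [:: 4;11;0;8;13;9;14]; [:: 1;13;0;1;25]; [:: 12;7;0]; [:: 10;23;0;5]; [::
      7;9;0;17;19;9]; [:: 20;25;0]];
  IClass [:: 11;34] [:: 6;8;30] [:: [:: 3;2;32;0;30]; [:: 5]]
    [:: [:: 32;7;0;5;32]; [:: 11;9;0;3;10]; [:: 4;23;0;19;32;20]; [:: 5;24;0]; [::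
      7;10;0;11;5;3]; [:: 18;25;0;12]; [:: 27;21;0;5;4;3]];
  IClass [:: 10;1] [:: 0;5;7] [:: [:: 5;10]; [:: 31;30;10;32;7]]
    [:: [:: 0;10;0;20;10;1;22;21]; [:: 1;8;0;27;25;33]; [:: 3;21;0;4;5]; [:: 30;24;0;9;3]; [::
      34;26;0]];
  IClass [:: 1] [:: 0;4;7;25] [:: [:: 16;1;22;14]; [:: 4]]
    [:: [:: 12;9;0;6]; [:: 1;12;0;4;17;3]; [:: 14;8;0;12;6]; [:: 10;24;0;15;3]];
  IClass [:: 35;7] [:: 2;4;34] [:: [:: 26;20;28]; [:: 35;0;4]]
    [:: [:: 0;8;0;1;34;2]; [:: 6;21;0;11;9;28]; [:: 4;10;0;2;1]; [:: 10;26;0;33;10;16]; [::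
      18;24;0;34;16;35;22]];
  IClass [:: 16;2;5] [:: 11;13;21] [:: [:: 23;24;34;33;8;29]]
    [:: [:: 13;17;0;1;18;24]; [:: 4;14;0;5]; [:: 9;15;0;10]; [:: 30;18;0;18;15]];
  IClass [:: 16] [:: 2;13;21] [:: [:: 2;19;16]; [:: 22;2]; [:: 16;4;0]]
    [:: [:: 13;4;0;12;14;7]; [:: 7;14;0]; [:: 2;6;0;27;32]; [:: 3;16;0;4;19]; [::
      5;15;0;0;29;28;30]; [:: 15;17;0;15;27]; [:: 16;5;0;4;3;0;16]; [:: 22;19;0;19;14;3]];
  IClass [:: 34;6;17] [:: 20;22;32] [:: [:: 12;1;10;3;5;7]]
    [:: [:: 24;14;0;24]; [:: 17;16;0;18;15;6]; [:: 28;15;0;27;12;35]; [:: 11;17;0;10;18;15]];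
  IClass [:: 16;33] [:: 2;5;13;35] [:: [:: 9;21;30;32;20;3]; [:: 5;18]]
    [:: [:: 14;15;0;18]; [:: 33;19;0;10;23;15]; [:: 5;17;0]; [:: 28;18;0;15;22;11]];
  IClass [:: 22;23;29] [:: 9;24;27] [:: [:: 22;35;5;8]; [:: 12;32;20;33;19;4]]
    [:: [:: 16;16;0;8;31]; [:: 5;17;0;12]];
  IClass [:: 27;24;14] [:: 3;12;16] [:: [:: 6;9;28;2]; [:: 21;20]]
    [:: [:: 0;18;0;11;12;26]]]%num.

Definition E7_roots : seq (N * N) :=
  [:: (3,0); (2,1); (3,2); (4,3); (5,4); (6,5); (9,0); (10,0); (9,1); (10,2); (11,3); (12,4);
    (15,0); (16,0); (17,0); (16,1); (17,2); (18,3); (22,0); (20,3); (23,0); (24,0); (23,1);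
    (24,2); (26,1); (29,0); (27,3); (30,0); (30,1); (31,2); (33,1); (35,0); (33,4); (34,3);
    (37,2); (39,1); (40,1); (40,4); (42,2); (43,2); (44,1); (44,5); (45,3); (47,2); (48,1);
    (49,0); (50,3); (51,2); (53,0); (54,3); (56,0); (56,4); (58,0); (59,3); (60,2); (61,1)]%num.
Definition E7_centre : seq N := [:: 0;1;4;6;36;54;60]%num.
Definition E7_classes : seq iclass := [::
  IClass [::] [::] [:: [:: 40;42;17;54;4]; [:: 34;49;12;11;10;29]]
    [:: [:: 0;1;0]];
  IClass [::] [:: 0] [:: [:: 26;6;39;60;0]; [:: 40;26;46;51]]
    [:: [:: 0;0;0;33;50;16;46;7;32]; [:: 1;2;0]; [:: 3;3;0]];
  IClass [::] [:: 0;1] [:: [:: 27;35;29;60;5;0]; [:: 5;15;22;13]]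
    [:: [:: 1;1;0;40;0;18;8;62]; [:: 2;4;0]; [:: 4;5;0]; [:: 9;6;0]; [:: 60;7;0]];
  IClass [:: 7] [:: 3] [:: [:: 61;6;3;0;51]; [:: 51;12;46]]
    [:: [:: 0;1;0;20;42;0;11;21]; [:: 62;4;0;13;8;3;58]; [:: 20;6;0;62;41;36;2]];
  IClass [:: 8] [:: 0;2] [:: [:: 6;8;11;1]; [:: 5;0]]
    [:: [:: 0;3;0;9;3;29;12;21]; [:: 1;2;0;2;12;50]; [:: 3;8;0]; [:: 4;9;0]; [:: 26;10;0]; [::
      49;11;0]; [:: 60;12;0]];
  IClass [::] [:: 0;1;4] [:: [:: 2;28;53;12;35;19]; [:: 0;32;14;39;3]]
    [:: [:: 0;2;0;56;18;57;11;52]; [:: 2;9;0;1;6;2]; [:: 3;10;0;7;6;25;16]; [::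
      60;5;1;19;46;9;27;60]; [:: 9;13;0]; [:: 36;7;1;46;45;25;13]];
  IClass [:: 19] [:: 13;15] [:: [:: 19;36;4]; [:: 19;12;5;0;1]]
    [:: [:: 1;3;0;45;48;54;62]; [:: 8;8;0;19;15;13]; [:: 30;13;0;12;60;54]; [::
      5;10;0;3;19;16;27;42]; [:: 19;2;0;9;16;25]; [:: 20;14;0]; [:: 60;12;0;9;41;21;55]];
  IClass [::] [:: 0;1;60] [:: [:: 2;62;4;12;1;36]; [:: 36;7;12;59]]
    [:: [:: 0;2;0;11;17;53;4]; [:: 28;12;0;25;41;16]; [:: 18;5;1;38;29;20;16]];
  IClass [:: 0;8] [:: 2;19] [:: [:: 15;9;13;5;12;8]]
    [:: [:: 1;6;0;60;61;5]; [:: 3;4;0;11;0;6]; [:: 4;15;0]; [:: 5;16;0]; [:: 14;17;0]; [::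
      39;18;0]; [:: 58;19;0]];
  IClass [:: 8] [:: 0;2;4] [:: [:: 8;62;0;48;26]; [:: 58;56;57]]
    [:: [:: 4;4;0;4;12]; [:: 2;5;0;54;1;6]; [:: 3;15;0;4]; [:: 5;20;0]; [::
      6;13;1;10;8;31;4;58;6]; [:: 17;16;0;5;4]; [:: 36;12;1;23;11;34]; [:: 60;10;1;0;28;62;17];
      [:: 56;21;0]];
  IClass [:: 36] [:: 0;2;26] [:: [:: 8;0;1;26]; [:: 26;36;31;6]; [:: 3;16;14;36;6;22]]
    [:: [:: 0;6;0;8;11;52;19;3]; [:: 36;5;0;46;50;31;18]; [:: 26;4;0;18;0]; [::
      3;17;0;9;19;60;54]; [:: 4;12;1;60;15;56;35;32]; [:: 39;16;0;13;17;36;32]; [::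
      6;10;1;54;19;22]; [:: 22;15;0;31;22;0]; [:: 17;18;0;11]; [:: 62;9;1;28;17]; [:: 54;22;0];
      [:: 57;21;0;14;25;61;22]];
  IClass [:: 2;49] [:: 0;1] [:: [:: 57;58;27;10;9;44;25]; [:: 5;11;2;1]]
    [:: [:: 49;4;0;4]; [:: 3;18;0;24;59;46;8]; [:: 4;20;0;10;8;19;26]; [:: 55;21;0;18;0;5;58];
      [:: 30;19;0;8;2;18;5]];
  IClass [:: 61] [:: 0;1;60] [:: [:: 11;12;0;4]; [:: 8;48;5;33;11;0]]
    [:: [:: 0;6;0;57;4;7;45;50]; [:: 62;4;0;62;11]; [:: 58;19;0;2;19;13]; [::
      4;10;1;51;55;2;49]; [:: 8;7;0;1;3;19;12;2;36]; [:: 39;9;1;36;19;46;27]; [::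
      43;22;0;36;46;26]];
  IClass [:: 25] [:: 19;20;22] [:: [:: 62;15;37;52;46;61]; [:: 54;25;36]]
    [:: [:: 16;6;0;45;54;6]; [:: 2;15;0;3;0;16;19]; [:: 6;9;1;22;57;48;3]; [:: 10;17;0;14]; [::
      9;5;0;0;54;1]];
  IClass [:: 0;36] [:: 13;16] [:: [:: 41;25;49;18;57;20;53]; [:: 30;19;18]]
    [:: [:: 20;6;0;5;54]; [:: 51;17;0;54]; [:: 6;22;0;36;34;23;8;37;46]];
  IClass [:: 2;19] [:: 13;15;25] [:: [:: 26;15;19;20;4]; [:: 19;60;54;26;16]]
    [:: [:: 25;8;0;12;38;5]; [:: 2;13;0;58;57;0]; [:: 5;23;0]; [:: 6;15;1;8;59;31]; [::
      13;10;0;3;6]; [:: 10;9;0;4;6]; [:: 21;24;0]; [:: 48;16;1;3;45;15;54;43]; [:: 56;25;0]];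
  IClass [:: 19;2] [:: 5;13;15] [:: [:: 7;9;2;19;5]]
    [:: [:: 0;10;0;41;13;25;5;39]; [:: 3;9;0;57;53;11]; [:: 11;23;0]; [:: 5;8;0;6]; [:: 6;26;0];
      [:: 23;24;0;11;0;10]; [:: 18;15;1;12;16;13;59]; [:: 28;21;1;27;1;40;52]; [::
      49;19;1;8;12;31;56]; [:: 44;27;0]; [:: 62;18;1;28;3]];
  IClass [:: 0;36] [:: 13;16;31] [:: [:: 36;56;8;59;0]; [:: 36;8;6]]
    [:: [:: 4;13;0;7;1;33;42]; [:: 1;14;0;14;45;10;26;5]; [:: 13;8;0;15;10;1]; [::
      5;24;0;4;0;5]; [:: 6;21;1;8;31;57]; [:: 26;10;0;13;15;36]; [:: 23;28;0]; [::
      48;25;0;22;48]; [:: 56;20;1;32;35;31;48]];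
  IClass [:: 1;3] [:: 0;8;42] [:: [:: 5]; [:: 1;62;13;40;5;18]]
    [:: [:: 15;8;0;48;5;39]; [:: 3;10;0;11;4;0]; [:: 16;24;0;41;33]; [:: 5;19;1;1;43;28;13]; [::
      50;27;0;12;47;2]; [:: 8;11;0;3;13]; [:: 14;28;0]; [:: 38;16;1;62;3;28;5]; [::
      26;23;0;4;3]; [:: 46;25;0;31;43;20;22]; [:: 43;20;1;48;41;52;34]];
  IClass [:: 60;9] [:: 1;3;58] [:: [:: 12]; [:: 2;0;8;3;58;5]]
    [:: [:: 0;12;0;11;53;61;8]; [:: 58;8;0;12]; [:: 19;11;0;35;46;40;58]; [:: 4;25;0;6]; [::
      5;18;1;45;9;52;2;35]; [:: 10;16;1;9;34;58;20]; [:: 14;20;1;9;19;24;21]];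
  IClass [:: 4;8] [:: 0;2;11] [:: [:: 2;4;33;42;36]; [:: 4;12;2;33;62;44]]
    [:: [:: 0;11;0;49;27;14;33;29]; [:: 8;9;0;26;42;41]; [:: 3;23;0;11;4]; [::
      18;17;1;61;24;53;21]; [:: 58;26;0;47;31;48;45]; [:: 26;19;1;47;60;25;29;19]; [::
      40;18;1;41;19;53;3;48]; [:: 49;29;0]];
  IClass [:: 56;8] [:: 0;2;4] [:: [:: 2;6;8]; [:: 57;59;6;0]]
    [:: [:: 0;11;0;58;6;12;0;52]; [:: 1;10;0;27;17;44;12;59]; [:: 15;16;1;43;46;31;52]; [::
      52;26;0;24;55;22;23]; [:: 6;17;1;31;57;6;36]; [:: 22;25;0;26;13]; [::
      17;27;0;32;56;59;11]; [:: 31;22;1;22;32;4;11;35]; [:: 56;9;0]];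
  IClass [:: 62;26] [:: 0;8;61] [:: [:: 12;60;43;54;46;0]; [:: 45;46;4;2]]
    [:: [:: 0;14;0;18;15;48;44;7]; [:: 54;10;0;6;0]; [:: 26;12;0;1;11;4;8]; [:: 9;25;0;3;7]; [::
      4;22;1;23;8;34]; [:: 37;21;1;15;44;1;52]];
  IClass [:: 2;5;19] [:: 13;15;25] [:: [:: 42;26;33;2;37;17]]
    [:: [:: 0;18;0;39;56;44;38]; [:: 5;15;0;56;59]; [:: 12;24;1;50;13;59;39]; [::
      8;16;0;54;40;47]; [:: 17;20;0]; [:: 34;27;1;30;33;59;55]; [:: 40;23;1;15;54;20;49;52]];
  IClass [:: 7;49;20] [:: 23;26;42] [:: [:: 27;32;31;39;2;37]]
    [:: [:: 0;15;0;17;39;49]; [:: 42;17;0;22;37;27]; [:: 57;23;1;38;60;22;39;36]; [::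
      19;16;0;19;0;11]; [:: 62;27;1;5;7;28;10]; [:: 31;18;0;16;41;8]; [:: 30;26;1;25;16;48;13]];
  IClass [:: 22;26;59] [:: 16;54;60] [:: [:: 4;20;22;25;59;2]; [:: 26;22;1;10]]
    [:: [:: 4;19;0;6;12]; [:: 7;17;0;4;56;0]; [:: 51;18;0;42;38;62;17]; [::
      5;27;1;49;30;21;41;17]; [:: 6;25;1;13;16;56]; [:: 13;22;0;38;45;9;49]; [:: 10;21;0]; [::
      50;26;1;30;19;62;40;35]; [:: 59;15;0;59]];
  IClass [:: 9;7;5] [:: 1;3;12] [:: [:: 0;2;1;6;19;5]]
    [:: [:: 0;21;0;14;24;29;27]; [:: 8;20;0;7;30;8;9]; [:: 10;24;1;28;46;42;3]; [:: 6;16;0]; [::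
      29;27;1;17;25;45;53]; [:: 45;25;1;6;9;27;22;58]; [:: 58;28;1;17;45;1;61;22]];
  IClass [:: 9;7;44] [:: 1;3;5] [:: [:: 53;55;48;2;56;50]]
    [:: [:: 15;18;0;12;6;44]; [:: 1;21;0;11;6;39;41]; [:: 19;16;0;56;44]; [:: 37;23;1;41;34;16];
      [:: 12;25;1;27;61;21;57]; [:: 30;27;1;43;33;59]; [:: 16;27;1;35;41;11;16]; [::
      23;26;1;39;1;18;57]; [:: 26;24;1;11;52;58;33;16]];
  IClass [:: 15;2;33] [:: 9;17;22] [:: [:: 33;25]; [:: 47;42;4;59;56]]
    [:: [:: 0;17;0;0;42;27;37]; [:: 14;18;0]; [:: 6;26;1;61;3;23;31;21]; [::
      58;29;1;57;28;5;43;33]];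
  IClass [:: 4;52;8] [:: 2;11;49] [:: [:: 3;7;25;49;39;20]; [:: 38;11;24;4;61]]
    [:: [:: 0;20;0;49]; [:: 34;28;1;7;26;59;30]]]%num.

Definition E8_roots : seq (N * N) :=
  [:: (3,0); (2,1); (3,2); (4,3); (5,4); (6,5); (7,6); (10,0); (11,0); (10,1); (11,2); (12,3);
    (13,4); (14,5); (17,0); (18,0); (19,0); (18,1); (19,2); (20,3); (21,4); (25,0); (23,3);
    (26,0); (27,0); (26,1); (27,2); (28,3); (30,1); (33,0); (31,3); (34,0); (35,0); (34,1);
    (35,2); (36,2); (38,1); (41,0); (38,4); (39,3); (42,0); (42,1); (44,2); (46,1); (47,1);
    (49,0); (47,4); (48,3); (51,2); (52,2); (54,1); (55,1); (54,5); (55,4); (56,3); (58,2);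
    (59,2); (60,1); (61,1); (61,5); (62,0); (63,3); (65,2); (66,2); (67,1); (67,6); (69,0);
    (70,3); (71,3); (72,2); (73,1); (75,0); (76,0); (75,4); (77,3); (78,2); (81,0); (82,0);
    (82,4); (83,3); (84,3); (86,0); (87,0); (87,4); (88,2); (89,3); (91,0); (91,5); (92,1);
    (93,2); (94,3); (95,0); (97,1); (98,2); (99,3); (101,1); (102,2); (102,4); (104,1); (105,2);
    (107,1); (107,3); (109,0); (109,1); (111,0); (111,2); (113,0); (114,3); (115,4); (116,5);
    (117,6); (118,7)]%num.
Definition E8_centre : seq N := [:: 0;1;4;6;43;70;88;119]%num.
Definition E8_classes : seq iclass := [::
  IClass [::] [::] [:: [:: 92;51;59;54;11;9;65]; [:: 45;101;35;6;116]]
    [:: [:: 0;1;0]];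
  IClass [::] [:: 0] [:: [:: 107;30;104]; [:: 44;50;105;63;28]]
    [:: [:: 0;0;0;92;105;17;57;9;116]; [:: 1;2;0]; [:: 3;3;0]];
  IClass [::] [:: 0;1] [:: [:: 18;115;14;29]; [:: 21;98;5;117;7;1]]
    [:: [:: 0;1;0;66;69;17;80]; [:: 2;4;0]; [:: 4;5;0]; [:: 10;6;0]];
  IClass [:: 8] [:: 3] [:: [:: 58;97;92;57]; [:: 86;47;36;69;106;107]]
    [:: [:: 3;1;0;100;65;21;56;119]; [:: 1;4;0;9;112;46;73;113]; [:: 108;6;0;66;117;97;9]];
  IClass [:: 2] [:: 0;1] [:: [:: 20;7;119;12;0]; [:: 1;13;119;9;0]]
    [:: [:: 0;3;0;50;48;60;62;77;84]; [:: 9;2;0;43;20;115;54]; [:: 3;7;0]; [:: 4;8;0]; [::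
      30;9;0]; [:: 62;10;0]];
  IClass [::] [:: 0;1;4] [:: [:: 93;4;107;106]; [:: 43;86;45;98;104;85]]
    [:: [:: 0;2;0;1;62;3;16;5;12]; [:: 2;8;0;14;2;9;0;119]; [:: 66;9;0;21;71;36]; [:: 6;11;0];
      [:: 10;12;0]; [:: 43;13;0]];
  IClass [:: 22] [:: 15;17] [:: [:: 14;93;70]; [:: 43;26;77;116;109;28]]
    [:: [:: 0;3;0;53;81;15;55;110]; [:: 89;7;0;34;45;105;115]; [:: 4;12;0;45;115;112;20;117];
      [:: 5;9;0;24;18;118;11;44]; [:: 10;2;0;12;118;77;13;4;0]; [:: 23;14;0]];
  IClass [:: 22;2] [:: 15;17] [:: [:: 2;73;95;78;106;24]; [:: 6;119;5]]
    [:: [:: 0;6;0;3;15;13;1;63]; [:: 3;4;0;0;28;2;1]; [:: 4;15;0]; [:: 5;16;0]; [:: 16;17;0];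
      [:: 46;18;0]];
  IClass [:: 1] [:: 0;4;9] [:: [:: 118;119;9;0;2;117]; [:: 86;84;90;89;79]]
    [:: [:: 4;4;0;20;13;0]; [:: 1;5;0;93;92;97]; [:: 18;15;0;22;43;119]; [:: 5;19;0]; [::
      6;20;0]; [:: 109;16;0;12;7;115;22]; [:: 30;21;0]; [:: 60;22;0]; [:: 75;23;0]];
  IClass [:: 43] [:: 0;2;30] [:: [:: 1;0;119;43]; [:: 67;0;43;72]; [:: 119;4;14;0]]
    [:: [:: 0;6;0;93;18;49;51;98;82;22]; [:: 1;5;0;36;15;8;70;17]; [:: 2;4;0;77;20;105]; [::
      16;17;0;10;18;22;30]; [:: 4;21;0;4;84;6;11;75]; [:: 5;16;0;60;38;79;69;5]; [::
      119;22;0;71;105;16;3]; [:: 23;15;0;3;117;14;11]; [:: 45;18;0;16;19;63;79]; [::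
      97;20;1;48;39;30;112]; [:: 70;24;0]; [:: 75;23;0;119;92;29;11]];
  IClass [:: 9;68] [:: 2;62] [:: [:: 48;42;49;9;100]; [:: 68;119;116;28;5;13]]
    [:: [:: 9;4;0;111;31;27;114;30]; [:: 3;18;0;9;8;2;3]; [:: 4;19;0;26;17;44;29]; [::
      6;23;0;80;94;86;5;6]];
  IClass [::] [:: 0;1;4;6] [:: [:: 108;43;81;42;6;104;4]; [:: 11;78;16;68;8;67;57]; [::
    88;6;70;0]]
    [:: [:: 0;5;0;1;70;74;62;119]; [:: 9;20;0;0;9]; [:: 20;22;0;44;18;96;15;24]; [::
      10;20;1;16;78;81;4;101]; [:: 43;5;1;42;57;88;5;6;49]];
  IClass [:: 29] [:: 22;23;25] [:: [:: 66;58;72;40;67;50;35]; [:: 10;117;94;1;87;93]]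
    [:: [:: 22;6;0;117;26;18;119]; [:: 53;15;0;9;66;64;14]; [:: 6;20;1;101;16;79;0;78]; [::
      81;17;0;89;77;84]; [:: 10;5;0;7;4;117;70;1]];
  IClass [::] [:: 0;1;4;43] [:: [:: 0;56;93;5]; [:: 86;116;77;95;17;81;8]]
    [:: [:: 18;5;0;20;57;98;22]; [:: 2;21;0;117;14;8;25]; [:: 6;5;1;38;52;53;99;110;96]];
  IClass [:: 22;23] [:: 15;17] [:: [:: 57;6;112;37;105]; [:: 77;7;36;2;9]]
    [:: [:: 25;6;0;93;14;117;23]; [:: 2;17;0;0;9;85;30;86]; [:: 14;24;0;83;8;75]];
  IClass [:: 8;43] [:: 10;23;36] [:: [:: 7]; [:: 67;11;97;118;77;117;60]]
    [:: [:: 29;7;0;53;29;119;13]; [:: 8;12;0;77;29;85;102;116]; [:: 5;25;0]; [:: 6;26;0]; [::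
      15;9;0;72;1;100;3]; [:: 11;8;0;118;7;117]; [:: 24;27;0]; [:: 60;28;0]; [:: 75;29;0]];
  IClass [:: 2;22] [:: 5;15;17] [:: [:: 15;8;7;3;22]; [:: 2;10;5;119;22;7;8]]
    [:: [:: 1;9;0;46;25;10;37;36]; [:: 3;8;0;4;5;119]; [:: 4;25;0;68;43;22;31;26]; [::
      5;7;0;21;6]; [:: 6;30;0]; [:: 119;28;1;62;13;36;60;70]; [:: 16;27;0;16;50;24;38;119]; [::
      109;26;0;13;116;29]; [:: 32;31;0]; [:: 46;32;0]; [:: 54;33;0]; [:: 73;34;0]];
  IClass [:: 9;4] [:: 2;17;29] [:: [:: 7]; [:: 56;64;39;44;77;81;112;67]]
    [:: [:: 4;12;0;94;87;16;7;8]; [:: 2;14;0;13;63;15;18;23;93]; [:: 25;7;0;25;117]; [::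
      5;27;0;0;4;5]; [:: 6;31;0;4;119;0;13]; [:: 9;9;0;14;23;11;119;9]; [:: 26;35;0]; [::
      103;29;0;103;90;6;117]; [:: 75;36;0]];
  IClass [:: 15;62] [:: 8;10;46] [:: [:: 56;0;68;46;7;2]; [:: 15;53;86;22;55]]
    [:: [:: 17;7;0;21;67;7]; [:: 15;9;0;98;105;19;83]; [:: 25;27;0;3;25;7;8;19]; [::
      5;32;0;118;119]; [:: 94;33;0;96;117;103;7]; [:: 118;34;0;6;21;116]; [::
      9;10;0;28;54;1;101;22;3]; [:: 16;35;0;50;68;9;7;5]; [:: 115;28;0;99;69;82;13]; [::
      30;25;0;37;45;62;54;13]; [:: 32;29;0;102;81;100;104;77;52]; [:: 59;36;0;18;14;16;46;7]];
  IClass [:: 12;9] [:: 0;2;5] [:: [:: 102;107;103;119]; [:: 9;1;0]]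
    [:: [:: 0;10;0;28;76;89;85]; [:: 5;8;0;119;1;2;4]; [:: 24;25;0;0;118]; [::
      6;31;1;59;5;12;111;42;79]; [:: 7;36;1;74;4;109;33;83;103]; [:: 27;30;0;20]; [::
      51;32;0;50;30;19;24]; [:: 101;34;0;29;10;106;33;113]; [:: 62;37;0]];
  IClass [:: 2] [:: 0;1;4;6] [:: [:: 1;2;0;119]; [:: 8;65;119;31;11;47;43]]
    [:: [:: 0;8;0;83;72;40;19;41;99]; [:: 2;11;0;48;103;4;49;62]; [:: 25;26;0;6;11;30]; [::
      84;31;1;13;81;104;72]; [:: 7;36;1;15;7;97;94;18]; [:: 36;9;1;93;79;8;100;87]; [::
      66;28;1;113;6;28;35;36]; [:: 82;38;0]; [:: 119;12;1;30;99;80;11;4;25;96]];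
  IClass [:: 1] [:: 0;4;9;36] [:: [:: 67;7;16;96;14;43;0]; [:: 77;93;117]]
    [:: [:: 0;9;0;11;7;14;8]; [:: 43;13;0;18;36;10;14]; [:: 2;8;0;43;117;2]; [::
      5;32;0;88;38;19;70;47]; [:: 6;9;1;89;90;43;88]; [:: 60;8;1;119;9;89;91;96]; [:: 70;39;0]];
  IClass [:: 70] [:: 0;2;4;60] [:: [:: 1;4;92;36]; [:: 87;92;1;94;119;30]; [:: 91;87;90]]
    [:: [:: 4;9;0;6;115;12;13]; [:: 1;11;0;65;117;100;98]; [:: 60;8;0;14]; [:: 22;28;0;6;22];
      [:: 95;34;0;28;14;83;5;1]; [:: 6;9;1;113;35;6]; [:: 7;28;1;85;87;88;6;1]; [::
      19;31;0;41;47;33;68;18;58]; [:: 28;31;1;82;91;88;45;34;12]; [:: 31;26;0;3;19;13]; [::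
      30;8;1;70;118;82;43;81]; [:: 88;39;0;92;6;1]; [:: 82;40;0]];
  IClass [:: 84;1] [:: 9;79;81] [:: [:: 67;101;36;83;97]; [:: 6;3;17;43;84;119;70]]
    [:: [:: 81;10;0;101;35;6;104;12;53]; [:: 1;9;0;0;65;22;117;14;3]; [:: 3;28;0;60;0;22]; [::
      5;30;0;88;119;68;25;26]; [:: 6;31;1;13;81;101;66;20]; [:: 7;38;0;117;82;14]; [::
      8;29;0;9;22;2]; [:: 58;33;0;70;54;57]; [:: 43;39;0;7;16;10;117]; [::
      78;40;0;36;14;92;9;6]; [:: 75;8;0;119;4;118]; [:: 85;41;0]];
  IClass [:: 2;30] [:: 0;1;88] [:: [:: 50;1;55;77;101;51;106]; [:: 47;30;20;12]]
    [:: [:: 0;14;0;84;11;117;98]; [:: 92;9;0;96;43;47;46]; [:: 3;29;0;2;0;96;3]; [::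
      4;39;0;100;72;67]; [:: 5;31;0;58;27;119;1;79;43]; [:: 82;41;0;60;81;29;97;70]];
  IClass [:: 24;26;11] [:: 1;4;19] [:: [:: 98;104;108]; [:: 24;43;8;93;53;42;37]]
    [:: [:: 44;18;0;3;37;4]; [:: 2;15;0;104;98;108]; [:: 6;42;0]; [:: 7;43;0]; [::
      9;16;0;5;108;101;102]; [:: 19;19;0;12;5;0;7]; [:: 32;44;0]; [::
      104;43;1;18;73;44;15;91;29]];
  IClass [:: 30;25] [:: 3;6;16;18] [:: [:: 81;1;119;79;22;8]; [:: 9;1;43;119;18]; [::
    93;101;25;22;78;77]]
    [:: [:: 16;16;0;6;63;25;74;23]; [:: 1;20;1;98;114;26;83;23;81]; [:: 13;42;0;119]; [::
      6;15;0;9;30;15;117;8]; [:: 7;45;0]; [:: 15;22;0;13;1;3;57;12]; [:: 22;20;0;29;22]; [::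
      99;43;0;87;118;75]; [:: 32;43;1;87;18;15;54;84]; [:: 107;42;1;84;92;85;86;65]; [::
      60;16;1;71;96;98;84;83]; [:: 67;46;0]; [:: 75;47;0]; [:: 82;45;1;117;7;15;84;18]; [::
      119;15;1;36;87;75;9]];
  IClass [:: 29;50;12] [:: 31;43;44] [:: [:: 24;23;3;51;7;38;36]; [:: 118;7]]
    [:: [:: 24;15;0;7;75;84;119]; [:: 4;17;0;80;99;5;86;87]; [:: 60;43;1;15;118;102;62;68]; [::
      7;42;1;36;9;118;37;75]; [:: 9;16;0;62;38;16;31]; [:: 57;44;0;45;10;119;6]; [::
      18;18;0;50;119;9]; [:: 34;48;0]];
  IClass [:: 70;22] [:: 2;17;29;79] [:: [:: 65;72;97;6;88;18;9]]
    [:: [:: 3;18;0;21;28;13]; [:: 1;20;1;60;21;110;42;29]; [:: 2;15;0;14;83;2;119]; [::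
      5;44;0;19;33;4;31;62;74]; [:: 6;16;1;16;67;51;20;88;106]; [:: 7;46;0;14]; [::
      9;23;0;119;60;0;84]; [:: 11;22;0;85;86]; [:: 48;43;1;61;87;76;44;77;96]; [::
      68;42;0;32;43;46;69]; [:: 24;48;0;24;6]; [:: 82;49;0]];
  IClass [:: 16;3;18] [:: 1;11;84] [:: [:: 22;9;93;43;77]; [:: 75;87;94]; [::
    114;55;49;89;27;36;82;18]]
    [:: [:: 79;18;0;17;119;62;75;45]; [:: 8;17;0;75;117;82;85;119]; [:: 69;44;0;6;33;31;3;16];
      [:: 6;47;0;79;96;92;8;88;75]; [:: 117;45;1;89;94;18;15]; [:: 9;24;0;43;18;3;25]; [::
      11;23;0;84;117;7]; [:: 24;48;0;44;27;68]; [:: 98;49;0;81;6;86;60]; [::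
      75;15;0;7;89;87;82]];
  IClass [:: 6;15;17] [:: 5;8;10] [:: [:: 5;15;1;8;13;17;119]]
    [:: [:: 0;23;0;74;20;18;17;88]; [:: 3;19;0;20;0;118]; [:: 45;42;0;45;6;119;5]; [::
      13;16;0;13;118;7;5]; [:: 21;49;1;49;66;113;23;11]; [:: 26;44;0;2;17;10;20]; [::
      105;45;0;119;53;21;10]; [:: 40;50;0]; [:: 46;47;0;70;32;81;22;15]; [:: 61;51;0]; [::
      81;52;0]; [:: 119;48;1;70;3;9;6;88]];
  IClass [:: 9;0] [:: 2;5;22;41] [:: [:: 119;5]; [:: 0;62;84]; [:: 57;52;51;119;92]]
    [:: [:: 0;20;1;75;72;62;81;97]; [:: 1;24;0;47;63;92;16;15]; [:: 32;16;0;5]; [::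
      24;44;0;20;0;5;12]; [:: 5;17;0;9;43;119;57]; [:: 49;42;1;87;50;59;100;101;19]; [::
      47;22;0;119;34;26;10;45]; [:: 14;50;0;7]; [:: 18;48;0;29;13;5;57]; [::
      112;52;1;106;47;30;67;44]; [:: 96;47;0;44;46;12;58;79]; [:: 98;49;0;73;49;46;33]; [::
      68;19;1;42;104;69;111]; [:: 76;45;1;5;77;60;46;101;17]; [:: 119;23;1;4;81;111;62;101]];
  IClass [:: 22;56] [:: 2;5;17;68] [:: [:: 15;16;1;78;114;109]; [:: 7;118;30;50;29]]
    [:: [:: 17;16;0;119;46]; [:: 1;21;0;44;62;16;31]; [:: 5;18;0;118]; [:: 65;47;0;13;24;60];
      [:: 7;18;1;117;16;40;3;24;13]; [:: 38;19;0;19;11]; [:: 20;16;1;87;96;77;24;84]; [::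
      39;19;1;91;2;92;115;74]];
  IClass [:: 10;54;8] [:: 1;3;5] [:: [:: 92;30;37;20;51;45;4]]
    [:: [:: 5;18;0;48;13;86;59]; [:: 10;23;0;19;44;46;26;43]; [:: 75;16;0;119;54;118;5]; [::
      23;43;1;11;96;118;43;113]; [:: 51;47;0;25;60;34;58]; [:: 115;46;0;116;14;82;89]; [::
      11;44;0;50;29;88;18]; [:: 12;44;0;33;65;34]; [:: 14;51;0;7]; [:: 16;48;0;10;79;6;38;29];
      [:: 57;42;0;63;69;19;58;75]; [:: 40;49;0;116;2;21;15;97]; [:: 80;45;1;54;15;87;18;112];
      [:: 119;44;1;25;88;62;60;37;63]];
  IClass [:: 15;87] [:: 5;8;10;73] [:: [:: 116;95;31;44]; [:: 106;31;38;7;116;87;19]; [::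
    109;114;87;111;3;7]]
    [:: [:: 78;16;0;78;5]; [:: 15;22;0;32;8;7;12;35]; [:: 104;42;0;95;16;98;118;62]; [::
      5;18;0;118;5;116;14]; [:: 66;51;0;72;6;66]; [:: 7;18;1;3;113]; [::
      10;19;0;29;105;37;33;51]; [:: 18;44;0;82;89;27;44;59]; [:: 20;42;1;27;47;80;84;1;91]; [::
      23;43;1;91;26;104;116;105]; [:: 32;52;1;110;70;113;4;88;90]; [:: 45;43;0;60;117;29;87;61];
      [:: 46;16;1;118;15;34;106;67]; [:: 110;47;0;13;106;99;61;21]; [::
      68;19;1;77;51;80;21;113;20]; [:: 81;44;1;114;103;43;61;32;81]; [::
      116;52;0;31;24;102;44;16;118]];
  IClass [:: 15;5;62] [:: 4;26;30] [:: [:: 52;29;68;81;39]; [:: 45;100;55;115;24;86;56;16]]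
    [:: [:: 12;17;0;119;50;7;10;117]; [:: 37;18;0;24;37;30;5]; [:: 6;48;0;74;57;38;30;32]; [::
      118;52;1;49;104;0;105;18;103]; [:: 39;53;0]];
  IClass [:: 9;4] [:: 2;17;29;81] [:: [:: 3;11;65;25;119;79]; [:: 83;4;98;1;84;6;43]]
    [:: [:: 75;17;0;0;7;4]; [:: 88;18;0;13;119;46]; [:: 4;20;1;2;14;84;43;85]; [::
      5;43;1;83;39;36;89;55;22]; [:: 6;19;1;19;78;93;70;45;24]; [:: 97;45;1;7;79;2;94;43]; [::
      19;48;0;0;96;68;3;54;2]; [:: 26;53;0;50;34;22;10;52]];
  IClass [:: 26;24;30] [:: 11;29;44] [:: [:: 86;32;15;79;77;38;76;107]; [:: 24;44;7;38;31]]
    [:: [:: 11;19;0;10;0;50]; [:: 57;52;0;4;12;27;38]; [:: 119;53;1;47;74;54;57;52;45]];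
  IClass [:: 119;1] [:: 9;85;86;87] [:: [:: 94;1;34;82;65;31]; [:: 63;96;0;58;82;88]]
    [:: [:: 6;23;0;84;87]; [:: 1;20;1;68;55;105;26]; [:: 3;46;0;78;4;77]; [::
      74;45;0;103;51;118;21;50;12]; [:: 8;45;1;93;84;36;15;100]; [::
      68;50;0;19;108;83;60;74;50]; [:: 30;23;1;42;25;50;110;82;13]; [:: 82;20;0;2;9;119;6;0]];
  IClass [:: 9;92] [:: 0;2;4;60] [:: [:: 23;75;36;29;10]; [:: 91;90;92;36;119]; [::
    83;79;98;0;84]]
    [:: [:: 0;24;0;0;1;6;22;25]; [:: 70;21;0;88;6;4;70]; [:: 2;22;0;79;81;36;43]; [::
      3;23;0;17;65;77;93]; [:: 69;47;0;58;63;44;3;8]; [:: 6;24;1;48;46;47;112]; [::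
      7;23;1;72;119;94;17;85;96]; [:: 82;54;0]];
  IClass [:: 82;70] [:: 0;2;4;60] [:: [:: 39;37;119;41;4;26]; [:: 94;79;51;59;108;7;102;62]; [::
    30;96;1]]
    [:: [:: 65;23;0;77;97;96;70]; [:: 82;22;0;4;6]; [:: 23;46;0;4;22;1;14;103]; [::
      5;51;0;85;91;28;60;17;79]; [:: 96;23;1;78;101;60;67;91;96]; [:: 15;49;0;22;70;15]; [::
      118;49;1;82;90;70;43]; [:: 88;54;0;65;88]];
  IClass [:: 86;75;2] [:: 1;82;89] [:: [:: 9;6;119;85;1]; [:: 1;40;83;27;7]]
    [:: [:: 85;23;0;18;9;15;36]; [:: 1;24;0;72;57;96;45;34;3]; [:: 3;49;0;70;86;4;65]; [::
      5;50;0;36;83;56;1;20;106]; [:: 30;54;0;17;9;89;25;10]];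
  IClass [:: 88;70;18] [:: 39;46;58;75] [:: [:: 44;18;16;63;56;25;30]]
    [:: [:: 0;33;0;62;37;84;75]; [:: 18;28;0;5;10;2;45;70]; [:: 3;25;0;115;13;5;20]; [::
      7;55;0]; [:: 65;34;0;117;68;63;39;74]; [:: 37;26;0;37]; [:: 62;30;0;58;81;60]; [::
      96;31;1;92;50;19;90;25;61]; [:: 40;56;0]; [:: 55;57;0]; [:: 82;58;0]; [::
      119;27;1;19;15;119;41;8;51;9]];
  IClass [:: 10;25;68] [:: 7;30;44;56] [:: [:: 17;0;68;24]; [:: 51;62;25;26;43;7;11]]
    [:: [:: 23;34;0;28;6;4;35]; [:: 37;26;0;89;61;82;118]; [:: 57;55;0;10;53;57]; [::
      7;25;0;108;104;98]; [:: 9;28;1;13;112;67;35;54]; [:: 68;36;1;48;29;30;107;90]; [::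
      65;57;0;53;12;66;78;22]; [:: 47;59;0]; [:: 105;27;1;0;118;65;56;16]; [::
      106;33;1;41;29;88;12;48]; [:: 98;25;1;94;103;111;44;47;84;41]; [:: 118;60;0]];
  IClass [:: 68;70;69] [:: 13;44;58;92] [:: [:: 27;36;96;18;68;33;11]]
    [:: [:: 70;28;0;22;96;119;24;2;20]; [:: 65;29;0;84;58;32;44]; [:: 58;27;0;60;1;24]; [::
      49;57;0;45;40;8;22;42]; [:: 8;25;0;119;52;8;39]; [:: 68;34;0;18;82;27;89;14]; [::
      12;31;0]; [:: 109;56;0;73;78;86;21;51]; [:: 15;33;0;54;23;119;69;58]; [:: 26;33;0;57;5;9];
      [:: 19;30;0;34;41;2;20;119]; [:: 112;58;0;50;85;63;32;52]; [:: 55;55;1;73;96;58;87;43;93];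
      [:: 119;33;1;58;33;11;10;56]];
  IClass [:: 11;7;1] [:: 0;4;6;9] [:: [:: 65;14;98;25;101;36;117]]
    [:: [:: 4;30;0;118;14;116;7]; [:: 1;38;0;11;39;35;53;77]; [:: 80;55;0;117;21;75;69;99]; [::
      7;26;0]; [:: 9;31;1;46;60;62;101;77]; [:: 11;36;1;89;90;30;1]; [:: 47;57;0;67;51;91;13];
      [:: 90;33;1;68;75;107;96;19;54]; [:: 75;61;0]; [:: 116;60;0;1;83;19;52;25;4]; [::
      107;58;1;118;6;15;18;75]; [:: 119;29;1;97;2;1;87;22;77]];
  IClass [:: 25;98;97] [:: 10;23;91;93] [:: [:: 118;11;36;7;70;14;30]]
    [:: [:: 3;33;0;28;60;51;25;27]; [:: 1;38;0;36;43;101;4;93;87]; [:: 25;28;0;89;82;73;117];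
      [:: 5;57;0;78;83;77;55]; [:: 70;33;1;40;68;90;107;29]; [:: 18;40;0;15;12;9;13;19]; [::
      30;28;1;86;77;8;87;84;30]; [:: 74;57;0;13;62;84]; [:: 19;56;0;33;34;60;70;32]; [::
      67;26;0;84;75]; [:: 40;55;1;42;41;81;84;101;28]; [:: 31;59;0;38;22;97;118;77;86]; [::
      45;55;0;78;4;12;28;45]; [:: 75;62;0]];
  IClass [:: 25;84;30] [:: 6;18;70;88] [:: [:: 75;119;84]; [:: 30;32;4;19;34;96;31]; [::
    30;1;84;3;16;25]]
    [:: [:: 0;34;0;94;116;73;75]; [:: 8;31;0;13;81]; [:: 3;32;0;23;105;114;82;93;98]; [::
      5;30;0;39;12;70;23;51]; [:: 6;29;0]; [:: 118;61;0;18;10;70;86;73]; [::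
      9;39;0;79;23;8;19;32]; [:: 11;31;1;89;81;36;47;30;82]; [:: 35;33;1;85;89;86;39;10]; [::
      63;33;0;54;30;13;84;43]; [:: 49;30;1;70;25;91;23;104;90]; [:: 91;62;0;90;91;30;100;2]; [::
      75;26;0;2;22;43;8]; [:: 119;29;1;23;0;17;8;10]];
  IClass [:: 1;6;11] [:: 4;19;37;41] [:: [:: 0;17;43;79;56;84;62]]
    [:: [:: 0;29;0;54;23;69;19]; [:: 1;36;0;84;54;86;104;34;76]; [:: 65;27;0;65]; [::
      3;35;0;13;16;20;7]; [:: 6;28;0;24;30;36;92;15]; [:: 72;55;1;16;39;69;113;29;42]; [::
      68;33;0;17;62;11;3]; [:: 11;31;0;0;65;32;12;34]; [:: 21;58;0;118;48;79;63;82;90]; [::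
      48;60;1;111;90;40;119;60;20]; [:: 71;63;0]; [:: 119;30;1;6;16;88;22;15]];
  IClass [:: 22;82;70] [:: 2;17;29;79] [:: [:: 65;96;7;117;8;36;89]]
    [:: [:: 4;33;0;89;117;116;60]; [:: 81;31;0;54;41;110;100;20]; [:: 25;29;0;60;118;7]; [::
      13;58;0;112;118;60;65;93]; [:: 94;30;1;16;84;88;17;21]; [:: 9;41;0;94;87;60;117]; [::
      11;40;0;114;109;12;58]; [:: 33;55;1;80;46;42;4;75]; [:: 14;62;0;14;7]; [::
      53;56;0;99;55;67;71;66]; [:: 32;63;0;41;60;103;58;8;12]; [:: 82;28;0;82;89]];
  IClass [:: 9;5;0] [:: 2;13;22;49] [:: [:: 13;40;0;6;64;1;8]; [:: 55;5;13;9]]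
    [:: [:: 0;38;0;79;33;105;34;88]; [:: 2;41;0;65;46;63;62;21]; [:: 17;30;0;53;2;28;55]; [::
      4;56;0;6;13]; [:: 6;31;0;7]; [:: 9;31;1;112;35;75;25;38;50]; [:: 66;58;0;66;51;16;73]; [::
      54;62;0;109;82;56;63;98]; [:: 62;30;1;51;95;28;102;103]; [:: 114;58;1;99;2;88;87;94]; [::
      92;64;0]; [:: 118;41;1;62;21;36;86;75;9]];
  IClass [:: 78;77;22] [:: 17;66;83;85] [:: [:: 62;71;82;77;111;60;74]]
    [:: [:: 0;33;0;73;118;84;67;7]; [:: 76;40;0;39;15;105;104;70;103]; [:: 5;34;0;6;5]; [::
      43;57;0;68;55;101;44;108]; [:: 110;62;0;96;75;67;69]; [:: 61;30;0;5;119;13]; [::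
      11;56;0;50;63;109;112;6]; [:: 18;56;0;24;7;28;0]; [:: 14;33;1;3;21;113;14]; [::
      24;58;0;6;61;95;86]; [:: 28;57;0;25;60;86;14;65]; [:: 36;55;1;79;98;47;110;49;19]; [::
      30;55;0;106;60;109;14;116;17]; [:: 107;30;1;84;106;38;112;86]; [::
      75;61;0;42;23;109;25;26]; [:: 88;58;1;29;36;56;6;113;14]];
  IClass [:: 0;5;9] [:: 2;13;22;84] [:: [:: 6;119;5]; [:: 30;0;79;119;19;9;65]]
    [:: [:: 9;31;1;28;103;6;66;102]; [:: 54;30;0;25;6;41;32]; [:: 22;37;0;118;3;115;78]; [::
      41;34;0;51;12;87;89;33;84]; [:: 7;58;1;58;18;55;89;79;12]; [::
      28;60;0;101;20;54;40;62;45]; [:: 59;64;0;11;108;52;19;53;32;95]; [::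
      119;35;1;4;62;41;58;56]];
  IClass [:: 75;9;31] [:: 25;26;27;57] [:: [:: 23;96;68;56;39;22;92]; [:: 9;5;43;119;37]]
    [:: [:: 6;35;0;118;104;87;7]; [:: 17;36;0;79;38;29;46;36]; [:: 77;60;1;68;102;10;31;100];
      [:: 86;65;0]; [:: 119;37;1;66;76;1;23;27;86]];
  IClass [:: 84;43;75] [:: 15;18;70;89] [:: [:: 10;98;117;89;83;60;77]; [:: 23;117;16;96]]
    [:: [:: 0;41;0;3;81;60;82;23]; [:: 82;39;0;29;119;10;17]; [:: 17;40;0;3;7;30]; [::
      5;62;0;18;89;15;109;50;44]; [:: 98;41;1;89;72;73;91;65]; [:: 90;66;0]];
  IClass [:: 39;116;106;38] [:: 88;89;90;113] [:: [:: 45;22;73;78;64;79;56;36]]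
    [:: [:: 44;51;0;37;21;44;28]; [:: 1;46;0;36;71;11;108;55]; [:: 59;42;0;48;53;12;61;83;59];
      [:: 103;44;1;15;11;119;62;71;57]; [:: 45;43;0;7;53]; [:: 21;45;0;6;14]; [::
      118;48;1;41;99;61;63;59;38]; [:: 102;49;1;45;91;111;65;57;56]];
  IClass [:: 7;73;19;4] [:: 1;12;27;40] [:: [:: 56;8;31;10;30;44;49;45]]
    [:: [:: 0;46;0;10;8;36;78;52]; [:: 1;49;0;108;62;101;117;13;40]; [:: 4;44;0;5;6;7]; [::
      42;42;0;40]; [:: 80;44;1;23;50;30;107;53]; [:: 11;42;1;82;90;50;65;62;25]; [::
      15;51;0;15;55;73;9;72]; [:: 65;51;0;55;5;18;64;34]; [:: 20;50;0;55;64]; [::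
      115;49;1;64;73;50;103;35;102]];
  IClass [:: 68;103;40;77] [:: 21;44;76;114] [:: [:: 92;107;1;59;82;75;48;16]]
    [:: [:: 63;45;1;58;28;8;6;107;64]; [:: 1;46;0;67;108;65;91;12]; [::
      2;44;0;59;6;13;49;20;48]; [:: 83;42;0;55]; [:: 52;43;1;113;35;11;19;52]; [:: 12;46;0;13];
      [:: 9;51;0;55;83;72]; [:: 46;42;1;117;81;105;1;62;47]; [:: 53;43;0;10;8;87;0;55]; [::
      54;51;0;27;4;3;19]; [:: 68;44;1;119;109;59;117;74]; [:: 29;45;0;22;2;23;25;28]];
  IClass [:: 17;29;15;6] [:: 8;37;43;94] [:: [:: 114;36;63;110;62;61;16;111]; [:: 82;119]]
    [:: [:: 0;49;0;60;109;82;89;103]; [:: 25;48;0;26;110;99;78;12]; [:: 3;44;0;45;28;63;69;79];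
      [:: 105;51;0;13;61;33;6]; [:: 34;52;1;28;37;111;43;14]; [:: 13;45;1;118;9;117;94;36]; [::
      43;50;0;108;94;83;100]; [:: 82;42;0;36;15;56;54;75;45;24]];
  IClass [:: 46;39;75;55] [:: 11;24;26;47] [:: [:: 42;11;108;22;43;47;97;14]; [:: 27;93;81;36]]
    [:: [:: 16;43;1;49;108;22;85;102;38]; [:: 6;46;0;82;45;31;60;108;103]; [::
      29;43;0;14;50;45;30]];
  IClass [:: 21;97;44;66] [:: 62;87;108;110] [:: [:: 41;2;100;92;111;83;67;90]; [::
    17;44;46;68;47;77]]
    [:: [:: 24;52;0;117;68;43;30;16;14]; [:: 10;45;0;87;94;23;106]; [::
      6;48;1;12;54;40;112;53;58]; [:: 7;43;0;118]; [:: 46;53;1;12;28;114;20;113]];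
  IClass [:: 107;35;64;112] [:: 15;67;100;118] [:: [:: 11;2;8;9]; [:: 111;26;71;110]]
    [:: [:: 4;51;0;29;55;34;19;21]; [:: 1;45;1;61;39;1;68;102]; [:: 15;47;0;77;90;96;10;8]; [::
      94;45;0;117;87;7]];
  IClass [:: 102;31;113;80] [:: 66;68;82;101] [:: [:: 109;59;83;113;4;98;117;30]; [::
    9;101;95;93;58;90]]
    [:: [:: 104;51;0;22;47;23;62;98;42]; [:: 13;50;0;32;81;26]; [:: 2;49;0;25;7;36;73]; [::
      3;47;0;31;28;6]; [:: 101;54;0;37;89;27;36;96]; [:: 11;49;1;78;84;88;96;93;90]; [::
      75;46;0;101;93;18;9]];
  IClass [:: 102;15;89;96] [:: 40;84;95;115] [:: [:: 77;18;23;69]; [::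
    118;103;41;8;87;39;117;94]]
    [:: [:: 71;48;0]; [:: 105;49;0;98;8;82;107;58]];
  IClass [:: 69;16;114;60] [:: 18;39;64;68] [:: [:: 4;19;34;69;56;65]; [:: 84;108;7;87;79;23]]
    [:: [:: 42;50;0;53;113;48;15;3]; [:: 36;52;1;82;116;57;88]; [:: 35;52;0;13;17;67;81;91;16]];
  IClass [:: 24;35;107;100] [:: 31;43;44;86] [:: [:: 41;118;8;66;51;67]; [:: 37;8;82;65;77;79]]
    [:: [:: 0;53;0;47;25;22;94;68]];
  IClass [:: 113;78;3;5] [:: 16;52;53;101] [:: [:: 27;41;32;24;114;102;61;58]; [::
    89;100;67;111;57;109]]
    [:: [:: 24;54;0;68;103;18;1;104]]]%num.


(** * Integer reflections as matrices *)

Section IntegerReflectionSoundness.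

Variables (R : realType) (n : nat).

Definition zr (z : Z) : R := (int_of_Z z)%:~R.

Lemma zrD a b : zr (Z.add a b) = zr a + zr b.
Proof. by rewrite /zr -rmorphD -(rmorphD int_of_Z). Qed.

Lemma zrM a b : zr (Z.mul a b) = zr a * zr b.
Proof. by rewrite /zr -rmorphM -(rmorphM int_of_Z). Qed.

Lemma zrN a : zr (Z.opp a) = - zr a.
Proof. by rewrite /zr -rmorphN -(rmorphN int_of_Z). Qed.

Lemma zrB a b : zr (Z.sub a b) = zr a - zr b.
Proof. by rewrite /Z.sub zrD zrN. Qed.

Lemma idot_isub f c z r : idot f (isub c z r) = Z.sub (idot f z) (Z.mul c (idot f r)).
Proof.
elim: f z r => [|a f IH] [|b z] [|d r] /=; try lia.
all: by rewrite ?IH /=; try lia; case: f {IH} => /=; intros; lia.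
Qed.

Lemma isub_idot c f g z : idot (isub c f g) z = Z.sub (idot f z) (Z.mul c (idot g z)).
Proof.
elim: z f g => [|a z IH] [|b f] [|d g] /=; try lia.
all: rewrite ?IH /=; try lia.
all: case: z {IH} => /=; intros; lia.
Qed.

Fixpoint comb (v : seq 'cV[R]_n) (z : seq Z) : 'cV[R]_n :=
  match v, z with
  | x :: v', a :: z' => zr a *: x + comb v' z'
  | _, _ => 0
  end.

Lemma comb_nil v : comb v [::] = 0.
Proof. by case: v. Qed.

Lemma comb_isub v c z r : comb v (isub c z r) = comb v z - zr c *: comb v r.
Proof.
elim: v z r => [|x v IH] [|a z] [|b r] /=; rewrite ?scaler0 ?subr0 //.
- by rewrite IH comb_nil zrN zrM scaleNr scalerDr scalerA !sub0r opprD.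
- by rewrite IH zrB zrM scalerBl scalerDr scalerA opprD addrACA.
Qed.

Lemma comb_ireflect v p z :
  comb v (ireflect p z) = comb v z - zr (idot p.2 z) *: comb v p.1.
Proof. exact: comb_isub. Qed.

Lemma comb_opp v z : comb v (map Z.opp z) = - comb v z.
Proof.
elim: v z => [|x v IH] [|a z] /=; rewrite ?oppr0 //.
by rewrite IH zrN scaleNr opprD.
Qed.

Lemma idot_oppl f z : idot (map Z.opp f) z = Z.opp (idot f z).
Proof. by elim: f z => [|a f IH] [|b z] //=; rewrite IH; lia. Qed.

Lemma eq_zseqP z r : eq_zseq z r -> z = r.
Proof.
elim: z r => [|a z IH] [|b r] //=; case: Z.eqb_spec => // -> /IH ->; by [].
Qed.

Lemma eq_ireflP p q : eq_irefl p q -> p = q.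
Proof.
by case: p q => [p1 p2] [q1 q2]; rewrite /eq_irefl /=; case: ifP => // /eq_zseqP-> /eq_zseqP->.
Qed.

Lemma eq_imatrixP M N : eq_imatrix M N -> M = N.
Proof.
by elim: M N => [|z M IH] [|r N] //=; case: ifP => // /eq_zseqP -> /IH ->.
Qed.

Definition iact (w : iword) z := foldr ireflect z w.

Lemma iapplyE w M : iapply w M = map (iact w) M.
Proof.
elim: w => [|p w IH] /=; first by rewrite map_id.
by rewrite IH -map_comp.
Qed.

Variables (v : seq 'cV[R]_n).
Notation W := (refl_group v).
Notation m := (size v).

Lemma comb_iunit i : (i < m)%N -> comb v (iunit m i) = v`_i.
Proof.
have comb0 : forall u k, comb u (nseq k Z0) = 0.
  by elim=> [|x u IH] [|k] //=; rewrite IH /zr /= scale0r addr0.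
rewrite /iunit; elim: v i => [|x u IH] [|i] //= im.
  by rewrite /zr /= scale1r comb0 addr0.
by rewrite subSS IH // /zr /= scale0r add0r.
Qed.

(** The integers only record the action on the span of [v]; membership in [W] is what makes them
    determine [A]. *)
Definition realizes (p : ireflection) A :=
  [/\ W A, A *m A = 1%:M & forall z, A *m comb v z = comb v (ireflect p z)].

Definition wrealizes (w : iword) A :=
  W A /\ forall z, A *m comb v z = comb v (iact w z).

Lemma refl_group_eqP A B : W A -> W B ->
  (forall i, (i < m)%N -> A *m v`_i = B *m v`_i) -> A = B.
Proof.
move=> gA gB AB; have BV := refl_group_unit gB.
have VB : invmx B *m B = 1%:M by exact: mulmx1C.
suff E : invmx B *m A = 1%:M by rewrite -[A]mul1mx -BV -mulmxA E mulmx1.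
apply: (@refl_group_faithful _ _ v).
  by apply: generated_mul gA; apply: generated_inv.
by move=> _ /(nthP 0) [i im <-]; rewrite -mulmxA AB // mulmxA VB mul1mx.
Qed.

(** Agreement on coordinate vectors is agreement on the generating roots, on which the group acts
    faithfully. *)
Lemma wrealizes_eq w w' A B :
  wrealizes w A -> wrealizes w' B -> eq_iword m w w' -> A = B.
Proof.
move=> [gA Aw] [gB Bw] /eq_imatrixP; rewrite !iapplyE => E.
apply: refl_group_eqP => // i im; rewrite -comb_iunit // Aw Bw; congr comb.
have := congr1 (fun s => nth [::] s i) E.
by rewrite !(nth_map [::]) ?size_map ?size_iota // !(nth_map 0%N) ?size_iota // nth_iota.
Qed.

Lemma wrealizes_nil : wrealizes [::] 1%:M.
Proof. by split=> [|z]; [exact: generated_1|rewrite mul1mx]. Qed.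

Lemma wrealizes_cons p w A B : realizes p A -> wrealizes w B -> wrealizes (p :: w) (A *m B).
Proof.
move=> [gA _ Ap] [gB Bw]; split; first exact: generated_mul.
by move=> z; rewrite -mulmxA Bw Ap.
Qed.

Lemma wrealizes_cat w w' A B : wrealizes w A -> wrealizes w' B -> wrealizes (w ++ w') (A *m B).
Proof.
move=> [gA Aw] [gB Bw]; split; first exact: generated_mul.
by move=> z; rewrite -mulmxA Bw Aw /iact foldr_cat.
Qed.

Lemma realizes_opp p A : realizes p A -> realizes (iopp p) A.
Proof.
move=> [gA A2 Ap]; split=> // z; rewrite Ap /ireflect !comb_isub /iopp /=.
by rewrite idot_oppl comb_opp zrN scaleNr scalerN opprK.
Qed.

Lemma realizes_conj p q A B : realizes p A -> realizes q B ->
  realizes (iconj p q) (A *m B *m A).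
Proof.
move=> [gA A2 Ap] [gB B2 Bq]; split.
- by do 2!apply: generated_mul => //.
- by rewrite -!mulmxA (mulmxA A A) A2 mul1mx (mulmxA B B) B2 mul1mx.
move=> z; have E : A *m comb v (ireflect p z) = comb v z by rewrite -Ap mulmxA A2 mul1mx.
rewrite -!mulmxA Ap Bq (comb_ireflect _ q) mulmxBr -scalemxAr E Ap.
rewrite [RHS]comb_ireflect /= isub_idot /ireflect idot_isub -/(ireflect p q.1).
by rewrite !zrB !zrM [zr (idot p.2 z) * _]mulrC.
Qed.

Lemma realizes_conj_word w q A B : wrealizes w A -> (forall p, p \in w -> exists P, realizes p P) ->
  realizes q B -> exists2 C, realizes (iconj_word w q) C & C *m A = A *m B.
Proof.
move=> wA + qB; elim: w A wA => [|p w IH] A wA rw.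
  exists B => //; have -> : A = 1%:M; last by rewrite mulmx1 mul1mx.
  apply: wrealizes_eq wA wrealizes_nil _; rewrite /eq_iword.
  by elim: (iapply _ _) => //= z M ->; elim: z => //= a z IHz; rewrite Z.eqb_refl.
have [P rP] := rw p (mem_head _ _); have [gP P2 Pp] := rP.
(* [P] is its own inverse, so multiplying by it strips the first letter of the word. *)
have wB : wrealizes w (P *m A).
  have [gA Aw] := wA; split; first exact: generated_mul.
  move=> z; rewrite -mulmxA Aw /=.
  by rewrite -Pp mulmxA P2 mul1mx.
have [|C rC CA] := IH _ wB; first by move=> x xw; apply: rw; rewrite inE xw orbT.
exists (P *m C *m P); first exact: realizes_conj.
by rewrite -[P *m C *m P *m A]mulmxA -(mulmxA P C) CA !mulmxA P2 mul1mx.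
Qed.

Lemma realizes_unique p A B : realizes p A -> realizes p B -> A = B.
Proof.
move=> [gA _ Ap] [gB _ Bp]; apply: refl_group_eqP => // i im.
by rewrite -comb_iunit // Ap Bp.
Qed.

Lemma irefl_removeP p s s' q :
  irefl_remove p (iopp p) s = Some s' -> q \in s -> [\/ q \in s', q = p | q = iopp p].
Proof.
elim: s s' => [|a s IH] s' //=; rewrite inE; case: ifP => [/eq_ireflP <- [<-]|_].
  by case/orP => [/eqP->|->]; [constructor 2|constructor 1].
case: ifP => [/eq_ireflP E [<-]|_].
  by case/orP => [/eqP->|->]; [constructor 3|constructor 1].
case E : irefl_remove => [s''|//] [<-] /orP[/eqP->|/(IH _ E)].
  by constructor 1; rewrite mem_head.
by case=> [qs|->|->]; [constructor 1; rewrite inE qs orbT|constructor 2|constructor 3].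
Qed.

End IntegerReflectionSoundness.

(** * Soundness of the conjugacy class tables *)

Section CheckSoundness.

Variables (R : realType) (n : nat) (v : seq 'cV[R]_n).
Notation W := (refl_group v).
Notation m := (size v).
Variables (L : seq ireflection) (zword : seq N) (T : seq iclass).
Hypothesis L_simple : forall i, (i < m)%N ->
  nth ([::], [::]) L i \in take m L /\ realizes v (nth ([::], [::]) L i) (reflmx v`_i).
Hypothesis L_realized : forall p, p \in L -> exists A, realizes v p A.
Hypothesis checked : check_all m L zword T.

Lemma iref_realized k : exists A, realizes v (iref L k) A.
Proof.
have [kL|kL] := ltnP (nat_of_bin k) (size L); first exact/L_realized/mem_nth.
exists 1%:M; rewrite /iref nth_default //; split; [exact: generated_1|exact: mulmx1|].
by move=> z; rewrite mul1mx /ireflect /=; case: z.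
Qed.

Lemma irefs_realized w p : p \in irefs L w -> exists A, realizes v p A.
Proof. by move=> /mapP [k _ ->]; apply: iref_realized. Qed.

Lemma irefs_wrealized w : exists A, wrealizes v (irefs L w) A.
Proof.
elim: w => [|k w [B wB]]; first by exists 1%:M; apply: wrealizes_nil.
by have [A kA] := iref_realized k; exists (A *m B); apply: wrealizes_cons.
Qed.

Lemma central_element : exists2 z, wrealizes v (irefs L zword) z &
  z *m z = 1%:M /\ forall A, W A -> A *m z = z *m A.
Proof.
have [z zw] := irefs_wrealized zword; exists z => //.
have /and5P[_ _ _ /andP[/allP comm z2] _] := checked; split.
  exact: wrealizes_eq (wrealizes_cat zw zw) (wrealizes_nil _) z2.
move=> A; elim/refl_group_ind => [|t B /(nthP 0) [i im <-] _ IH].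
  by rewrite mulmx1 mul1mx.
have [iL ri] := L_simple im.
suff E : reflmx v`_i *m z = z *m reflmx v`_i by rewrite -mulmxA IH !mulmxA E.
apply: wrealizes_eq (wrealizes_cons ri zw) _ (comm _ iL).
by rewrite -[X in z *m X]mulmx1; apply: wrealizes_cat zw (wrealizes_cons ri (wrealizes_nil _)).
Qed.

Section Central.

Variable z : 'M[R]_n.
Hypothesis zw : wrealizes v (irefs L zword) z.
Hypotheses (z2 : z *m z = 1%:M) (zC : forall A, W A -> A *m z = z *m A).

Let zp (e : bool) : 'M[R]_n := if e then z else 1%:M.

Let zpC e A : W A -> A *m zp e = zp e *m A.
Proof. by case: e => /= [/zC //|_]; rewrite mulmx1 mul1mx. Qed.

Let zpM e f : zp e *m zp f = zp (e (+) f).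
Proof. by case: e; case: f; rewrite /= ?z2 ?mulmx1 ?mul1mx. Qed.

(** Conjugacy to a representative times a central sign, written without inverses. *)
Definition conj_to_rep A := exists g c e U,
  [/\ W g, c \in T, wrealizes v (irep L c) U & A *m g = g *m (zp e *m U)].

Let good_product U p := exists2 P, realizes v p P & conj_to_rep (P *m U).

Lemma good_product_opp U p q : q = iopp p -> good_product U p -> good_product U q.
Proof. by move=> -> [P rP cP]; exists P => //; apply: realizes_opp. Qed.

(** As [A] centralises [U], conjugating [P] by [A] conjugates [P U] as well. One reflection in each
    orbit of the centraliser is therefore enough. *)
Lemma good_product_conj U w A p :
    wrealizes v (irefs L w) A -> A *m U = U *m A ->
  good_product U p -> good_product U (iconj_word (irefs L w) p).
Proof.
move=> wA AU [P rP [g [c [e [U' [Wg cT rU' E]]]]]].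
have [Q rQ QA] := realizes_conj_word wA (@irefs_realized w) rP.
exists Q => //; exists (A *m g), c, e, U'; split=> //.
  by apply: generated_mul Wg; case: wA.
by rewrite !mulmxA -(mulmxA Q) -AU mulmxA QA -!mulmxA (mulmxA P) E !mulmxA.
Qed.

Lemma remove_allP U s rest q : (forall p, p \in s -> good_product U p) ->
  q \in rest -> q \in remove_all s rest \/ good_product U q.
Proof.
move=> + qr; elim: s => [|p s IH] gs /=; first by left.
have [|qr'|] := IH; [by move=> x xs; apply: gs; rewrite inE xs orbT| |by right].
case E : irefl_remove => [r'|]; last by left.
have [?|->|qE] := irefl_removeP E qr'; [by left| |]; right.
  by apply: gs; rewrite mem_head.
by apply: good_product_opp qE _; apply: gs; rewrite mem_head.
Qed.

Lemma orbit_coverP U fuel (gens : seq (seq N)) todo rest q :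
    (forall w A, w \in gens -> wrealizes v (irefs L w) A -> A *m U = U *m A) ->
    (forall p, p \in todo -> good_product U p) -> q \in rest ->
  q \in orbit_cover fuel (map (irefs L) gens) todo rest \/ good_product U q.
Proof.
move=> gensU; elim: fuel todo rest => [|fuel IH] [|p todo] rest gt qr /=; try by left.
set F := (fun g tr => _); set res := foldr _ _ _.
have gp : good_product U p by apply: gt; rewrite mem_head.
suff [gres qres] : (forall x, x \in res.1 -> good_product U x) /\
    (q \in res.2 \/ good_product U q).
  case: res gres qres => t r /= gres [qres|]; [exact: IH|by right].
have gt' x : x \in todo -> good_product U x by move=> xt; apply: gt; rewrite inE xt orbT.
rewrite /res; elim: gens gensU {res IH} => [|w gens IHg] gensU /=; first by split=> //; left.
have [|] := IHg; first by move=> w' A wg; apply: gensU; rewrite inE wg orbT.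
case: (foldr F _ _) => t r /= gtr qtr.
case E : irefl_remove => [r'|] //=.
have [A wA] := irefs_wrealized w.
have gp' : good_product U (iconj_word (irefs L w) p).
  by apply: good_product_conj gp; [exact: wA|apply: gensU wA; rewrite mem_head].
split; first by move=> x; rewrite inE => /orP[/eqP->|/gtr].
case: qtr => [qr'|]; last by right.
by have [?|->|/good_product_opp qE] := irefl_removeP E qr'; [left|right|right; apply: qE].
Qed.

Lemma check_classP c : c \in T -> check_class m L zword T c.
Proof. by have /and5P[_ _ _ _ /allP H] := checked; apply: H. Qed.

Lemma product_conj_to_rep c U p : c \in T -> wrealizes v (irep L c) U -> p \in L ->
  good_product U p.
Proof.
move=> cT rU pL; have /and5P[_ _ /allP comm /allP prods /nilP cover] := check_classP cT.
have starts q : q \in map (product_refl L) (icl_products c) -> good_product U q.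
  move=> /mapP [d /prods + ->]; rewrite /check_product -/(irep L c) => chk.
  move: (product_class d) (product_sign d) chk => k e chk.
  have [P rP] := iref_realized (nth N0 d 0); exists P => //.
  have [G wG] := irefs_wrealized (drop 3 d).
  have [U' rU'] : exists U', wrealizes v (irep_at L T k) U'.
    have [A wA] := irefs_wrealized (icl_left (nth iclass0 T k)).
    have [B wB] := irefs_wrealized (icl_right (nth iclass0 T k)).
    by exists (A *m B); apply: wrealizes_cat.
  have rz : wrealizes v (if e then irefs L zword else [::]) (zp e).
    by case: (e) => //; apply: wrealizes_nil.
  have := wrealizes_eq (wrealizes_cons rP (wrealizes_cat rU wG))
    (wrealizes_cat wG (wrealizes_cat rz rU')) chk.
  rewrite !mulmxA => E; have [kT|kT] := ltnP (nat_of_bin k) (size T).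
    exists G, (nth iclass0 T k), e, U'; split=> //; first by case: wG.
      exact: mem_nth.
    by rewrite E !mulmxA.
  (* A class index out of range reads empty words, hence the identity, which the head class also
     represents. *)
  have h0 : (0 < size T)%N by have /and5P[] := checked.
  have U'1 : U' = 1%:M.
    apply: (@refl_group_faithful _ _ v); first by case: rU'.
    move=> _ /(nthP 0) [i im <-]; rewrite -comb_iunit // (proj2 rU').
    by rewrite /irep_at /irep nth_default.
  exists G, (head iclass0 T), e, 1%:M; split; first by case: wG.
  - by case: (T) h0 => // ? ? _; rewrite mem_head.
  - have /and5P[_ h1 _ _ _] := checked.
    have [A wA] := irefs_wrealized (icl_left (head iclass0 T)).
    have [B wB] := irefs_wrealized (icl_right (head iclass0 T)).
    have rAB : wrealizes v (irep L (head iclass0 T)) (A *m B) by apply: wrealizes_cat.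
    by rewrite -(wrealizes_eq rAB (wrealizes_nil _) h1).
  - by rewrite E U'1 !mulmxA.
have [] := remove_allP starts pL; last by [].
move/(@orbit_coverP U (size L).+1 (icl_centraliser c) _ _ p) => H.
have [||] := H _ _ starts => //; last by rewrite cover.
move=> w A wc wA; have := comm (irefs L w) (map_f _ wc) => cw.
exact: wrealizes_eq (wrealizes_cat wA rU) (wrealizes_cat rU wA) cw.
Qed.

(** Stability of [L] under the simple reflections lets a reflection be moved across any element of
    the group. *)
Lemma closed_conj g p P : W g -> p \in L -> realizes v p P ->
  exists q Q, [/\ q \in L, realizes v q Q & P *m g = g *m Q].
Proof.
move=> Wg; elim/refl_group_ind: Wg p P => [|t A /(nthP 0) [i im <-] gA IH] p P pL rP.
  by exists p, P; rewrite mulmx1 mul1mx.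
have [iL ri] := L_simple im; have /and5P[_ _ /allP/(_ _ iL)/allP/(_ _ pL) cl _ _] := checked.
have [_ s2 _] := ri; have rc := realizes_conj ri rP; set s := reflmx _ in s2 rc *.
have [p' [p'L rp']] : exists p', p' \in L /\ realizes v p' (s *m P *m s).
  move: cl => /hasP [p' p'L]; case: ifP => [/eq_ireflP E _|_ /eq_ireflP E];
    exists p'; split=> //; rewrite -E //; exact: realizes_opp.
have [q [Q [qL rQ E]]] := IH _ _ p'L rp'; exists q, Q; split=> //.
by rewrite -mulmxA -E !mulmxA s2 mul1mx.
Qed.

(** If [B g = g z^e u] and [s g = g Q], then [s B g = g z^e Q u]; here [Q] is a reflection of the
    list, and the table provides a representative for [Q u]. *)
Lemma all_conj_to_rep A : W A -> conj_to_rep A.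
Proof.
elim/refl_group_ind => {A} [|t B /(nthP 0) [i im <-] gB [g [c [e [U [Wg cT rU E]]]]]].
  have /and5P[h0 h1 _ _ _] := checked.
  have [A wA] := irefs_wrealized (icl_left (head iclass0 T)).
  have [B wB] := irefs_wrealized (icl_right (head iclass0 T)).
  have rAB : wrealizes v (irep L (head iclass0 T)) (A *m B) by apply: wrealizes_cat.
  exists 1%:M, (head iclass0 T), false, (A *m B); split=> //; first exact: generated_1.
    by case: (T) h0 => // ? ? _; rewrite mem_head.
  by rewrite (wrealizes_eq rAB (wrealizes_nil _) h1) /= !mulmx1.
have [iL ri] := L_simple im.
have [q [Q [qL rQ sg]]] := closed_conj Wg (mem_take iL) ri.
have [Q' rQ' [h [c' [f [U' [Wh c'T rU' E']]]]]] := product_conj_to_rep cT rU qL.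
have QQ : Q' = Q by exact: realizes_unique rQ' rQ.
rewrite {}QQ {rQ'} in E'.
exists (g *m h), c', (e (+) f), U'; split=> //; first exact: generated_mul.
have WQ : W Q by case: rQ.
rewrite -mulmxA (mulmxA B) E !mulmxA sg -(mulmxA g Q) (zpC e WQ) -!mulmxA.
rewrite (mulmxA Q) E' -zpM -!mulmxA; congr (g *m _).
by rewrite !mulmxA (zpC e Wh).
Qed.

(** For [A = g z^e l r g^-1] the involution is [g l g^-1]: its product with [A] is [g z^e r g^-1],
    whose square is 1. *)
Lemma check_strongly_real_aux : strongly_real W.
Proof.
move=> A /all_conj_to_rep [g [c [e [U [Wg cT rU E]]]]].
have /and5P[l2 r2 _ _ _] := check_classP cT.
have [l wl] := irefs_wrealized (icl_left c); have [r wr] := irefs_wrealized (icl_right c).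
have {}l2 := wrealizes_eq (wrealizes_cat wl wl) (wrealizes_nil _) l2.
have {}r2 := wrealizes_eq (wrealizes_cat wr wr) (wrealizes_nil _) r2.
have UE : U = l *m r.
  have [gU Uw] := rU; have [glr lrw] := wrealizes_cat wl wr.
  by apply: (refl_group_eqP gU glr) => i im; rewrite -comb_iunit // Uw lrw.
have gV := refl_group_unit Wg; have Vg : invmx g *m g = 1%:M by exact: mulmx1C.
have Wl : W l by case: wl.
have Wr : W r by case: wr.
exists (g *m l *m invmx g); split.
- by apply: generated_mul (generated_inv Wg); apply: generated_mul.
- by rewrite !mulmxA -(mulmxA _ _ g) Vg mulmx1 -(mulmxA g) l2 mulmx1 gV.
have -> : g *m l *m invmx g *m A = g *m (zp e *m r) *m invmx g.
  rewrite -[A]mulmx1 -gV (mulmxA A) E UE !mulmxA -(mulmxA _ _ g) Vg mulmx1.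
  by rewrite -(mulmxA g) (zpC e Wl) !mulmxA -(mulmxA _ l l) l2 mulmx1.
rewrite !mulmxA -(mulmxA _ _ g) Vg mulmx1 -(mulmxA (g *m _)) (zpC e Wr).
by rewrite !mulmxA -(mulmxA g) zpM addbb /= mulmx1 -(mulmxA g) r2 mulmx1 gV.
Qed.

End Central.

Lemma check_strongly_real : strongly_real W.
Proof. by have [z zw [z2 zC]] := central_element; apply: (check_strongly_real_aux zw z2 zC). Qed.

End CheckSoundness.
Delimit Scope Z_scope with Zb.

(** Entry [j] of row [i] is twice the product of roots [i] and [j] over the squared length of root
    [i]. Node 1 of G2 and nodes 2 and 3 of F4 are short. *)
Definition G2_cartan : seq (seq Z) := [:: [:: 2; -1]; [:: -3; 2]]%Zb.
Definition F4_cartan : seq (seq Z) :=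
  [:: [:: 2; -1; 0; 0]; [:: -1; 2; -1; 0]; [:: 0; -2; 2; -1]; [:: 0; 0; -1; 2]]%Zb.

Definition E_cartan (m : nat) : seq (seq Z) :=
  [seq [seq if i == j then 2%Zb
            else if ((i == 0) && (j == 3) || (j == 0) && (i == 3))%N then (-1)%Zb
            else if [&& 0 < i, 0 < j & (i == j.+1) || (j == i.+1)]%N then (-1)%Zb else 0%Zb
       | j <- iota 0 m] | i <- iota 0 m].

(** * Matching the diagrams with integral Cartan matrices *)

Section ExceptionalTypes.

Variables (R : realType) (n : nat).
Implicit Types (K v : seq 'cV[R]_n).

Let rt2 : R := Num.sqrt 2.
Let rt3 : R := Num.sqrt 3.

Lemma realizes_simple v i (f : seq Z) : (i < size v)%N -> size f = size v ->
    (forall j, (j < size v)%N -> 2 * dotp v`_j v`_i / dotp v`_i v`_i = zr R (nth Z0 f j)) ->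
  realizes v (iunit (size v) i, f) (reflmx v`_i).
Proof.
move=> iv szf fE; split; [exact/refl_group_gen/mem_nth|exact: reflmxK|].
move=> z; rewrite comb_ireflect /= comb_iunit // reflmxEl; congr (_ - _ *: _).
move: (v`_i) fE => t; elim: v f z szf {iv} => [|x u IH] [|a f] [|b z] //= szf fE.
- by rewrite dotp0l mulr0 mul0r.
- by rewrite dotp0l mulr0 mul0r.
- by rewrite dotp0l mulr0 mul0r.
have [szf'] := szf; rewrite dotpDl dotpZl zrD zrM -(IH f z szf').
  by rewrite -(fE 0%N) //=; ring.
by move=> j ju; apply: (fE j.+1).
Qed.

Definition cartan_of v (cart : seq (seq Z)) := [/\ size cart = size v,
  forall i, (i < size v)%N -> size (nth [::] cart i) = size v &
  forall i j, (i < size v)%N -> (j < size v)%N ->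
    2 * dotp v`_j v`_i / dotp v`_i v`_i = zr R (nth Z0 (nth [::] cart i) j)].

Lemma strongly_real_check v cart ptr zword T :
  cartan_of v cart -> check_type cart ptr zword T -> strongly_real (refl_group v).
Proof.
move=> [szc szi cE]; rewrite /check_type szc.
have sz : size (isimple cart) = size v by rewrite size_map size_iota.
have simple_real i : (i < size v)%N ->
    realizes v (nth ([::], [::]) (isimple cart) i) (reflmx v`_i).
  move=> iv; rewrite (nth_map 0%N) ?size_iota ?szc // nth_iota ?szc //= add0n.
  by apply: realizes_simple => //; [exact: szi|move=> j jv; apply: cE].
have [L' [-> rl]] : exists L', ireflections cart ptr = isimple cart ++ L' /\
    forall p, p \in isimple cart ++ L' -> exists A, realizes v p A.
  rewrite /ireflections -{1}[isimple cart]cats0.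
  have : forall p, p \in isimple cart ++ [::] -> exists A, realizes v p A.
    move=> p; rewrite cats0 => /(nthP ([::], [::])) [i]; rewrite sz => iv <-.
    by exists (reflmx v`_i); apply: simple_real.
  elim: ptr [::] => [|[a b] ptr IH] L' rl /=; first by exists L'.
  have dflt k : exists A, realizes v (nth ([::], [::]) (isimple cart ++ L') k) A.
    have [kL|kL] := ltnP k (size (isimple cart ++ L')); first exact/rl/mem_nth.
    (* An index out of range reads a pair of empty lists, which acts as the identity. *)
    exists 1%:M; rewrite nth_default //; split; [exact: generated_1|exact: mulmx1|].
    by move=> z; rewrite mul1mx /ireflect /=; case: z.
  rewrite rcons_cat; apply: IH => p; rewrite -rcons_cat mem_rcons inE => /orP[/eqP->|/rl //].
  by have [[A rA] [B rB]] := (dflt b, dflt a); exists (A *m B *m A); apply: realizes_conj.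
apply: check_strongly_real => // i iv.
have nE : nth ([::], [::]) (isimple cart ++ L') i = nth ([::], [::]) (isimple cart) i.
  by rewrite nth_cat sz iv.
rewrite nE -sz take_size_cat //; split; last exact: simple_real.
by apply: mem_nth; rewrite sz.
Qed.

Lemma zr_small : (zr R 2%Zb = 2) * (zr R 0%Zb = 0) * (zr R (-1)%Zb = -1) *
  (zr R (-2)%Zb = -2) * (zr R (-3)%Zb = -3).
Proof. by []. Qed.

Lemma refl_group_scaled K v A :
    (forall t, t \in K -> exists2 a, a != 0 & a *: t \in v) ->
  refl_group K A -> refl_group v A.
Proof.
move=> Kv; apply: refl_group_sub => t /Kv [a a0 atv].
by rewrite -(reflmxZ t a0); apply: refl_group_gen.
Qed.

Lemma strongly_real_E K ptr zword T : has_gram (gram_chain 3 1) K ->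
  check_type (E_cartan (size K)) ptr zword T -> strongly_real (refl_group K).
Proof.
move=> gK; apply: strongly_real_check.
split; first by rewrite size_map size_iota.
  by move=> i iK; rewrite (nth_map 0%N) ?size_iota // size_map size_iota.
move=> i j iK jK; have ii : dotp K`_i K`_i = 2 by rewrite gK // /gram_chain eqxx.
rewrite ii gK // mulrAC divff ?pnatr_eq0 // mul1r.
rewrite (nth_map 0%N) ?size_iota // (nth_map 0%N) ?size_iota // !nth_iota // !add0n.
rewrite gram_chainC /gram_chain; do !case: ifP => //.
Qed.

(** The Gram entry [- sqrt 2] is not integral. Dividing the last two roots by [sqrt 2] restores an
    integral Cartan matrix and leaves the reflections unchanged. *)
Lemma strongly_real_F4 K : has_gram (@gram_F4 R) K -> size K = 4 -> strongly_real (refl_group K).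
Proof.
case: K => [|k0 [|k1 [|k2 [|k3 []]]]] // gK _.
have r22 := @rt2_sqr R; have r21 := @rt2_gt1 R; rewrite -/rt2 in r22 r21.
have r20 : rt2 != 0 by rewrite gt_eqF //; apply: lt_trans r21.
have rV0 : rt2^-1 != 0 by rewrite invr_eq0.
have rV2 : rt2^-1 * rt2^-1 = 2^-1 by rewrite -invfM r22.
have rVr : rt2^-1 * rt2 = 1 by rewrite mulVf.
pose v := [:: k0; k1; rt2^-1 *: k2; rt2^-1 *: k3].
apply: (@strongly_real_eq _ _ (refl_group v)).
  move=> A; split; apply: refl_group_scaled => t; rewrite !inE => /or4P[]/eqP->.
  1,2,5,6: by exists 1; rewrite ?oner_eq0 // scale1r !inE eqxx ?orbT.
  1,2: by exists rt2; rewrite // scalerA mulfV // scale1r !inE eqxx ?orbT.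
  1,2: by exists rt2^-1; rewrite // !inE eqxx ?orbT.
apply: (@strongly_real_check _ F4_cartan F4_roots F4_centre F4_classes); last first.
  by vm_cast_no_check (erefl true).
have g00 := gK 0%N 0%N isT isT; have g01 := gK 0%N 1%N isT isT.
have g02 := gK 0%N 2%N isT isT; have g03 := gK 0%N 3%N isT isT.
have g11 := gK 1%N 1%N isT isT; have g12 := gK 1%N 2%N isT isT.
have g13 := gK 1%N 3%N isT isT; have g22 := gK 2%N 2%N isT isT.
have g23 := gK 2%N 3%N isT isT; have g33 := gK 3%N 3%N isT isT.
rewrite /gram_F4 /= -/rt2 in g00 g01 g02 g03 g11 g12 g13 g22 g23 g33.
have [g10 g20 g30] : [/\ dotp k1 k0 = -1, dotp k2 k0 = 0 & dotp k3 k0 = 0].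
  by split; rewrite dotpC.
have [g21 g31 g32] : [/\ dotp k2 k1 = - rt2, dotp k3 k1 = 0 & dotp k3 k2 = -1].
  by split; rewrite dotpC.
have d22 : rt2^-1 * (rt2^-1 * 2) = 1 by rewrite mulrA rV2 mulVf ?pnatr_eq0.
have d21 : rt2^-1 * - rt2 = -1 by rewrite mulrN rVr.
have d23 : rt2^-1 * (rt2^-1 * -1) = - 2^-1 by rewrite mulrA rV2 mulrN1.
split=> // [[|[|[|[|i]]]]|[|[|[|[|i]]]] [|[|[|[|j]]]]] // _ _; rewrite /= ?dotpZl ?dotpZr;
  rewrite ?g00 ?g01 ?g02 ?g03 ?g10 ?g11 ?g12 ?g13 ?g20 ?g21 ?g22 ?g23 ?g30 ?g31 ?g32 ?g33 ?zr_small;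
  by rewrite ?d22 ?d21 ?d23 ?mulr0; lra.
Qed.

Lemma strongly_real_G2 K : has_gram (gram_chain 1 rt3) K -> size K = 2 ->
  strongly_real (refl_group K).
Proof.
case: K => [|k0 [|k1 []]] // gK _.
have r33 := @rt3_sqr R; have r21 := @rt2_gt1 R; have r32 := @rt3_gt_rt2 R.
rewrite -/rt3 in r33 r32.
have r30 : rt3 != 0 by rewrite gt_eqF //; apply: lt_trans r32; apply: lt_trans r21.
have rV3 : rt3^-1 * rt3^-1 = 3^-1 by rewrite -invfM r33.
have rVr : rt3^-1 * rt3 = 1 by rewrite mulVf.
apply: (@strongly_real_eq _ _ (refl_group [:: k0; rt3^-1 *: k1])).
  move=> A; split; apply: refl_group_scaled => t; rewrite !inE => /orP[]/eqP->.
  1,3: by exists 1; rewrite ?oner_eq0 // scale1r !inE eqxx.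
    by exists rt3; rewrite // scalerA mulfV // scale1r !inE eqxx orbT.
  by exists rt3^-1; rewrite ?invr_eq0 // !inE eqxx orbT.
apply: (@strongly_real_check _ G2_cartan G2_roots G2_centre G2_classes); last first.
  by vm_cast_no_check (erefl true).
have g00 := gK 0%N 0%N isT isT; have g01 := gK 0%N 1%N isT isT.
have g11 := gK 1%N 1%N isT isT; rewrite /gram_chain /= -/rt3 in g00 g01 g11.
have g10 : dotp k1 k0 = - rt3 by rewrite dotpC.
have d11 : rt3^-1 * (rt3^-1 * 2) = 2 / 3 by rewrite mulrA rV3 mulrC.
have d10 : rt3^-1 * - rt3 = -1 by rewrite mulrN rVr.
have d3 : 2 * -1 / (2 / 3) = -3 :> R by field.
have d2 : 2 * (2 / 3) / (2 / 3) = 2 :> R by field.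
split=> // [[|[|i]]|[|[|i]] [|[|j]]] // _ _; rewrite /= ?dotpZl ?dotpZr;
  by rewrite ?g00 ?g01 ?g10 ?g11 ?zr_small ?d11 ?d10 ?d3 ?d2; lra.
Qed.

End ExceptionalTypes.

(** * Simple roots *)

Section ObtuseBases.

Variables (R : realType) (n : nat).
Implicit Types (X : seq 'cV[R]_n) (h x y : 'cV[R]_n).

(** If [h] is orthogonal to the new vector [a], add [e *: a] with [e] larger than every ratio
    [|dotp h b / dotp a b|]: vectors orthogonal to [a] keep their product with [h], and for the
    others the two terms cannot cancel. *)
Lemma exists_generic X : {in X, forall x, x != 0} -> exists h, {in X, forall x, dotp h x != 0}.
Proof.
elim: X => [|a X IH] X0; first by exists 0.
have [|h hX] := IH; first by move=> x xX; apply: X0; rewrite inE xX orbT.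
have [ha|ha] := eqVneq (dotp h a) 0; last first.
  by exists h => x; rewrite inE => /orP[/eqP->|/hX].
pose e := 1 + \sum_(b <- X) `|dotp h b / dotp a b|.
have e0 : 0 < e by rewrite ltr_wpDr ?ltr01 // sumr_ge0.
exists (h + e *: a) => x; rewrite inE dotpDl dotpZl => /orP[/eqP->|xX].
  by rewrite ha add0r mulf_neq0 ?gt_eqF // dotp_gt0 X0 // mem_head.
have [->|ax] := eqVneq (dotp a x) 0; first by rewrite mulr0 addr0 hX.
apply/eqP => E; have hE : dotp h x / dotp a x = - e.
  by rewrite -[dotp h x](addrK (e * dotp a x)) E sub0r mulNr mulfK.
have : `|dotp h x / dotp a x| <= \sum_(b <- X) `|dotp h b / dotp a b|.
  by rewrite (big_rem _ xX) /= lerDl sumr_ge0.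
by rewrite hE normrN gtr0_norm // /e; lra.
Qed.

(** Split a relation into its positive and negative parts, two equal sums with disjoint supports.
    Their inner product is both a squared length and nonpositive, so both sums vanish; pairing with
    [h] then kills every coefficient. *)
Lemma obtuse_free X h : uniq X -> {in X, forall x, 0 < dotp h x} ->
  {in X &, forall x y, x != y -> dotp x y <= 0} -> free X.
Proof.
move=> uX hX oX; change (free (in_tuple X)); apply/freeP => k k0 i.
pose p i := Num.max (k i) 0; pose q i := Num.max (- k i) 0.
have pq0 j : p j * q j = 0.
  rewrite /p /q; have [kj|kj] := leP (k j) 0; first by rewrite mul0r.
  by rewrite max_r ?mulr0 // oppr_le0 ltW.
have kpq j : k j = p j - q j.
  rewrite /p /q; have [kj|kj] := leP (k j) 0.
    by rewrite max_l ?oppr_ge0 // sub0r opprK.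
  by rewrite max_r ?subr0 // oppr_le0 ltW.
have p0 j : 0 <= p j by rewrite le_max lexx orbT.
have q0 j : 0 <= q j by rewrite le_max lexx orbT.
pose comb c := \sum_(j < size X) c j *: X`_j.
have E : comb p = comb q.
  apply/eqP; rewrite -subr_eq0 -sumrB; apply/eqP; rewrite -[RHS]k0.
  by apply: eq_bigr => j _; rewrite kpq scalerBl.
have cle : dotp (comb p) (comb q) <= 0.
  rewrite dotp_suml sumr_le0 // => j _; rewrite dotp_sumr sumr_le0 // => l _.
  rewrite dotpZl dotpZr mulrA; have [->|jl] := eqVneq l j; first by rewrite pq0 mul0r.
  apply: mulr_ge0_le0; first exact: mulr_ge0.
  by apply: oX; rewrite ?mem_nth // nth_uniq // eq_sym.
have cz c : (forall j, 0 <= c j) -> comb c = 0 -> forall j, c j = 0.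
  move=> c0 cE j; have := dotp0r h; rewrite -cE dotp_sumr => /eqP.
  rewrite psumr_eq0 => [/allP/(_ j (mem_index_enum j))|l _]; rewrite dotpZr.
    by rewrite /= mulf_eq0 (gt_eqF (hX _ _)) ?mem_nth // orbF => /eqP.
  by rewrite mulr_ge0 // ltW // hX ?mem_nth.
have p00 : comb p = 0.
  by apply/eqP; rewrite -dotp_eq0 eq_le dotp_ge0 andbT {2}E.
by rewrite kpq (cz p) // (cz q) // -?E // subrr.
Qed.

End ObtuseBases.

(** * Indecomposable positive roots of a root system *)

Section RootSystemBase.

Variables (R : realType) (n : nat) (Phi : {fset 'cV[R]_n}).
Hypothesis hPhi : crystallographic_root_system Phi.

Let Phi0 a : a \in Phi -> a != 0. Proof. by case: hPhi => H _ _; apply: H. Qed.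
Let PhiR a b : a \in Phi -> b \in Phi -> refl a b \in Phi.
Proof. by case: hPhi => _ H _; apply: H. Qed.
Let PhiZ a b : a \in Phi -> b \in Phi -> 2 * dotp b a / dotp a a \is a Num.int.
Proof. by case: hPhi => _ _ H; apply: H. Qed.
Let Phi_gt0 a : a \in Phi -> 0 < dotp a a. Proof. by move=> /Phi0; rewrite dotp_gt0. Qed.

Lemma root_opp a : a \in Phi -> - a \in Phi.
Proof.
move=> aP; have := PhiR aP aP; rewrite /refl mulfK ?gt_eqF ?Phi_gt0 //.
by rewrite scaler_nat mulr2n opprD addrA subrr sub0r.
Qed.

Lemma cauchy_schwarz (x y : 'cV[R]_n) : dotp x y ^+ 2 <= dotp x x * dotp y y.
Proof.
have [->|y0] := eqVneq y 0; first by rewrite !dotp0r expr0n /= mulr0.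
have yy : 0 < dotp y y by rewrite dotp_gt0.
have := dotp_ge0 (dotp y y *: x - dotp x y *: y).
have -> : dotp (dotp y y *: x - dotp x y *: y) (dotp y y *: x - dotp x y *: y) =
    dotp y y * (dotp x x * dotp y y - dotp x y ^+ 2).
  by rewrite !dotp_lin (dotpC y x); ring.
by rewrite pmulr_rge0 // subr_ge0.
Qed.

(** Both Cartan integers are positive. If one of them is 1, a reflection produces [a - b] or its
    opposite; if both were at least 2, Cauchy-Schwarz would force [a = b]. *)
Lemma root_sub a b : a \in Phi -> b \in Phi -> a != b -> 0 < dotp a b -> a - b \in Phi.
Proof.
move=> aP bP ab ab0; have [aa bb] := (Phi_gt0 aP, Phi_gt0 bP).
have int_pos (x : R) : x \is a Num.int -> 0 < x -> x = 1 \/ 2 <= x.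
  move=> /intrP [z ->]; rewrite ltr0z => z0.
  have [->|z1] : z = 1 \/ (2 <= z)%R by lia.
    by left.
  by right; rewrite (ler_int R 2 z).
have [|p1|p2] := int_pos _ (PhiZ bP aP); first by rewrite divr_gt0 ?mulr_gt0.
  by have := PhiR bP aP; rewrite /refl p1 scale1r.
have [|q1|q2] := int_pos _ (PhiZ aP bP); first by rewrite divr_gt0 ?mulr_gt0 // dotpC.
  have := PhiR aP bP; rewrite /refl q1 scale1r => /root_opp.
  by rewrite opprB.
exfalso; move: p2 q2; rewrite !ler_pdivlMr // (dotpC b a) => p2 q2.
have cs := cauchy_schwarz a b.
move: ab; rewrite -subr_eq0 -dotp_eq0 => /eqP; apply; rewrite !dotp_lin (dotpC b a).
have [p2' q2'] : dotp b b <= dotp a b /\ dotp a a <= dotp a b by split; lra.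
have : dotp a a * dotp b b <= dotp a b * dotp b b by rewrite ler_wpM2r // ltW.
have : dotp a b * dotp b b <= dotp a b * dotp a b by rewrite ler_wpM2l // ltW.
move: cs; rewrite expr2 => h1 h2 h3.
have e1 : dotp a b * dotp b b = dotp a b * dotp a b by lra.
have e2 : dotp a a * dotp b b = dotp a b * dotp b b by lra.
have {}e1 : dotp b b = dotp a b by apply: (mulfI (lt0r_neq0 ab0)).
have {}e2 : dotp a a = dotp a b by apply: (mulIf (lt0r_neq0 bb)).
lra.
Qed.

Section Positive.

Variable h : 'cV[R]_n.
Hypothesis h_generic : {in Phi, forall a, dotp h a != 0}.

Definition positive_roots : seq 'cV[R]_n := [seq a <- Phi | 0 < dotp h a].
Definition simple_roots := [seq a <- positive_roots |
  ~~ has (fun b => a - b \in positive_roots) positive_roots].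

Notation P := positive_roots.
Notation D := simple_roots.

Lemma positive_rootsE a : (a \in P) = (a \in Phi) && (0 < dotp h a).
Proof. by rewrite mem_filter andbC. Qed.

Lemma positive_or_opp a : a \in Phi -> a \in P \/ - a \in P.
Proof.
move=> aP; rewrite !positive_rootsE aP root_opp // dotpNr oppr_gt0.
by have := h_generic aP; rewrite neq_lt => /orP[->|->]; [right|left].
Qed.

Lemma simple_positive d : d \in D -> d \in P.
Proof. by rewrite mem_filter => /andP[]. Qed.

Lemma simple_root d : d \in D -> d \in Phi.
Proof. by move/simple_positive; rewrite positive_rootsE => /andP[]. Qed.

Lemma simple_gt0 d : d \in D -> 0 < dotp h d.
Proof. by move/simple_positive; rewrite positive_rootsE => /andP[]. Qed.

Lemma simple_roots_uniq : uniq D.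
Proof. by rewrite !filter_uniq // fset_uniq. Qed.

(** A positive product would make [d - e] a root, and according to its sign [d] or [e] would be a
    sum of two positive roots. *)
Lemma simple_obtuse d e : d \in D -> e \in D -> d != e -> dotp d e <= 0.
Proof.
move=> dD eD de; rewrite leNgt; apply/negP => de0.
have := root_sub (simple_root dD) (simple_root eD) de de0.
case/positive_or_opp => [deP|].
  move: dD; rewrite mem_filter => /andP[/hasP []]; exists e => //.
  exact: simple_positive.
rewrite opprB => edP; move: eD; rewrite mem_filter => /andP[/hasP []]; exists d => //.
exact: simple_positive.
Qed.

(** Induction on the height [dotp h], through the number of positive roots of smaller height. *)
Lemma positive_ind (Q : 'cV[R]_n -> Prop) :
    (forall a, a \in P -> (forall b, b \in P -> dotp h b < dotp h a -> Q b) -> Q a) ->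
  forall a, a \in P -> Q a.
Proof.
move=> step a; move: {2}_.+1 (ltnSn (count (fun b => dotp h b < dotp h a) P)) => k.
elim: k a => // k IH a ak aP; apply: step => // b bP ba; apply: IH => //.
rewrite ltnS in ak; apply: leq_trans ak; rewrite -!size_filter.
have /uniq_leq_size -> // : uniq (b :: [seq c <- P | dotp h c < dotp h b]).
  by rewrite /= mem_filter ltxx /= !filter_uniq // fset_uniq.
move=> c; rewrite inE => /orP[/eqP->|]; first by rewrite mem_filter ba.
rewrite mem_filter => /andP[cb cP]; rewrite mem_filter cP andbT.
exact: lt_trans ba.
Qed.

Lemma positive_comb a : a \in P -> exists2 c : 'cV[R]_n -> R,
  forall d, 0 <= c d & a = \sum_(d <- D) c d *: d.
Proof.
elim/positive_ind => {}a aP IH; have [aD|aD] := boolP (a \in D).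
  exists (fun d => (d == a)%:R); first by move=> d; rewrite ler0n.
  rewrite (bigD1_seq a) ?simple_roots_uniq //= eqxx scale1r big1 ?addr0 // => d /negbTE->.
  by rewrite scale0r.
move: aD; rewrite mem_filter aP andbT negbK => /hasP [b bP abP].
have [hb hab] : 0 < dotp h b /\ 0 < dotp h (a - b).
  by move: bP abP; rewrite !positive_rootsE => /andP[_ ->] /andP[_ ->].
rewrite dotpBr in hab.
have [|c c0 cE] := IH b bP; first by lra.
have [|c' c0' cE'] := IH _ abP; first by rewrite dotpBr; lra.
exists (fun d => c d + c' d) => [d|]; first exact: addr_ge0.
under eq_bigr do rewrite scalerDl.
by rewrite big_split /= -cE -cE' addrC subrK.
Qed.

(** A positive root [b] has positive product with some simple [d], for otherwise [dotp b b <= 0].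
    Reflecting in [d] lowers the height unless the image is negative; then [b] is a multiple of [d],
    not necessarily [d] itself when the system is not reduced. *)
Lemma root_refl_group a : a \in Phi -> refl_group D (reflmx a).
Proof.
suff HP b : b \in P -> refl_group D (reflmx b).
  by case/positive_or_opp => /HP //; rewrite reflmx_opp.
elim/positive_ind => {}b bP IH; have bPhi : b \in Phi.
  by move: bP; rewrite positive_rootsE => /andP[].
have [c c0 cE] := positive_comb bP.
have [d dD bd] : exists2 d, d \in D & 0 < dotp b d.
  apply/hasP; apply: contraT; rewrite -all_predC => /allP nD.
  have := Phi_gt0 bPhi; rewrite {2}cE dotp_sumr ltNge; case/negP.
  rewrite big_seq; apply: sumr_le0 => d dD; rewrite dotpZr mulr_ge0_le0 //.
  by have := nD d dD; rewrite /= -leNgt.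
have gd := refl_group_gen dD; have dPhi := simple_root dD.
have [dd hd] := (Phi_gt0 dPhi, simple_gt0 dD).
set k := 2 * dotp b d / dotp d d; have k0 : 0 < k by rewrite divr_gt0 ?mulr_gt0.
have E : reflmx d *m b = b - k *: d by rewrite reflmxEl.
have : b - k *: d \in Phi by have := PhiR dPhi bPhi; rewrite /refl.
case/positive_or_opp => [bkP|].
  have hlt : dotp h (b - k *: d) < dotp h b by rewrite dotpBr dotpZr ltrBlDr ltrDl mulr_gt0.
  have := refl_group_conj gd (IH _ bkP hlt).
  by rewrite -E mulmxA reflmxK mul1mx.
(* The only coordinate that the reflection in [d] changes is the one at [d],
   so [b] must be a multiple of [d]. *)
move=> bkP; have [c' c0' cE'] := positive_comb bkP.
have sumE : \sum_(e <- D | e != d) (c e + c' e) *: e = (k - c d - c' d) *: d.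
  have : \sum_(e <- D) (c e + c' e) *: e = k *: d.
    under eq_bigr do rewrite scalerDl.
    by rewrite big_split /= -cE -cE' opprB addrCA subrr addr0.
  rewrite (bigD1_seq d) ?simple_roots_uniq //= => Ek.
  by rewrite -addrA -opprD scalerBl -Ek addrAC subrr add0r.
(* Pairing with [d] bounds the coefficient by 0, since distinct simple roots have nonpositive
   products; pairing with [h] then makes all the nonnegative sums [c e + c' e] vanish. *)
have le0 : k - c d - c' d <= 0.
  rewrite -(ler_pM2r dd) mul0r -dotpZl -sumE dotp_suml big_seq_cond; apply: sumr_le0.
  move=> e /andP[eD ed]; rewrite dotpZl mulr_ge0_le0 ?addr_ge0 //.
  exact: simple_obtuse.
have hsum : \sum_(e <- D | e != d) (c e + c' e) * dotp h e = 0.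
  apply/eqP; rewrite eq_le; apply/andP; split; last first.
    rewrite big_seq_cond; apply: sumr_ge0 => e /andP[eD _].
    by rewrite mulr_ge0 ?addr_ge0 // ltW // simple_gt0.
  have -> : \sum_(e <- D | e != d) (c e + c' e) * dotp h e = (k - c d - c' d) * dotp h d.
    rewrite -dotpZr -sumE dotp_sumr; apply: eq_bigr => e _; by rewrite dotpZr.
  by rewrite mulr_le0_ge0 // ltW.
have bE : b = c d *: d.
  rewrite {1}cE (bigD1_seq d) ?simple_roots_uniq //= big_seq_cond big1 ?addr0 //.
  move=> e /andP[eD ed]; suff -> : c e = 0 by rewrite scale0r.
  move/eqP: hsum; rewrite big_seq_cond psumr_eq0 => [/allP/(_ e eD)|i /andP[iD _]]; last first.
    by rewrite mulr_ge0 ?addr_ge0 // ltW // simple_gt0.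
  rewrite eD ed /= mulf_eq0 (gt_eqF (simple_gt0 eD)) orbF paddr_eq0 //.
  by case/andP => /eqP.
have cd0 : c d != 0.
  by apply: contraTneq (Phi0 bPhi) => cd0; rewrite bE cd0 scale0r eqxx.
by rewrite bE reflmxZ.
Qed.

Definition normalized (d : 'cV[R]_n) := Num.sqrt (2 / dotp d d) *: d.

Lemma normalized_coef d : d \in D -> 0 < Num.sqrt (2 / dotp d d) :> R.
Proof. by move=> dD; rewrite sqrtr_gt0 divr_gt0 // Phi_gt0 // simple_root. Qed.

Lemma normalized_norm d : d \in D -> dotp (normalized d) (normalized d) = 2.
Proof.
move=> dD; have dd := Phi_gt0 (simple_root dD).
rewrite /normalized dotpZl dotpZr mulrA -expr2 sqr_sqrtr ?divr_ge0 ?ltW //.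
by rewrite divfK ?gt_eqF.
Qed.

Lemma normalized_obtuse d e : d \in D -> e \in D -> d != e ->
  dotp (normalized d) (normalized e) <= 0.
Proof.
move=> dD eD de; rewrite dotpZl dotpZr mulrA mulr_ge0_le0 //.
  by rewrite mulr_ge0 // ltW // normalized_coef.
exact: simple_obtuse.
Qed.

(** Distinct simple roots have nonpositive product, whereas equal normalisations would have product
    2. *)
Lemma normalized_inj : {in D &, injective normalized}.
Proof.
move=> d e dD eD E; apply/eqP; apply: contraT => /(normalized_obtuse dD eD).
by rewrite E normalized_norm // leNgt ltr0n.
Qed.

Lemma simple_system_normalized : simple_system (map normalized D).
Proof.
have hN x : x \in map normalized D -> 0 < dotp h x.
  by case/mapP => d dD ->; rewrite dotpZr mulr_gt0 ?normalized_coef ?simple_gt0.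
have oN : {in map normalized D &, forall x y, x != y -> dotp x y <= 0}.
  move=> _ _ /mapP[d dD ->] /mapP[e eD ->] de; apply: normalized_obtuse => //.
  by apply: contraNneq de => ->.
split.
- apply: obtuse_free hN oN; rewrite map_inj_in_uniq ?simple_roots_uniq //.
  exact: normalized_inj.
- by move=> _ /mapP[d dD ->]; apply: normalized_norm.
move=> x y xN yN xy; have xy0 := oN x y xN yN xy; have [hx hy] := (hN x xN, hN y yN).
have /mapP[d dD xE] := xN; have /mapP[e eD yE] := yN.
have [xx yy] : dotp x x = 2 /\ dotp y y = 2 by rewrite xE yE !normalized_norm.
(* Opposite vectors are impossible, since both are positive on [h]. *)
have gtN2 : -2 < dotp x y.
  have : 0 < dotp (x + y) (x + y).
    rewrite dotp_gt0; apply: contraTneq (addr_gt0 hx hy) => E.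
    by rewrite -dotpDr E dotp0r ltxx.
  by rewrite !dotp_lin xx yy (dotpC y x); lra.
(* The square is the product of the two Cartan integers of [d] and [e]; being less than 4, it is 0,
   1, 2 or 3. *)
have /intrP [z zE] : dotp x y ^+ 2 \is a Num.int.
  have [dd ee] := (Phi_gt0 (simple_root dD), Phi_gt0 (simple_root eD)).
  have -> : dotp x y ^+ 2 = (2 * dotp e d / dotp d d) * (2 * dotp d e / dotp e e).
    rewrite xE yE /normalized dotpZl dotpZr !exprMn !sqr_sqrtr ?divr_ge0 ?ltW //.
    by rewrite (dotpC e d) expr2; field; rewrite !gt_eqF.
  by apply: rpredM; apply: PhiZ; apply: simple_root.
have z4 : (z < 4)%R by rewrite -(ltr_int R) -zE; nra.
have z0 : (0 <= z)%R by rewrite -(ler_int R) -zE sqr_ge0.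
have xyE : dotp x y = - Num.sqrt (z%:~R).
  by rewrite -zE sqrtr_sqr ler0_norm // opprK.
have [zz|[zz|[zz|zz]]] : z = 0 \/ (z = 1 \/ (z = 2 \/ z = 3)) by lia.
all: rewrite /admissible xyE zz ?sqrtr0 ?sqrtr1 ?oppr0 ?eqxx ?orbT //.
Qed.

Lemma refl_group_normalized A : refl_group (map normalized D) A <-> weyl_group Phi A.
Proof.
split.
  apply: generated_sub => _ [_ /mapP[d dD ->] ->]; apply: generated_gen.
  by exists d; [exact: simple_root|rewrite reflmxZ // gt_eqF // normalized_coef].
apply: generated_sub => _ [a aP ->].
apply: refl_group_sub (root_refl_group aP) => d dD.
rewrite -(reflmxZ d (lt0r_neq0 (normalized_coef dD))); apply: refl_group_gen.
exact: map_f.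
Qed.

End Positive.

Lemma weyl_group_simple_system : exists2 L, simple_system L &
  forall A, refl_group L A <-> weyl_group Phi A.
Proof.
have [h hP] := @exists_generic R n Phi Phi0.
exists (map normalized (simple_roots h)); first exact: simple_system_normalized.
exact: refl_group_normalized.
Qed.

End RootSystemBase.

(** * Assembling the connected components *)

Section Main.

Variables (R : realType) (n : nat).
Implicit Types (K L : seq 'cV[R]_n).

Lemma E6_checked : check_type (E_cartan 6) E6_roots E6_centre E6_classes.
Proof. by vm_cast_no_check (erefl true). Qed.

Lemma E7_checked : check_type (E_cartan 7) E7_roots E7_centre E7_classes.
Proof. by vm_cast_no_check (erefl true). Qed.

Lemma E8_checked : check_type (E_cartan 8) E8_roots E8_centre E8_classes.
Proof. by vm_cast_no_check (erefl true). Qed.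

Lemma strongly_real_classified K : classified K -> strongly_real (refl_group K).
Proof.
case=> gK szK.
- exact: strongly_real_TypeA.
- by apply: strongly_real_TypeB => //; apply: ltnW.
- by apply: strongly_real_TypeD => //; lia.
- have [sz|[sz|sz]] : size K = 6%N \/ (size K = 7%N \/ size K = 8%N) by lia.
  + by apply: (strongly_real_E gK); rewrite sz; exact: E6_checked.
  + by apply: (strongly_real_E gK); rewrite sz; exact: E7_checked.
  + by apply: (strongly_real_E gK); rewrite sz; exact: E8_checked.
- exact: strongly_real_F4.
- exact: strongly_real_G2.
Qed.

Lemma strongly_real_orthogonal K L :
    {in K & L, forall x y, dotp x y = 0} ->
    strongly_real (refl_group K) -> strongly_real (refl_group L) ->
  strongly_real (refl_group (K ++ L)).
Proof.
move=> KL srK srL.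
have sr := strongly_real_commuting (@refl_group_involutive _ _ K)
  (@refl_group_involutive _ _ L) _ srK srL.
apply: strongly_real_eq (sr _) => [A|_ _ [x xK ->] [y yL ->]].
  split; apply: generated_sub => B.
    by case=> [[t tK ->]|[t tL ->]]; apply: generated_gen; exists t;
      rewrite // mem_cat ?tK ?tL ?orbT.
  by case=> t; rewrite mem_cat => /orP[tK|tL] ->; apply: generated_gen; [left|right]; exists t.
rewrite (orthogonal_conj_reflmx _ (orthogonal_reflmx x)).
by rewrite (reflmx_orthogonal (t := x)) // dotpC KL.
Qed.

(** Induction on the number of roots outside the component [K]. A root of [L] that meets [K] is
    absorbed; if there is none, the groups of [K] and [L] commute, and the growth restarts from the
    first root of [L], a diagram A1. *)
Lemma strongly_real_grow K L : classified K -> simple_system (K ++ L) ->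
  strongly_real (refl_group (K ++ L)).
Proof.
move: {2}_.+1 (ltnSn (size L)) => k; elim: k K L => // k IH K L Lk cK sKL.
have [/hasP [b bL /hasP [t tK bt]]|] := boolP (has (fun b => has (fun t => dotp b t != 0) K) L).
  have pL := perm_to_rem bL.
  have pKL : perm_eq (K ++ L) ((b :: K) ++ rem b L).
    by rewrite (perm_trans (perm_cat (perm_refl K) pL)) // perm_catC /= perm_cons perm_catC.
  have sbK : simple_system (b :: K).
    by apply: simple_system_sub (simple_system_perm pKL sKL); apply: prefix_subseq.
  have [K' pK' cK'] := classified_extend cK sbK tK bt.
  have pE : perm_eq (K ++ L) (K' ++ rem b L).
    by rewrite (perm_trans pKL) // perm_cat2r perm_sym.
  have sr : strongly_real (refl_group (K' ++ rem b L)).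
    apply: IH => //; last exact: simple_system_perm pE sKL.
    by rewrite (perm_size pL) /= in Lk; lia.
  by apply: strongly_real_eq sr => A; apply: refl_group_eq => x; rewrite (perm_mem pE).
rewrite -all_predC => /allP orth.
apply: strongly_real_orthogonal; last 2 first.
- exact: strongly_real_classified.
- case: L Lk sKL {orth} => [|b L] Lk sKL.
    by apply: strongly_real_trivial => A [t].
  apply: (IH [:: b] L); first by move: Lk => /=; lia.
    apply: TypeA => // i j; case: i; case: j => // _ _; rewrite /gram_chain /=.
    by case: sKL => _ nb _; apply: nb; rewrite mem_cat mem_head orbT.
  by apply: simple_system_sub sKL; apply: suffix_subseq.
move=> x y xK yL; have := orth y yL; rewrite /= -all_predC => /allP/(_ x xK) /=.
by rewrite negbK dotpC => /eqP.
Qed.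

Lemma strongly_real_weyl (Phi : {fset 'cV[R]_n}) :
  crystallographic_root_system Phi -> strongly_real (weyl_group Phi).
Proof.
move=> /weyl_group_simple_system [[|b L] sL LW]; apply: strongly_real_eq LW _.
  by apply: strongly_real_trivial => A [t].
apply: (@strongly_real_grow [:: b] L) => //.
apply: TypeA => // i j; case: i; case: j => // _ _; rewrite /gram_chain /=.
by case: sL => _ nb _; apply: nb; rewrite mem_head.
Qed.

End Main.

Theorem theorem1p1 (R : realType) (n : nat) (Phi : {fset 'cV[R]_n})
    (hPhi : crystallographic_root_system Phi) :
  [/\ (forall w : 'M[R]_n, weyl_group Phi w ->
         exists i j : 'M[R]_n,
           [/\ involution_of (weyl_group Phi) i,
               involution_of (weyl_group Phi) j
             & w = i *m j]),
      (forall w : 'M[R]_n, weyl_group Phi w ->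
         exists D : 'M[R]_n -> Prop,
           dihedral_subgroup_of (weyl_group Phi) D /\ D w)
    & (forall w : 'M[R]_n, weyl_group Phi w ->
         exists i : 'M[R]_n,
           involution_of (weyl_group Phi) i /\ i *m w *m i = invmx w)].
Proof.
have two_inv w : weyl_group Phi w -> exists i j : 'M[R]_n,
    [/\ involution_of (weyl_group Phi) i, involution_of (weyl_group Phi) j & w = i *m j].
  move=> Ww; have [i [Wi i2 iw2]] := strongly_real_weyl hPhi Ww.
  exists i, (i *m w); split=> //; last by rewrite mulmxA i2 mul1mx.
  by split=> //; apply: generated_mul.
split=> // w Ww; have [i [j [invi invj wE]]] := two_inv w Ww.
  exists (generated (fun B => B = i \/ B = j)); split; first by exists i, j; split.
  by rewrite wE; apply: generated_mul; apply: generated_gen; [left|right].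
have [[_ i2] [_ j2]] := (invi, invj).
exists i; split=> //; rewrite wE mulmxA i2 mul1mx; apply/esym/mulmx_eq1_invmx.
by rewrite mulmxA -(mulmxA i) j2 mulmx1.
Qed.
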